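(* Let $c=1.109643839000099$. There exists a smooth, even, real-valued, zero-mean function $v:\mathbb{T}\to\mathbb{R}$, $v\neq0$, which is a traveling wave with speed $c$ of the Burgers--Hilbert equation, i.e. $$c\,\partial_x v+Hv+v\,\partial_x v=0\quad\text{on }\mathbb{T}.$$ In addition, $v$ is not $\frac{2\pi}{n}$-periodic for any integer $n\ge 2$. Consequently, for every integer $n\geq 1$, the function $x\mapsto \frac1n v(nx)$ is a traveling wave of the Burgers--Hilbert equation with speed $\frac cn$ and minimal period $\frac{2\pi}{n}$.
   Context: $\mathbb{T}=\mathbb{R}/2\pi\mathbb{Z}$, and $\hat f_k=\frac1{2\pi}\int_{-\pi}^{\pi}f(x)e^{-ikx}\,dx$. $H$ is the Hilbert transform on $\mathbb{T}$: $\widehat{Hf}_k=-i\,\mathrm{sgn}(k)\hat f_k$ with $\mathrm{sgn}(0)=0$. The Burgers--Hilbert equation is $\partial_t u+Hu+u\,\partial_x u=0$; a traveling wave with speed $s\in\mathbb{R}$ is a function $w$ on $\mathbb{T}$ such that $u(x,t)=w(x+st)$ is a solution, i.e. $s\,\partial_x w+Hw+w\,\partial_x w=0$. *)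

(* Defs.v *)
From Stdlib Require Import Reals ZArith.
From Coquelicot Require Import Coquelicot.
Open Scope R_scope.

(* A function on the torus R/(2 PI Z) is a function on R with period 2 PI. *)
Definition periodic (T : R) (f : R -> R) : Prop := forall x, f (x + T) = f x.

Definition on_torus (f : R -> R) : Prop := periodic (2 * PI) f.

Definition smooth (f : R -> R) : Prop := forall (n : nat) (x : R), ex_derive_n f n x.

Definition even_function (f : R -> R) : Prop := forall x, f (- x) = f x.

Definition minimal_period (T : R) (f : R -> R) : Prop :=
  0 < T /\ periodic T f /\ forall T', 0 < T' -> periodic T' f -> T <= T'.

Definition cexp_i (t : R) : C := (cos t, sin t).

Definition fourier_coeff (f : R -> R) (k : Z) : C :=
  (RtoC (/ (2 * PI)) *
   RInt (V := C_R_CompleteNormedModule)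
     (fun x => RtoC (f x) * cexp_i (- (IZR k * x))) (- PI) PI)%C.

(* [g] is H f, through its Fourier coefficients.  Continuity of [g] makes it
   unique, since a continuous function on the torus is determined by its
   Fourier coefficients. *)
Definition is_hilbert (f g : R -> R) : Prop :=
  on_torus g /\ (forall x, continuous g x) /\
  forall k : Z,
    fourier_coeff g k = (- Ci * RtoC (IZR (Z.sgn k)) * fourier_coeff f k)%C.

(* Classical solutions, with arguments in the order [u x t]. *)
Definition burgers_hilbert_solution (u : R -> R -> R) : Prop :=
  (forall t, on_torus (fun x => u x t)) /\
  (forall x t, ex_derive (fun y => u y t) x /\ ex_derive (fun r => u x r) t) /\
  forall t, exists Hu : R -> R,
    is_hilbert (fun x => u x t) Hu /\
    forall x,
      Derive (fun r => u x r) t + Hu x + u x t * Derive (fun y => u y t) x = 0.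

Definition traveling_wave (s : R) (w : R -> R) : Prop :=
  burgers_hilbert_solution (fun x t => w (x + s * t)).

(* Main.v *)
(* Write v(x) = - w(x + PI) with w(y) = sum_{k >= 1} p_k cos(k y). Integrating the
   equation once turns it into (c - 1/k) p_k = Q_k(p) for k >= 1, where Q_k(p) is the
   k-th cosine coefficient of w^2 / 2, a quadratic form with nonnegative coefficients.
   For fixed p_1 = a and p_2 = b the equations with k >= 3 are solved by monotone
   iteration from 0; every iterate is a polynomial in (a, b) with nonnegative
   coefficients, so boundedness at one corner of a box of parameters gives convergence,
   monotonicity and continuity on the whole box. Boundedness and two-sided estimates of
   the limit come from numerical approximate solutions and a weighted l^1 norm in which
   the linearisation has norm at most 991/1000; the weights eventually grow
   geometrically, which makes the p_k decay exponentially. The two remaining equations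
   (k = 1, 2) are solved for (a, b) by applying the intermediate value theorem twice:
   the first one determines b as a continuous function of a, and the residual of the
   second one changes sign along this curve. *)

Require Import Defs.
From Stdlib Require Import Reals ZArith Arith Bool Lra Lia List.
From Stdlib Require Import ClassicalEpsilon FunctionalExtensionality.
From Coquelicot Require Import Coquelicot.
Import ListNotations.
Open Scope R_scope.

(** * Cosine convolutions and the monotone iteration *)

(** The minus sign in v(x) = - w(x + PI) reverses the sign of the nonlinearity; this is what puts a
    form with nonnegative coefficients on the right of (c - 1/k) p_k = Q_k(p) and allows comparison
    arguments throughout. Iterating all the equations at once would fail: Q is homogeneous of degree
    two, so at a solution p the linearisation of p_k -> Q_k(p) / (c - 1/k) maps p to 2 p. Freezing
    p_1 and p_2 leaves a contraction, but a narrow one: residual and quadratic error must fit into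
    the margin 9/1000, hence the long tables with ten digits. Errors are one-sided. Upper bounds
    follow the iteration from 0 by induction; lower bounds use that the limit is a supersolution of
    the truncated equations. Signs on whole sides of the parameter box come from single corners: Q_1
    and Q_2 increase in a and b, and by a parity argument even Q_1 / a increases in a. Three corners
    are needed: the largest for boundedness, two others for the signs. *)

Fixpoint rsum (n : nat) (f : nat -> R) : R :=
  match n with O => 0 | S m => rsum m f + f m end.

Lemma rsum_ext (n : nat) (f g : nat -> R) :
  (forall i, (i < n)%nat -> f i = g i) -> rsum n f = rsum n g.
Proof.
  induction n as [|n IH]; intros H; simpl; [reflexivity|].
  rewrite IH, H; auto; intros; apply H; lia.
Qed.

Lemma rsum_le (n : nat) (f g : nat -> R) :
  (forall i, (i < n)%nat -> f i <= g i) -> rsum n f <= rsum n g.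
Proof.
  induction n as [|n IH]; intros H; simpl; [lra|].
  apply Rplus_le_compat; [apply IH; intros; apply H; lia | apply H; lia].
Qed.

Lemma rsum_plus (n : nat) (f g : nat -> R) :
  rsum n (fun i => f i + g i) = rsum n f + rsum n g.
Proof. induction n as [|n IH]; simpl; [|rewrite IH]; ring. Qed.

Lemma rsum_scal (n : nat) (a : R) (f : nat -> R) :
  rsum n (fun i => a * f i) = a * rsum n f.
Proof. induction n as [|n IH]; simpl; [|rewrite IH]; ring. Qed.

Lemma rsum_zero (n : nat) (f : nat -> R) :
  (forall i, (i < n)%nat -> f i = 0) -> rsum n f = 0.
Proof.
  induction n as [|n IH]; intros H; simpl; [reflexivity|].
  rewrite IH, H; auto; try ring; intros; apply H; lia.
Qed.

Lemma rsum_nonneg (n : nat) (f : nat -> R) :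
  (forall i, (i < n)%nat -> 0 <= f i) -> 0 <= rsum n f.
Proof.
  intros H. rewrite <- (rsum_zero n (fun _ => 0)); auto. now apply rsum_le.
Qed.

Lemma rsum_split (n m : nat) (f : nat -> R) :
  rsum (n + m) f = rsum n f + rsum m (fun i => f (n + i)%nat).
Proof.
  induction m as [|m IH]; simpl.
  - rewrite Nat.add_0_r; ring.
  - rewrite <- plus_n_Sm; simpl; rewrite IH; ring.
Qed.

Lemma rsum_mono (n m : nat) (f : nat -> R) :
  (forall i, 0 <= f i) -> (n <= m)%nat -> rsum n f <= rsum m f.
Proof.
  intros Hf Hnm. replace m with (n + (m - n))%nat by lia.
  rewrite rsum_split. assert (H := rsum_nonneg (m - n) (fun i => f (n + i)%nat)).
  assert (0 <= rsum (m - n) (fun i => f (n + i)%nat)) by (apply H; auto). lra.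
Qed.

Lemma rsum_support (n m : nat) (f : nat -> R) :
  (forall i, (n <= i)%nat -> f i = 0) -> (n <= m)%nat -> rsum m f = rsum n f.
Proof.
  intros Hf Hnm. replace m with (n + (m - n))%nat by lia.
  rewrite rsum_split, (rsum_zero (m - n)); [ring|]. intros; apply Hf; lia.
Qed.

Lemma rsum_support_le (n m : nat) (f : nat -> R) :
  (forall i, 0 <= f i) -> (forall i, (n <= i)%nat -> f i = 0) -> rsum m f <= rsum n f.
Proof.
  intros H0 Hf. destruct (le_lt_dec n m).
  - rewrite (rsum_support n m); auto; lra.
  - apply rsum_mono; auto; lia.
Qed.

Lemma rsum_first (n : nat) (f : nat -> R) :
  rsum (S n) f = f 0%nat + rsum n (fun i => f (S i)).
Proof. rewrite <- (Nat.add_1_l n), rsum_split. simpl. ring. Qed.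

Lemma rsum_rev (n : nat) (f : nat -> R) :
  rsum (S n) (fun i => f (n - i)%nat) = rsum (S n) f.
Proof.
  induction n as [|n IH]; [reflexivity|].
  rewrite rsum_first, Nat.sub_0_r.
  rewrite (rsum_ext (S n) _ (fun i => f (n - i)%nat)) by (intros; f_equal; lia).
  rewrite IH. simpl. ring.
Qed.

Lemma rsum_switch (n m : nat) (f : nat -> nat -> R) :
  rsum n (fun i => rsum m (f i)) = rsum m (fun j => rsum n (fun i => f i j)).
Proof.
  induction n as [|n IH]; simpl.
  - symmetry; now apply rsum_zero.
  - rewrite IH, <- rsum_plus. reflexivity.
Qed.

Lemma rsum_term (n k : nat) (f : nat -> R) :
  (forall i, 0 <= f i) -> (k < n)%nat -> f k <= rsum n f.
Proof.
  intros Hf Hk. apply Rle_trans with (rsum (S k) f).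
  - simpl. assert (0 <= rsum k f) by (apply rsum_nonneg; auto). lra.
  - now apply rsum_mono.
Qed.

(* Subtraction of naturals truncates, so the first index is |k - m|. *)
Definition kernel (x : nat -> R) (k m : nat) : R :=
  x ((k - m) + (m - k))%nat + x (k + m)%nat.

Definition bilin (x y : nat -> R) (K k : nat) : R :=
  rsum K (fun m => x m * kernel y k m).

(* For k >= 1 this is the k-th cosine coefficient of w^2 / 2 when x is supported
   in [1, K) and w(y) = sum_k x_k cos(k y). *)
Definition quad (K : nat) (x : nat -> R) (k : nat) : R := / 4 * bilin x x K k.

Definition nonneg (x : nat -> R) : Prop := forall k, 0 <= x k.

Lemma kernel_nonneg (x : nat -> R) (k m : nat) : nonneg x -> 0 <= kernel x k m.
Proof. intros H. apply Rplus_le_le_0_compat; apply H. Qed.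

Lemma kernel_sym (x : nat -> R) (k m : nat) : kernel x k m = kernel x m k.
Proof. unfold kernel. now rewrite (Nat.add_comm (k - m)), (Nat.add_comm k). Qed.

Lemma kernel_le (x y : nat -> R) (k m : nat) :
  (forall i, x i <= y i) -> kernel x k m <= kernel y k m.
Proof. intros H. apply Rplus_le_compat; apply H. Qed.

Lemma bilin_le (x x' y y' : nat -> R) (K K' k : nat) :
  nonneg x -> nonneg y -> (forall i, x i <= x' i) -> (forall i, y i <= y' i) ->
  (K <= K')%nat -> bilin x y K k <= bilin x' y' K' k.
Proof.
  intros Hx Hy Hxx Hyy HK. unfold bilin.
  apply Rle_trans with (rsum K' (fun m => x m * kernel y k m)).
  - apply rsum_mono; auto. intros i. apply Rmult_le_pos; auto using kernel_nonneg.
  - apply rsum_le; intros i _.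
    apply Rmult_le_compat; auto using kernel_nonneg, kernel_le.
Qed.

Lemma bilin_nonneg (x y : nat -> R) (K k : nat) :
  nonneg x -> nonneg y -> 0 <= bilin x y K k.
Proof.
  intros Hx Hy. apply rsum_nonneg; intros.
  apply Rmult_le_pos; auto using kernel_nonneg.
Qed.

(* The full sums are equal; truncating them costs a shift of the bound. *)
Lemma bilin_comm_le (x y : nat -> R) (K k : nat) :
  nonneg x -> nonneg y -> x 0%nat = 0 -> y 0%nat = 0 ->
  bilin x y K k <= bilin y x (S k + K) k.
Proof.
  intros Hx Hy Hx0 Hy0. unfold bilin, kernel.
  set (d := fun m => ((k - m) + (m - k))%nat).
  assert (E : forall u v n, rsum n (fun m => u m * (v (d m) + v (k + m)%nat))
     = rsum n (fun m => u m * v (d m)) + rsum n (fun m => u m * v (k + m)%nat)).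
  { intros u v n. rewrite <- rsum_plus. apply rsum_ext; intros; ring. }
  fold d. rewrite !E.
  assert (F : forall u v, rsum (S k + K) (fun m => u m * v (d m)) =
     rsum (S k) (fun m => u m * v (k - m)%nat)
     + rsum K (fun j => u (S k + j)%nat * v (S j))).
  { intros u v. rewrite rsum_split. f_equal; apply rsum_ext; intros i Hi; unfold d;
      do 2 f_equal; lia. }
  assert (G : forall u v, u 0%nat = 0 -> nonneg u -> nonneg v ->
     rsum K (fun m => u m * v (k + m)%nat) <= rsum K (fun j => u (S j) * v (S k + j)%nat)).
  { intros u v Hu0 Hu Hv.
    apply Rle_trans with (rsum (S K) (fun m => u m * v (k + m)%nat)).
    - apply rsum_mono; [intros; apply Rmult_le_pos; auto | lia].
    - rewrite rsum_first, Hu0, Rmult_0_l, Rplus_0_l. right.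
      apply rsum_ext; intros; do 2 f_equal; lia. }
  assert (G' : rsum K (fun j => y (S j) * x (S k + j)%nat)
               <= rsum (S k + K) (fun m => y m * x (k + m)%nat)).
  { apply Rle_trans with (rsum (S K) (fun m => y m * x (k + m)%nat)).
    - rewrite rsum_first, Hy0, Rmult_0_l, Rplus_0_l. right.
      apply rsum_ext; intros; do 2 f_equal; lia.
    - apply rsum_mono; [intros; apply Rmult_le_pos; auto | lia]. }
  assert (H1 : rsum K (fun m => x m * y (d m)) <= rsum (S k + K) (fun m => x m * y (d m))).
  { apply rsum_mono; [intros; apply Rmult_le_pos; auto | lia]. }
  rewrite F in H1. rewrite F.
  assert (H2 : rsum (S k) (fun m => x m * y (k - m)%nat)
               = rsum (S k) (fun m => y m * x (k - m)%nat)).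
  { rewrite <- (rsum_rev k (fun m => y m * x (k - m)%nat)).
    apply rsum_ext; intros i Hi. replace (k - (k - i))%nat with i by lia. ring. }
  assert (H3 : rsum K (fun j => x (S k + j)%nat * y (S j))
               = rsum K (fun j => y (S j) * x (S k + j)%nat)).
  { apply rsum_ext; intros; ring. }
  assert (H4 : rsum K (fun j => x (S j) * y (S k + j)%nat)
               = rsum K (fun j => y (S k + j)%nat * x (S j))).
  { apply rsum_ext; intros; ring. }
  specialize (G x y Hx0 Hx Hy). lra.
Qed.

Lemma quad_le (x y : nat -> R) (K K' k : nat) :
  nonneg x -> (forall i, x i <= y i) -> (K <= K')%nat -> quad K x k <= quad K' y k.
Proof.
  intros Hx Hxy HK. unfold quad. apply Rmult_le_compat_l; [lra|].
  now apply bilin_le.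
Qed.

Lemma quad_nonneg (x : nat -> R) (K k : nat) : nonneg x -> 0 <= quad K x k.
Proof.
  intros Hx. apply Rmult_le_pos; [lra|]. now apply bilin_nonneg.
Qed.

Definition speed : R := 1.109643839000099.

Definition symbol (k : nat) : R := speed - / INR k.

Lemma symbol_pos (k : nat) : (1 <= k)%nat -> 0 < symbol k.
Proof.
  intros Hk. unfold symbol, speed. apply le_INR in Hk. simpl in Hk.
  assert (/ INR k <= / 1) by (apply Rinv_le_contravar; lra). lra.
Qed.

Definition seed (a b : R) (k : nat) : R :=
  match k with 1%nat => a | 2%nat => b | _ => 0 end.

(** The step number doubles as the truncation of the convolution. Every iterate is then a finite
    polynomial in [(a, b)], and since all terms are nonnegative, the widening range only helps the
    monotonicity in [n]. *)
Fixpoint approx (a b : R) (n k : nat) : R :=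
  match n with
  | O => seed a b k
  | S n' => if (k <=? 2)%nat then seed a b k else quad n' (approx a b n') k / symbol k
  end.

Definition coef (a b : R) (n k : nat) : R := quad n (approx a b n) k.

Lemma approx_low (a b : R) (n k : nat) : (k <= 2)%nat -> approx a b n k = seed a b k.
Proof.
  intros Hk. destruct n; simpl; auto. apply Nat.leb_le in Hk. now rewrite Hk.
Qed.

Lemma approx_S (a b : R) (n k : nat) :
  (3 <= k)%nat -> approx a b (S n) k = coef a b n k / symbol k.
Proof.
  intros Hk. simpl. destruct (Nat.leb_spec k 2); [lia | reflexivity].
Qed.

Lemma approx_0 (a b : R) (n : nat) : approx a b n 0 = 0.
Proof. now rewrite approx_low by lia. Qed.

Lemma seed_nonneg (a b : R) : 0 <= a -> 0 <= b -> nonneg (seed a b).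
Proof. intros Ha Hb [|[|[|k]]]; simpl; lra. Qed.

Lemma div_symbol_le (k : nat) (x y : R) :
  (3 <= k)%nat -> x <= y -> x / symbol k <= y / symbol k.
Proof.
  intros Hk Hxy. apply Rmult_le_compat_r; auto.
  apply Rlt_le, Rinv_0_lt_compat, symbol_pos; lia.
Qed.

Lemma approx_nonneg (a b : R) (n : nat) : 0 <= a -> 0 <= b -> nonneg (approx a b n).
Proof.
  intros Ha Hb. induction n as [|n IH]; intros k.
  - now apply seed_nonneg.
  - destruct (le_lt_dec k 2).
    + rewrite approx_low by auto. now apply seed_nonneg.
    + rewrite approx_S by auto. apply Rmult_le_pos.
      * now apply quad_nonneg.
      * apply Rlt_le, Rinv_0_lt_compat, symbol_pos; lia.
Qed.

Lemma approx_incr (a b : R) (n k : nat) :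
  0 <= a -> 0 <= b -> approx a b n k <= approx a b (S n) k.
Proof.
  intros Ha Hb. revert k. induction n as [|n IH]; intros k;
    (destruct (le_lt_dec k 2); [rewrite !approx_low by auto; lra|]).
  - replace (approx a b 0 k) with 0 by (destruct k as [|[|[|k]]]; simpl; auto; lia).
    now apply approx_nonneg.
  - rewrite !approx_S by auto. apply div_symbol_le; auto.
    apply quad_le; auto using approx_nonneg.
Qed.

Lemma coef_incr (a b : R) (n k : nat) :
  0 <= a -> 0 <= b -> coef a b n k <= coef a b (S n) k.
Proof.
  intros Ha Hb. apply quad_le; auto using approx_nonneg, approx_incr.
Qed.

Lemma approx_le (a b a' b' : R) (n k : nat) :
  0 <= a <= a' -> 0 <= b <= b' -> approx a b n k <= approx a' b' n k.
Proof.
  intros Ha Hb. revert k. induction n as [|n IH]; intros k.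
  - destruct k as [|[|[|k]]]; simpl; lra.
  - destruct (le_lt_dec k 2).
    + rewrite !approx_low by auto. destruct k as [|[|[|k]]]; simpl; lra.
    + rewrite !approx_S by auto. apply div_symbol_le; auto.
      apply quad_le; auto. apply approx_nonneg; lra.
Qed.

Lemma coef_le (a b a' b' : R) (n k : nat) :
  0 <= a <= a' -> 0 <= b <= b' -> coef a b n k <= coef a' b' n k.
Proof.
  intros Ha Hb. apply quad_le; auto using approx_le. apply approx_nonneg; lra.
Qed.

(** In [y * v - x * u = (y - x) * v + x * (v - u)] every factor on the right is nonnegative and does
    not decrease when primes are added. *)
Lemma product_gap (x x' y y' u u' v v' : R) :
  0 <= x <= x' -> x <= y -> 0 <= u <= u' -> u <= v ->
  y - x <= y' - x' -> v - u <= v' - u' ->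
  y * v - x * u <= y' * v' - x' * u'.
Proof. intros. nra. Qed.

Lemma quad_gap (x x' y y' : nat -> R) (K k : nat) :
  nonneg x -> (forall i, x i <= x' i) -> (forall i, x i <= y i) ->
  (forall i, y i - x i <= y' i - x' i) ->
  quad (S K) y k - quad K x k <= quad (S K) y' k - quad K x' k.
Proof.
  intros Hx Hxx Hxy Hgap.
  assert (Hk : forall m, kernel x k m <= kernel x' k m /\ kernel x k m <= kernel y k m
     /\ kernel y k m - kernel x k m <= kernel y' k m - kernel x' k m).
  { intros m. repeat split; try now apply kernel_le. unfold kernel.
    assert (A := Hgap (k - m + (m - k))%nat). assert (B := Hgap (k + m)%nat). lra. }
  assert (H : rsum K (fun m => y m * kernel y k m) - rsum K (fun m => x m * kernel x k m)
     <= rsum K (fun m => y' m * kernel y' k m) - rsum K (fun m => x' m * kernel x' k m)).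
  { induction K as [|K IH]; simpl; [lra|].
    assert (P : y K * kernel y k K - x K * kernel x k K
                <= y' K * kernel y' k K - x' K * kernel x' k K).
    { destruct (Hk K) as (H1 & H2 & H3). apply product_gap; auto.
      split; auto. now apply kernel_nonneg. }
    lra. }
  (* The sum for [y] has one term more than the sum for [x], at [m = K]; nothing is subtracted from
     it, so it is compared directly. *)
  assert (P : y K * kernel y k K <= y' K * kernel y' k K).
  { destruct (Hk K) as (H1 & H2 & H3).
    assert (0 <= kernel x k K) by now apply kernel_nonneg.
    assert (A := Hx K). assert (B := Hxx K). assert (C := Hxy K). assert (D := Hgap K).
    apply Rmult_le_compat; lra. }
  unfold quad, bilin. simpl. lra.
Qed.

(* Each step of the iteration adds a polynomial in (a, b) with nonnegative
   coefficients. *)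
Lemma approx_gap (a b a' b' : R) (n k : nat) :
  0 <= a <= a' -> 0 <= b <= b' ->
  approx a b (S n) k - approx a b n k <= approx a' b' (S n) k - approx a' b' n k.
Proof.
  intros Ha Hb. revert k. induction n as [|n IH]; intros k;
    (destruct (le_lt_dec k 2); [rewrite !approx_low by auto; lra|]).
  - assert (E : forall s t, approx s t 0 k = 0)
      by (intros; destruct k as [|[|[|k]]]; simpl; auto; lia).
    rewrite !E. assert (H := approx_le a b a' b' 1 k Ha Hb). lra.
  - rewrite !approx_S by auto.
    assert (H : coef a b (S n) k - coef a b n k <= coef a' b' (S n) k - coef a' b' n k).
    { apply quad_gap; auto using approx_le.
      - apply approx_nonneg; lra.
      - intros; apply approx_incr; lra. }
    apply (div_symbol_le k) in H; [|auto]. unfold Rdiv in *. lra.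
Qed.

Lemma coef_gap (a b a' b' : R) (n k : nat) :
  0 <= a <= a' -> 0 <= b <= b' ->
  coef a b (S n) k - coef a b n k <= coef a' b' (S n) k - coef a' b' n k.
Proof.
  intros Ha Hb. apply quad_gap; auto using approx_le, approx_gap.
  - apply approx_nonneg; lra.
  - intros; apply approx_incr; lra.
Qed.

(** * The limit of the iteration as a function of the first two amplitudes *)

Lemma growing_limit (u : nat -> R) (M : R) :
  (forall n, u n <= u (S n)) -> (forall n, u n <= M) -> is_lim_seq u (real (Lim_seq u)).
Proof.
  intros Hi Hb. apply Lim_seq_correct'. now apply ex_finite_lim_seq_incr with M.
Qed.

Definition amp (a b : R) (k : nat) : R := real (Lim_seq (fun n => approx a b n k)).

Definition coef_lim (a b : R) (k : nat) : R := real (Lim_seq (fun n => coef a b n k)).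

Lemma Nat_odd_dist (k m : nat) :
  Nat.odd (k - m + (m - k)) = xorb (Nat.odd k) (Nat.odd m).
Proof.
  destruct (le_lt_dec k m).
  - replace (k - m)%nat with 0%nat by lia. simpl. rewrite Nat.odd_sub by auto.
    now destruct (Nat.odd k), (Nat.odd m).
  - replace (m - k)%nat with 0%nat by lia. rewrite Nat.add_0_r. apply Nat.odd_sub. lia.
Qed.

Section Scaling.
Variable t : R.
Hypothesis Ht : 1 <= t.
Let s (k : nat) : R := if Nat.odd k then t else 1.

(** The two indices of a product contributing to coefficient [k] have a sum of the parity of [k], so
    an odd [k] requires an odd factor and [s k <= s m * s j]. Enlarging the odd amplitudes by [t]
    thus enlarges the odd coefficients at least by [t]. *)
Lemma quad_scaling (x y : nat -> R) (K k : nat) :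
  nonneg x -> (forall i, s i * x i <= y i) -> s k * quad K x k <= quad K y k.
Proof.
  intros Hx Hxy. unfold quad, bilin.
  replace (s k * (/ 4 * rsum K (fun m => x m * kernel x k m)))
    with (/ 4 * (s k * rsum K (fun m => x m * kernel x k m))) by ring.
  apply Rmult_le_compat_l; [lra|]. rewrite <- rsum_scal. apply rsum_le; intros m _.
  assert (Hs : forall i, 1 <= s i) by (intros i; unfold s; destruct (Nat.odd i); lra).
  assert (P : forall j, s k <= s m * s j -> s k * (x m * x j) <= y m * y j).
  { intros j Hj. assert (A := Hx m). assert (B := Hx j).
    assert (C := Hxy m). assert (D := Hxy j). assert (E := Hs m). assert (F := Hs j).
    apply Rle_trans with ((s m * x m) * (s j * x j)).
    - assert (0 <= x m * x j) by (apply Rmult_le_pos; lra).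
      replace (s m * x m * (s j * x j)) with (s m * s j * (x m * x j)) by ring.
      apply Rmult_le_compat_r; lra.
    - apply Rmult_le_compat; auto; apply Rmult_le_pos; lra. }
  unfold kernel. rewrite !Rmult_plus_distr_l.
  apply Rplus_le_compat; apply P; unfold s; rewrite ?Nat_odd_dist, ?Nat.odd_add;
    destruct (Nat.odd k), (Nat.odd m); simpl; nra.
Qed.

Lemma approx_scaling (a b : R) (n k : nat) :
  0 <= a -> 0 <= b -> s k * approx a b n k <= approx (t * a) b n k.
Proof.
  intros Ha Hb. revert k.
  assert (L : forall k, s k * seed a b k <= seed (t * a) b k).
  { intros [|[|[|k]]]; unfold s; simpl; try destruct (Nat.odd k); lra. }
  induction n as [|n IH]; intros k.
  - apply L.
  - destruct (le_lt_dec k 2).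
    + rewrite !approx_low by auto. apply L.
    + rewrite !approx_S by auto. unfold Rdiv. rewrite <- Rmult_assoc.
      apply div_symbol_le; auto. apply quad_scaling; auto. now apply approx_nonneg.
Qed.

(** Both sides of the equation for k = 1 grow with [a], so monotonicity alone does not carry a sign
    from one [a] to another; monotonicity of the quotient [coef a b n 1 / a] does. *)
Lemma coef1_scaling (a b : R) (n : nat) :
  0 <= a -> 0 <= b -> t * coef a b n 1 <= coef (t * a) b n 1.
Proof.
  intros Ha Hb. apply (quad_scaling (approx a b n) (approx (t * a) b n) n 1).
  - now apply approx_nonneg.
  - intros; now apply approx_scaling.
Qed.
End Scaling.

Lemma ivt_modulus (f : R -> R) (x y : R) :
  x <= y ->
  (forall eps, 0 < eps -> exists delta, 0 < delta /\
     forall s t, x <= s <= y -> x <= t <= y -> Rabs (s - t) < delta ->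
       Rabs (f s - f t) < eps) ->
  f x <= 0 -> 0 <= f y -> exists z, x <= z <= y /\ f z = 0.
Proof.
  intros Hxy Hf Hx Hy.
  destruct (Req_dec (f x) 0) as [E|Nx]; [exists x; split; [lra|auto]|].
  destruct (Req_dec (f y) 0) as [E|Ny]; [exists y; split; [lra|auto]|].
  assert (x <> y) by (intros ->; lra).
  (* [IVT] asks for continuity on the whole line; composing with the projection onto [[x, y]], which
     is 1-Lipschitz, provides it. *)
  set (cl := fun t => Rmax x (Rmin t y)).
  assert (Hcl : forall t, x <= cl t <= y).
  { intros t. unfold cl, Rmax, Rmin. repeat destruct (Rle_dec _ _); lra. }
  assert (Hcl2 : forall t, x <= t <= y -> cl t = t).
  { intros t Ht. unfold cl, Rmax, Rmin. repeat destruct (Rle_dec _ _); lra. }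
  assert (Hcl3 : forall s t, Rabs (cl s - cl t) <= Rabs (s - t)).
  { intros s t. unfold cl, Rmax, Rmin, Rabs.
    repeat destruct (Rle_dec _ _); repeat destruct (Rcase_abs _); lra. }
  destruct (IVT (fun t => f (cl t)) x y) as [z [Hz1 Hz2]].
  - intros a eps Heps. destruct (Hf eps Heps) as [d [Hd H']].
    exists d. split; [auto|]. intros t [_ Ht]. apply H'; auto.
    eapply Rle_lt_trans; [apply Hcl3|]. exact Ht.
  - lra.
  - rewrite Hcl2; lra.
  - rewrite Hcl2; lra.
  - exists z. rewrite Hcl2 in Hz2; auto.
Qed.

Section Box.
Variables aM bM B : R.
Hypothesis HaM : 0 < aM.
Hypothesis HbM : 0 < bM.
Hypothesis approx_bound : forall n k, approx aM bM n k <= B.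
Hypothesis coef_bound : forall n k, (1 <= k)%nat -> coef aM bM n k <= B.

Let inbox (a b : R) : Prop := 0 <= a <= aM /\ 0 <= b <= bM.

Lemma B_nonneg : 0 <= B.
Proof. rewrite <- (approx_0 aM bM 0). apply approx_bound. Qed.

Lemma amp_lim (a b : R) (k : nat) :
  inbox a b -> is_lim_seq (fun n => approx a b n k) (amp a b k).
Proof.
  intros [Ha Hb]. apply growing_limit with B.
  - intros n; apply approx_incr; lra.
  - intros n. apply Rle_trans with (approx aM bM n k); auto. now apply approx_le.
Qed.

Lemma coef_lim_lim (a b : R) (k : nat) :
  (1 <= k)%nat -> inbox a b -> is_lim_seq (fun n => coef a b n k) (coef_lim a b k).
Proof.
  intros Hk [Ha Hb]. apply growing_limit with B.
  - intros n; apply coef_incr; lra.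
  - intros n. apply Rle_trans with (coef aM bM n k); auto. now apply coef_le.
Qed.

Lemma approx_le_amp (a b : R) (n k : nat) : inbox a b -> approx a b n k <= amp a b k.
Proof.
  intros H. apply (is_lim_seq_incr_compare (fun n => approx a b n k)).
  - now apply amp_lim.
  - destruct H; intros; apply approx_incr; lra.
Qed.

Lemma coef_le_lim (a b : R) (n k : nat) :
  (1 <= k)%nat -> inbox a b -> coef a b n k <= coef_lim a b k.
Proof.
  intros Hk H. apply (is_lim_seq_incr_compare (fun n => coef a b n k)).
  - now apply coef_lim_lim.
  - destruct H; intros; apply coef_incr; lra.
Qed.

Lemma coef_lim_le (a b a' b' : R) (k : nat) :
  (1 <= k)%nat -> inbox a b -> inbox a' b' -> a <= a' -> b <= b' ->
  coef_lim a b k <= coef_lim a' b' k.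
Proof.
  intros Hk [Ha Hb] [Ha' Hb'] Hle1 Hle2.
  apply (is_lim_seq_le (fun n => coef a b n k) (fun n => coef a' b' n k)
           (coef_lim a b k) (coef_lim a' b' k)).
  - intros n; apply coef_le; lra.
  - apply coef_lim_lim; auto; split; lra.
  - apply coef_lim_lim; auto; split; lra.
Qed.

(** Obtained by summing [coef_gap] over all steps after [n]. The tail at the corner [(aM, bM)]
    dominates every other tail, so the convergence is uniform on the box. *)
Lemma coef_lim_gap (a b a' b' : R) (n k : nat) :
  (1 <= k)%nat -> inbox a b -> inbox a' b' -> a <= a' -> b <= b' ->
  coef_lim a b k - coef a b n k <= coef_lim a' b' k - coef a' b' n k.
Proof.
  intros Hk [Ha Hb] [Ha' Hb'] Hle1 Hle2.
  assert (H : forall m, coef a b (m + n) k - coef a b n k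
                        <= coef a' b' (m + n) k - coef a' b' n k).
  { induction m as [|m IH]; simpl; [lra|].
    assert (G := coef_gap a b a' b' (m + n) k). lra. }
  apply (is_lim_seq_le (fun m => coef a b (m + n) k - coef a b n k)
                       (fun m => coef a' b' (m + n) k - coef a' b' n k)
           (coef_lim a b k - coef a b n k) (coef_lim a' b' k - coef a' b' n k)); auto.
  - apply is_lim_seq_minus'; [|apply is_lim_seq_const].
    apply (is_lim_seq_incr_n (fun m => coef a b m k)). apply coef_lim_lim; auto; split; lra.
  - apply is_lim_seq_minus'; [|apply is_lim_seq_const].
    apply (is_lim_seq_incr_n (fun m => coef a' b' m k)). apply coef_lim_lim; auto; split; lra.
Qed.

Let lipschitz (f : R -> R -> R) : Prop :=
  exists L, 0 <= L /\ forall a b a' b', inbox a b -> inbox a' b' ->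
    Rabs (f a b - f a' b') <= L * (Rabs (a - a') + Rabs (b - b')).

Lemma lipschitz_plus (f g : R -> R -> R) :
  lipschitz f -> lipschitz g -> lipschitz (fun a b => f a b + g a b).
Proof.
  intros [L [HL Hf]] [M [HM Hg]]. exists (L + M). split; [lra|]. intros a b a' b' H H'.
  replace (f a b + g a b - (f a' b' + g a' b'))
    with ((f a b - f a' b') + (g a b - g a' b')) by ring.
  eapply Rle_trans; [apply Rabs_triang|].
  specialize (Hf a b a' b' H H'). specialize (Hg a b a' b' H H'). lra.
Qed.

Lemma lipschitz_mult (f g : R -> R -> R) :
  (forall a b, inbox a b -> Rabs (f a b) <= B) ->
  (forall a b, inbox a b -> Rabs (g a b) <= B) ->
  lipschitz f -> lipschitz g -> lipschitz (fun a b => f a b * g a b).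
Proof.
  intros Bf Bg [L [HL Hf]] [M [HM Hg]]. assert (HB := B_nonneg).
  exists (B * M + B * L). split; [nra|]. intros a b a' b' H H'.
  replace (f a b * g a b - f a' b' * g a' b')
    with (f a b * (g a b - g a' b') + g a' b' * (f a b - f a' b')) by ring.
  eapply Rle_trans; [apply Rabs_triang|]. rewrite !Rabs_mult.
  specialize (Hf a b a' b' H H'). specialize (Hg a b a' b' H H').
  specialize (Bf a b H). specialize (Bg a' b' H').
  rewrite Rmult_plus_distr_r.
  apply Rplus_le_compat; rewrite Rmult_assoc; apply Rmult_le_compat; auto using Rabs_pos.
Qed.

Lemma lipschitz_scal (t : R) (f : R -> R -> R) :
  lipschitz f -> lipschitz (fun a b => t * f a b).
Proof.
  intros [L [HL Hf]]. exists (Rabs t * L). split.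
  - apply Rmult_le_pos; auto using Rabs_pos.
  - intros a b a' b' H H'. rewrite <- Rmult_minus_distr_l, Rabs_mult, Rmult_assoc.
    apply Rmult_le_compat_l; auto using Rabs_pos.
Qed.

Lemma lipschitz_rsum (K : nat) (f : nat -> R -> R -> R) :
  (forall m, lipschitz (f m)) -> lipschitz (fun a b => rsum K (fun m => f m a b)).
Proof.
  intros Hf. induction K as [|K IH]; simpl.
  - exists 0. split; [lra|]. intros. rewrite Rminus_0_r, Rabs_R0. lra.
  - now apply lipschitz_plus.
Qed.

Lemma approx_abs_bound (a b : R) (n k : nat) : inbox a b -> Rabs (approx a b n k) <= B.
Proof.
  intros [Ha Hb]. rewrite Rabs_pos_eq by (apply approx_nonneg; lra).
  apply Rle_trans with (approx aM bM n k); auto. now apply approx_le.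
Qed.

Lemma coef_lipschitz_step (n k : nat) :
  (forall j, lipschitz (fun a b => approx a b n j)) -> lipschitz (fun a b => coef a b n k).
Proof.
  intros H. unfold coef, quad, bilin. apply lipschitz_scal, lipschitz_rsum. intros m.
  unfold kernel.
  set (j1 := (k - m + (m - k))%nat). set (j2 := (k + m)%nat).
  assert (P : forall j, lipschitz (fun a b => approx a b n m * approx a b n j)).
  { intros j. apply lipschitz_mult; auto using approx_abs_bound. }
  destruct (lipschitz_plus _ _ (P j1) (P j2)) as [L [HL HP]].
  exists L. split; auto. intros a b a' b' H1 H2.
  rewrite 2(Rmult_plus_distr_l (approx _ _ n m)). now apply HP.
Qed.

Lemma approx_lipschitz (n k : nat) : lipschitz (fun a b => approx a b n k).
Proof.
  assert (S0 : lipschitz (fun a b => seed a b k)).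
  { exists 1. split; [lra|]. intros a b a' b' _ _.
    assert (A := Rabs_pos (a - a')). assert (A' := Rabs_pos (b - b')).
    destruct k as [|[|[|k']]]; simpl; rewrite ?Rminus_0_r, ?Rabs_R0; lra. }
  revert k S0. induction n as [|n IH]; intros k S0; [exact S0|].
  destruct (le_lt_dec k 2) as [Hk|Hk].
  - destruct S0 as [L [HL H]]. exists L. split; auto. intros. rewrite !approx_low by auto. auto.
  - assert (Hc : lipschitz (fun a b => coef a b n k)).
    { apply coef_lipschitz_step. intros j. apply IH. exists 1. split; [lra|].
      intros a b a' b' _ _.
      assert (A := Rabs_pos (a - a')). assert (A' := Rabs_pos (b - b')).
      destruct j as [|[|[|j']]]; simpl; rewrite ?Rminus_0_r, ?Rabs_R0; lra. }
    destruct (lipschitz_scal (/ symbol k) _ Hc) as [L [HL H]].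
    exists L. split; auto. intros. rewrite !approx_S by auto. unfold Rdiv.
    rewrite !(Rmult_comm (coef _ _ _ _)). auto.
Qed.

(** A uniform limit of Lipschitz functions: an [n] chosen at the corner [(aM, bM)] leaves a tail
    below [eps / 4] on the whole box, and the polynomial [coef a b n k] is Lipschitz there. *)
Lemma coef_lim_modulus (k : nat) (eps : R) :
  (1 <= k)%nat -> 0 < eps -> exists delta, 0 < delta /\
  forall a b a' b', inbox a b -> inbox a' b' ->
    Rabs (a - a') + Rabs (b - b') < delta ->
    Rabs (coef_lim a b k - coef_lim a' b' k) < eps.
Proof.
  intros Hk Heps.
  assert (HM : inbox aM bM) by (split; lra).
  assert (HL := coef_lim_lim aM bM k Hk HM).
  apply is_lim_seq_spec in HL. destruct (HL (mkposreal (eps / 4) ltac:(lra))) as [n Hn].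
  specialize (Hn n (Nat.le_refl n)). simpl in Hn.
  assert (HnM : coef_lim aM bM k - coef aM bM n k < eps / 4).
  { apply Rabs_def2 in Hn. lra. }
  destruct (coef_lipschitz_step n k (approx_lipschitz n)) as [L [HL0 HLip]].
  exists (eps / 4 / (L + 1)). split; [apply Rdiv_lt_0_compat; lra|].
  intros a b a' b' H H' Hd.
  assert (Close : forall s t, inbox s t -> Rabs (coef_lim s t k - coef s t n k) < eps / 4).
  { intros s t Hst. assert (G := coef_lim_gap s t aM bM n k Hk Hst HM).
    assert (G' := coef_le_lim s t n k Hk Hst). destruct Hst.
    rewrite Rabs_pos_eq; lra. }
  assert (C1 := Close a b H). assert (C2 := Close a' b' H').
  specialize (HLip a b a' b' H H').
  assert (L * (Rabs (a - a') + Rabs (b - b')) <= eps / 4).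
  { apply Rle_trans with ((L + 1) * (eps / 4 / (L + 1))).
    - apply Rmult_le_compat; try lra.
      apply Rplus_le_le_0_compat; apply Rabs_pos.
    - right. field. lra. }
  apply Rabs_def2 in C1. apply Rabs_def2 in C2.
  assert (C3 : Rabs (coef a b n k - coef a' b' n k) <= eps / 4) by lra.
  apply Rabs_le_between in C3. apply Rabs_def1; lra.
Qed.

Lemma coef1_3 (a b : R) :
  coef a b 3 1 = / 2 * a * b + / 4 * b * approx a b 3 3.
Proof.
  unfold coef, quad, bilin. cbn [rsum]. unfold kernel. cbn [Nat.sub Nat.add].
  rewrite !(approx_low a b 3 0), !(approx_low a b 3 1), !(approx_low a b 3 2) by lia.
  cbn [seed]. field.
Qed.

(** The part added after step 3 does not decrease in [b], so the monomial [/ 2 * a * b] of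
    [coef a b 3 1] already gives the growth. This positive slope makes the solution [b] of the first
    equation unique and controls its dependence on [a]. *)
Lemma coef_lim1_strict (a b b' : R) :
  inbox a b -> inbox a b' -> b <= b' ->
  / 2 * a * (b' - b) <= coef_lim a b' 1 - coef_lim a b 1.
Proof.
  intros H H' Hb. assert (G := coef_lim_gap a b a b' 3 1 (le_n 1) H H' (Rle_refl a) Hb).
  rewrite !coef1_3 in G. destruct H as [Ha Hb0]. destruct H' as [_ Hb'].
  assert (0 <= b * approx a b 3 3 <= b' * approx a b' 3 3).
  { assert (0 <= approx a b 3 3) by (apply approx_nonneg; lra).
    assert (approx a b 3 3 <= approx a b' 3 3) by (apply approx_le; lra). nra. }
  lra.
Qed.

Lemma coef_lim1_scaling (t a b : R) :
  1 <= t -> inbox a b -> inbox (t * a) b -> t * coef_lim a b 1 <= coef_lim (t * a) b 1.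
Proof.
  intros Ht H H'.
  apply (is_lim_seq_le (fun n => t * coef a b n 1) (fun n => coef (t * a) b n 1)
           (t * coef_lim a b 1) (coef_lim (t * a) b 1)).
  - intros n. destruct H. apply coef1_scaling; lra.
  - apply (is_lim_seq_scal_l (fun n => coef a b n 1) t (coef_lim a b 1)).
    now apply coef_lim_lim.
  - now apply coef_lim_lim.
Qed.

(* The first equation determines b as a continuous function of a; along that
   curve the residual of the second one changes sign. *)
Lemma solve_two_equations (a1 b1 : R) :
  0 < a1 < aM -> 0 < b1 < bM ->
  symbol 1 * a1 <= coef_lim a1 bM 1 ->
  coef_lim a1 bM 2 <= symbol 2 * b1 ->
  coef_lim aM b1 1 <= symbol 1 * aM ->
  symbol 2 * bM <= coef_lim aM b1 2 ->
  exists a b, a1 <= a <= aM /\ b1 <= b <= bM /\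
    coef_lim a b 1 = symbol 1 * a /\ coef_lim a b 2 = symbol 2 * b.
Proof.
  intros Ha1 Hb1 HA1 HA2 HB1 HB2.
  assert (S1 := symbol_pos 1 ltac:(lia)). assert (S2 := symbol_pos 2 ltac:(lia)).
  assert (Box : forall a b, a1 <= a <= aM -> b1 <= b <= bM -> inbox a b).
  { intros; split; lra. }
  assert (Hex : forall a, a1 <= a <= aM ->
     exists b, b1 <= b <= bM /\ coef_lim a b 1 = symbol 1 * a).
  { intros a Ha.
    destruct (ivt_modulus (fun b => coef_lim a b 1 - symbol 1 * a) b1 bM)
      as [b [Hb E]]; try lra.
    - intros eps Heps.
      destruct (coef_lim_modulus 1 eps (le_n 1) Heps) as [d [Hd Hmod]].
      exists d. split; auto. intros s t Hs Ht Hst.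
      replace (_ - _) with (coef_lim a s 1 - coef_lim a t 1) by ring.
      apply Hmod; auto. rewrite Rminus_diag, Rabs_R0. lra.
    (* On the side [b = b1], scaling by [aM / a] carries the inequality known at the corner
       [(aM, b1)] back to every [a]. *)
    - assert (E : aM = (aM / a) * a) by (field; lra).
      assert (T : 1 <= aM / a) by (apply Rmult_le_reg_r with a; [lra|]; rewrite <- E; lra).
      assert (G : aM / a * coef_lim a b1 1 <= coef_lim (aM / a * a) b1 1).
      { apply coef_lim1_scaling; auto; [apply Box; lra|]. rewrite <- E. apply Box; lra. }
      rewrite <- E in G.
      assert (aM / a * coef_lim a b1 1 <= aM / a * (symbol 1 * a)).
      { eapply Rle_trans; [apply G|]. eapply Rle_trans; [apply HB1|]. right. field. lra. }
      apply Rmult_le_reg_l in H; lra.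
    (* On the side [b = bM], scaling by [a / a1] starts from the corner [(a1, bM)]. *)
    - assert (E : a = (a / a1) * a1) by (field; lra).
      assert (T : 1 <= a / a1) by (apply Rmult_le_reg_r with a1; [lra|]; rewrite <- E; lra).
      assert (G : a / a1 * coef_lim a1 bM 1 <= coef_lim (a / a1 * a1) bM 1).
      { apply coef_lim1_scaling; auto; [apply Box; lra|]. rewrite <- E. apply Box; lra. }
      rewrite <- E in G.
      assert (a / a1 * (symbol 1 * a1) <= a / a1 * coef_lim a1 bM 1).
      { apply Rmult_le_compat_l; lra. }
      replace (a / a1 * (symbol 1 * a1)) with (symbol 1 * a) in H by (field; lra). lra.
    - exists b. split; auto. lra. }
  set (beta := fun a => epsilon (inhabits 0)
         (fun b => b1 <= b <= bM /\ coef_lim a b 1 = symbol 1 * a)).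
  assert (Hbeta : forall a, a1 <= a <= aM ->
     b1 <= beta a <= bM /\ coef_lim a (beta a) 1 = symbol 1 * a).
  { intros a Ha. apply (epsilon_spec (inhabits 0)
      (fun b => b1 <= b <= bM /\ coef_lim a b 1 = symbol 1 * a)). now apply Hex. }
  assert (Hcont : forall eps, 0 < eps -> exists delta, 0 < delta /\
     forall s t, a1 <= s <= aM -> a1 <= t <= aM -> Rabs (s - t) < delta ->
       Rabs (beta s - beta t) < eps).
  (* Two changes below [e] have to be absorbed: that of [coef_lim] when [a] varies at fixed [b], and
     that of [symbol 1 * a]. The slope in [b] is at least [/ 2 * a1], and
     [2 * e = / 2 * a1 * eps]. *)
  { intros eps Heps. set (e := / 4 * a1 * eps).
    assert (He : 0 < e) by (unfold e; nra).
    destruct (coef_lim_modulus 1 e (le_n 1) He) as [d [Hd Hmod]].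
    exists (Rmin d (e / symbol 1)). split.
    { apply Rmin_pos; auto. apply Rdiv_lt_0_compat; auto. }
    intros s t Hs Ht Hst.
    destruct (Hbeta s Hs) as [Bs Es]. destruct (Hbeta t Ht) as [Bt Et].
    assert (K1 : Rabs (coef_lim s (beta t) 1 - coef_lim t (beta t) 1) < e).
    { apply Hmod; auto. rewrite Rminus_diag, Rabs_R0, Rplus_0_r.
      eapply Rlt_le_trans; [exact Hst|apply Rmin_l]. }
    assert (K2 : Rabs (symbol 1 * s - symbol 1 * t) < e).
    { rewrite <- Rmult_minus_distr_l, Rabs_mult, (Rabs_pos_eq (symbol 1)) by lra.
      apply Rlt_le_trans with (symbol 1 * (e / symbol 1)).
      - apply Rmult_lt_compat_l; auto. eapply Rlt_le_trans; [exact Hst|apply Rmin_r].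
      - right. field. lra. }
    assert (K3 : / 2 * a1 * Rabs (beta s - beta t)
                 <= Rabs (coef_lim s (beta s) 1 - coef_lim s (beta t) 1)).
    { destruct (Rle_lt_dec (beta s) (beta t)) as [Q|Q].
      - assert (G := coef_lim1_strict s (beta s) (beta t)
                       (Box _ _ Hs Bs) (Box _ _ Hs Bt) Q).
        rewrite (Rabs_minus_sym (beta s)), (Rabs_minus_sym (coef_lim s (beta s) 1)).
        rewrite !Rabs_pos_eq; nra.
      - assert (G := coef_lim1_strict s (beta t) (beta s)
                       (Box _ _ Hs Bt) (Box _ _ Hs Bs) (Rlt_le _ _ Q)).
        rewrite !Rabs_pos_eq; nra. }
    rewrite <- Es, <- Et in K2. apply Rabs_def2 in K1. apply Rabs_def2 in K2.
    assert (K4 : Rabs (coef_lim s (beta s) 1 - coef_lim s (beta t) 1) < 2 * e)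
      by (apply Rabs_def1; lra).
    apply Rmult_lt_reg_l with (/ 2 * a1); [lra|].
    replace (/ 2 * a1 * eps) with (2 * e) by (unfold e; lra). lra. }
  destruct (ivt_modulus (fun a => coef_lim a (beta a) 2 - symbol 2 * beta a) a1 aM)
    as [a [Ha E]]; try lra.
  - intros eps Heps.
    destruct (coef_lim_modulus 2 (eps / 2) ltac:(lia) ltac:(lra)) as [d [Hd Hmod]].
    destruct (Hcont (Rmin (d / 2) (eps / 2 / symbol 2))) as [d' [Hd' Hc]].
    { apply Rmin_pos; [lra|]. apply Rdiv_lt_0_compat; lra. }
    exists (Rmin (d / 2) d'). split; [apply Rmin_pos; lra|].
    intros s t Hs Ht Hst.
    assert (Hst1 := Rlt_le_trans _ _ _ Hst (Rmin_l _ _)).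
    assert (Hst2 := Hc s t Hs Ht (Rlt_le_trans _ _ _ Hst (Rmin_r _ _))).
    assert (Hst3 := Rlt_le_trans _ _ _ Hst2 (Rmin_l _ _)).
    assert (Hst4 := Rlt_le_trans _ _ _ Hst2 (Rmin_r _ _)).
    destruct (Hbeta s Hs) as [Bs Es]. destruct (Hbeta t Ht) as [Bt Et].
    assert (M := Hmod s (beta s) t (beta t) (Box _ _ Hs Bs) (Box _ _ Ht Bt) ltac:(lra)).
    assert (N : Rabs (symbol 2 * (beta s - beta t)) < eps / 2).
    { rewrite Rabs_mult, (Rabs_pos_eq (symbol 2)) by lra.
      apply Rlt_le_trans with (symbol 2 * (eps / 2 / symbol 2)).
      - now apply Rmult_lt_compat_l.
      - right. field. lra. }
    apply Rabs_def2 in M. apply Rabs_def2 in N. apply Rabs_def1; lra.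
  (* The exact value of [beta a1] does not matter: the left side of the second equation is largest
     at [bM], the right side smallest at [b1]. The end [aM] is treated with [b1] and [bM]
     exchanged. *)
  - destruct (Hbeta a1) as [Bb _]; [lra|].
    assert (coef_lim a1 (beta a1) 2 <= coef_lim a1 bM 2).
    { apply coef_lim_le; try lia; try lra; apply Box; lra. }
    assert (symbol 2 * b1 <= symbol 2 * beta a1) by (apply Rmult_le_compat_l; lra). lra.
  - destruct (Hbeta aM) as [Bb _]; [lra|].
    assert (coef_lim aM b1 2 <= coef_lim aM (beta aM) 2).
    { apply coef_lim_le; try lia; try lra; apply Box; lra. }
    assert (symbol 2 * beta aM <= symbol 2 * bM) by (apply Rmult_le_compat_l; lra). lra.
  - exists a, (beta a). destruct (Hbeta a Ha). repeat split; try lra.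
Qed.

Lemma amp_nonneg (a b : R) (k : nat) : inbox a b -> 0 <= amp a b k.
Proof.
  intros H. eapply Rle_trans; [|now apply (approx_le_amp a b 0)].
  destruct H. apply approx_nonneg; lra.
Qed.

Lemma amp_low (a b : R) (k : nat) : (k <= 2)%nat -> amp a b k = seed a b k.
Proof.
  intros Hk. unfold amp.
  rewrite (Lim_seq_ext _ (fun _ => seed a b k)) by (intros; now apply approx_low).
  now rewrite Lim_seq_const.
Qed.

Lemma amp_coef (a b : R) (k : nat) :
  (3 <= k)%nat -> inbox a b -> symbol k * amp a b k = coef_lim a b k.
Proof.
  intros Hk H. assert (Hs := symbol_pos k ltac:(lia)).
  assert (L := proj1 (is_lim_seq_incr_1 _ _) (amp_lim a b k H)).
  assert (L' : is_lim_seq (fun n => approx a b (S n) k) (coef_lim a b k * / symbol k)).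
  { apply is_lim_seq_ext with (fun n => coef a b n k * / symbol k).
    - intros; now rewrite approx_S.
    - apply (is_lim_seq_scal_r (fun n => coef a b n k) (/ symbol k) (coef_lim a b k)).
      apply coef_lim_lim; auto; lia. }
  apply is_lim_seq_unique in L. apply is_lim_seq_unique in L'. rewrite L in L'.
  injection L' as ->. field. lra.
Qed.

Lemma rsum_lim (K : nat) (f : nat -> nat -> R) (l : nat -> R) :
  (forall m, is_lim_seq (fun n => f n m) (l m)) ->
  is_lim_seq (fun n => rsum K (f n)) (rsum K l).
Proof.
  intros H. induction K as [|K IH]; simpl.
  - apply is_lim_seq_const.
  - now apply is_lim_seq_plus'.
Qed.

Lemma quad_amp_lim (a b : R) (K k : nat) :
  inbox a b -> is_lim_seq (fun n => quad K (approx a b n) k) (quad K (amp a b) k).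
Proof.
  intros H. unfold quad.
  apply (is_lim_seq_scal_l _ (/ 4) (bilin (amp a b) (amp a b) K k)).
  apply rsum_lim. intros m. apply is_lim_seq_mult'; [now apply amp_lim|].
  apply is_lim_seq_plus'; now apply amp_lim.
Qed.

Lemma quad_amp_le (a b : R) (K k : nat) :
  (1 <= k)%nat -> inbox a b -> quad K (amp a b) k <= coef_lim a b k.
Proof.
  intros Hk H.
  apply (is_lim_seq_le (fun n => quad K (approx a b (n + K)) k)
    (fun n => coef a b (n + K) k) (quad K (amp a b) k) (coef_lim a b k)).
  - intros n. destruct H. apply quad_le; try lia; [apply approx_nonneg; lra | intros; lra].
  - apply (is_lim_seq_incr_n (fun n => quad K (approx a b n) k)). now apply quad_amp_lim.
  - apply (is_lim_seq_incr_n (fun n => coef a b n k)). now apply coef_lim_lim.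
Qed.

(** Monotonicity replaces dominated convergence: the truncated form at the limit is squeezed between
    its value [coef a b K k] at the iterate and [coef_lim a b k]. *)
Lemma quad_amp_full (a b : R) (k : nat) :
  (1 <= k)%nat -> inbox a b -> is_lim_seq (fun K => quad K (amp a b) k) (coef_lim a b k).
Proof.
  intros Hk H. apply is_lim_seq_le_le with (fun K => coef a b K k) (fun _ => coef_lim a b k).
  - intros K. split; [|now apply quad_amp_le].
    destruct (H). apply quad_le; auto; [apply approx_nonneg; lra|].
    intros; now apply approx_le_amp.
  - now apply coef_lim_lim.
  - apply is_lim_seq_const.
Qed.
End Box.

(** * Error estimates in a weighted norm *)

Lemma bilin_plus_l (x y z : nat -> R) (K k : nat) :
  bilin (fun i => x i + y i) z K k = bilin x z K k + bilin y z K k.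
Proof. unfold bilin. rewrite <- rsum_plus. apply rsum_ext; intros; ring. Qed.

Lemma bilin_plus_r (x y z : nat -> R) (K k : nat) :
  bilin x (fun i => y i + z i) K k = bilin x y K k + bilin x z K k.
Proof.
  unfold bilin, kernel. rewrite <- rsum_plus. apply rsum_ext; intros; ring.
Qed.

(** The two cross terms of the expanded square agree only as full sums; the condition [S k + n <= K]
    pays for merging them into a single [bilin e x K k]. *)
Lemma quad_plus_le (x e : nat -> R) (n K k : nat) :
  nonneg x -> nonneg e -> x 0%nat = 0 -> e 0%nat = 0 -> (S k + n <= K)%nat ->
  quad n (fun i => x i + e i) k
  <= quad n x k + / 2 * bilin e x K k + / 4 * bilin e e K k.
Proof.
  intros Hx He Hx0 He0 HK. unfold quad.
  rewrite bilin_plus_l, !bilin_plus_r.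
  assert (A := bilin_comm_le x e n k Hx He Hx0 He0).
  assert (C : forall u j, nonneg u -> (j <= K)%nat -> bilin e u j k <= bilin e u K k).
  { intros u j Hu Hj. apply bilin_le; auto; intros; apply Rle_refl. }
  assert (A1 := C x (S k + n)%nat Hx HK).
  assert (A2 := C x n Hx ltac:(lia)). assert (A3 := C e n He ltac:(lia)). lra.
Qed.

Section Certificate.
Variables (N : nat) (psi P : nat -> R) (theta kappa : R).

(** In the l^1 norm with weights [omega] the division by [symbol k] in the iteration cancels, and
    the column sums of the linearisation at [P] become half the sums over [k] of
    [psi k * kernel P k m], to be compared with [omega m]. This is the meaning of [column] and
    [theta]; [submult] and [kappa] play the same part for the quadratic remainder. *)
Definition omega (k : nat) : R := symbol k * psi k.

Hypothesis psi_low : forall k, (k <= 2)%nat -> psi k = 0.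
Hypothesis psi_pos : nonneg psi.
Hypothesis omega_ge1 : forall k, (3 <= k)%nat -> 1 <= omega k.
Hypothesis P_nonneg : nonneg P.
Hypothesis P_0 : P 0%nat = 0.
Hypothesis P_high : forall k, (N <= k)%nat -> P k = 0.
Hypothesis column : forall m, (3 <= m)%nat -> bilin P psi N m <= 2 * theta * omega m.
Hypothesis submult : forall i j, (3 <= i)%nat -> (3 <= j)%nat ->
  kernel psi i j <= kappa * omega i * omega j.
Hypothesis theta_bounds : 0 <= theta < 1.
Hypothesis kappa_nonneg : 0 <= kappa.

Lemma omega_low (k : nat) : (k <= 2)%nat -> omega k = 0.
Proof. intros Hk. unfold omega. rewrite psi_low by auto. ring. Qed.

Lemma omega_nonneg : nonneg omega.
Proof.
  intros k. destruct (le_lt_dec k 2).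
  - rewrite omega_low by auto. lra.
  - assert (H := omega_ge1 k). assert (1 <= omega k) by auto. lra.
Qed.

Definition wnorm (M : nat) (e : nat -> R) : R := rsum M (fun k => omega k * e k).

Definition error_like (e : nat -> R) : Prop :=
  nonneg e /\ forall k, (k <= 2)%nat -> e k = 0.

Lemma wnorm_nonneg (M : nat) (e : nat -> R) : nonneg e -> 0 <= wnorm M e.
Proof.
  intros He. apply rsum_nonneg. intros. apply Rmult_le_pos; auto. apply omega_nonneg.
Qed.

(** [column] sums over the finite support of [P], which can be checked by computation; by symmetry
    of the convolution it bounds the sum over all rows [k]. *)
Lemma column_full (M m : nat) :
  (3 <= m)%nat -> rsum M (fun k => psi k * kernel P k m) <= 2 * theta * omega m.
Proof.
  intros Hm. apply Rle_trans with (bilin psi P M m).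
  { right. apply rsum_ext; intros; now rewrite kernel_sym. }
  eapply Rle_trans; [apply bilin_comm_le; auto|].
  eapply Rle_trans; [|apply column; auto].
  apply rsum_support_le.
  - intros; apply Rmult_le_pos; auto using kernel_nonneg.
  - intros i Hi. rewrite P_high by auto. ring.
Qed.

(** Exchanging the two sums turns the norm of the image into the column sums of the nonnegative
    matrix [kernel P k m]. *)
Lemma linear_part (e U : nat -> R) (M K : nat) :
  error_like e -> (forall k, U k <= P k) ->
  rsum M (fun k => psi k * bilin e U K k) <= 2 * theta * wnorm K e.
Proof.
  intros [He He2] HU.
  apply Rle_trans with (rsum K (fun m => e m * rsum M (fun k => psi k * kernel P k m))).
  - apply Rle_trans with (rsum M (fun k => rsum K (fun m => e m * (psi k * kernel P k m)))).
    + apply rsum_le; intros k _. unfold bilin. rewrite <- rsum_scal.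
      apply rsum_le; intros m _.
      replace (psi k * (e m * kernel U k m)) with (e m * (psi k * kernel U k m)) by ring.
      apply Rmult_le_compat_l; auto. apply Rmult_le_compat_l; auto. now apply kernel_le.
    + rewrite rsum_switch. right. apply rsum_ext; intros. now rewrite rsum_scal.
  - unfold wnorm. rewrite <- rsum_scal. apply rsum_le; intros m _.
    destruct (le_lt_dec m 2).
    + rewrite He2 by auto. lra.
    + assert (H := column_full M m). apply Rle_trans with (e m * (2 * theta * omega m)).
      * apply Rmult_le_compat_l; auto.
      * right; ring.
Qed.

(** After the same exchange the inner sum is a convolution of [psi] and [e]; commuting it lets
    [submult] bound it by [kappa * omega m] times the norm of [e]. *)
Lemma quadratic_part (e : nat -> R) (M K : nat) (r : R) :
  error_like e -> (forall L, wnorm L e <= r) ->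
  rsum M (fun k => psi k * bilin e e K k) <= kappa * r * r.
Proof.
  intros [He He2] Hr.
  assert (r0 : 0 <= r) by (eapply Rle_trans; [apply (wnorm_nonneg 0 e He)|apply Hr]).
  apply Rle_trans with (rsum K (fun m => e m * rsum M (fun k => psi k * kernel e k m))).
  { right. transitivity (rsum M (fun k => rsum K (fun m => e m * (psi k * kernel e k m)))).
    - apply rsum_ext; intros. unfold bilin. rewrite <- rsum_scal.
      apply rsum_ext; intros; ring.
    - rewrite rsum_switch. apply rsum_ext; intros. now rewrite rsum_scal. }
  apply Rle_trans with (rsum K (fun m => (kappa * r) * (omega m * e m))).
  - apply rsum_le; intros m _. destruct (le_lt_dec m 2) as [Hm|Hm].
    { rewrite He2 by auto. lra. }
    replace (kappa * r * (omega m * e m)) with (e m * (kappa * omega m * r)) by ring.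
    apply Rmult_le_compat_l; auto.
    apply Rle_trans with (bilin psi e M m).
    { right. apply rsum_ext; intros; now rewrite kernel_sym. }
    eapply Rle_trans; [apply bilin_comm_le; auto|].
    apply Rle_trans with (kappa * omega m * wnorm (S m + M) e).
    + unfold bilin, wnorm. rewrite <- rsum_scal. apply rsum_le; intros l _.
      destruct (le_lt_dec l 2) as [Hl|Hl].
      * rewrite He2 by auto. lra.
      * replace (kappa * omega m * (omega l * e l))
          with (e l * (kappa * omega m * omega l)) by ring.
        apply Rmult_le_compat_l; auto.
    + apply Rmult_le_compat_l; auto. apply Rmult_le_pos; auto. apply omega_nonneg.
  - rewrite rsum_scal. apply Rmult_le_compat_l.
    + now apply Rmult_le_pos.
    + apply Hr.
Qed.

(** Since the iteration is monotone, an upper bound needs only the positive part of the error, and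
    nonnegative sequences suffice in all estimates. *)
Definition excess (x U : nat -> R) (k : nat) : R := Rmax 0 (x k - U k).

Lemma excess_nonneg (x U : nat -> R) : nonneg (excess x U).
Proof. intros k. apply Rmax_l. Qed.

Lemma excess_bound (x U : nat -> R) (k : nat) : x k <= U k + excess x U k.
Proof. unfold excess. assert (H := Rmax_r 0 (x k - U k)). lra. Qed.

Lemma wnorm_term (e : nat -> R) (k : nat) (r : R) :
  (3 <= k)%nat -> nonneg e -> (forall M, wnorm M e <= r) -> e k <= r / omega k.
Proof.
  intros Hk He Hr. assert (W : 1 <= omega k) by auto.
  apply Rmult_le_reg_r with (omega k); [lra|].
  unfold Rdiv. rewrite Rmult_assoc, Rinv_l, Rmult_1_r by lra.
  eapply Rle_trans; [|apply (Hr (S k))].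
  rewrite Rmult_comm. apply (rsum_term (S k) k (fun i => omega i * e i)); auto.
  intros. apply Rmult_le_pos; auto. apply omega_nonneg.
Qed.

Section Estimates.
Variables (U : nat -> R) (eta r gam : R).
Hypothesis U_nonneg : nonneg U.
Hypothesis U_0 : U 0%nat = 0.
Hypothesis U_high : forall k, (N <= k)%nat -> U k = 0.
Hypothesis U_le_P : forall k, U k <= P k.
Let res (k : nat) : R := Rabs (quad N U k - symbol k * U k).
Hypothesis U_residual : forall M, rsum M (fun k => psi k * res k) <= eta.
Hypothesis r_nonneg : 0 <= r.
Hypothesis r_closed : eta + theta * r + / 4 * kappa * r * r <= r.
Let x (n : nat) : nat -> R := approx (U 1%nat) (U 2%nat) n.
Let e (n : nat) : nat -> R := excess (x n) U.

Lemma upper_error_like (n : nat) : error_like (e n).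
Proof.
  split; [apply excess_nonneg|]. intros k Hk. unfold e, excess, x.
  rewrite approx_low by auto. apply Rmax_left.
  destruct k as [|[|[|k]]]; simpl; try lia; lra.
Qed.

Lemma upper_coef_aux (n k K : nat) : (S k + n <= K)%nat ->
  coef (U 1%nat) (U 2%nat) n k
  <= quad N U k + / 2 * bilin (e n) U K k + / 4 * bilin (e n) (e n) K k.
Proof.
  intros HK. destruct (upper_error_like n) as [He He2].
  apply Rle_trans with (quad n (fun i => U i + e n i) k).
  - apply quad_le; auto.
    + now apply approx_nonneg.
    + intros i. apply excess_bound.
  - eapply Rle_trans; [apply (quad_plus_le U (e n) n K k); auto|].
    assert (quad n U k <= quad N U k); [|lra].
    unfold quad. apply Rmult_le_compat_l; [lra|]. apply rsum_support_le.
    + intros; apply Rmult_le_pos; auto using kernel_nonneg.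
    + intros i Hi. rewrite U_high by auto. ring.
Qed.

(** The iteration starts below [U], so the first error is 0; [r_closed] then says that the bound [r]
    reproduces itself, with contributions [eta] from the residual, [theta * r] from the linear and
    [/ 4 * kappa * r * r] from the quadratic part. *)
Lemma upper_error (n M : nat) : wnorm M (e n) <= r.
Proof.
  revert M. induction n as [|n IH]; intros M.
  - unfold wnorm. rewrite rsum_zero; auto. intros k _. unfold e, excess, x.
    destruct (le_lt_dec k 2).
    + rewrite omega_low by auto. ring.
    + replace (approx (U 1%nat) (U 2%nat) 0 k) with 0
        by (destruct k as [|[|[|k]]]; simpl; auto; lia).
      rewrite Rmax_left; [ring|]. assert (H := U_nonneg k). lra.
  - set (K := (S M + n)%nat).
    destruct (upper_error_like n) as [He He2].
    apply Rle_trans with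
      (rsum M (fun k => psi k * res k + (/ 2 * (psi k * bilin (e n) U K k)
                                 + / 4 * (psi k * bilin (e n) (e n) K k)))).
    + apply rsum_le; intros k Hk.
      assert (B1 : 0 <= bilin (e n) U K k) by now apply bilin_nonneg.
      assert (B2 : 0 <= bilin (e n) (e n) K k) by now apply bilin_nonneg.
      assert (Hp := psi_pos k).
      assert (Hres : 0 <= res k) by apply Rabs_pos.
      destruct (le_lt_dec k 2) as [Hk2|Hk2].
      * rewrite omega_low, psi_low by auto. lra.
      * assert (Sk := symbol_pos k ltac:(lia)).
        assert (C := upper_coef_aux n k K ltac:(lia)).
        assert (D : symbol k * e (S n) k
          <= res k + / 2 * bilin (e n) U K k + / 4 * bilin (e n) (e n) K k).
        { unfold e at 1, excess, x. rewrite approx_S by auto.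
          unfold Rmax. destruct (Rle_dec _ _) as [Hd|Hd].
          - rewrite Rmult_minus_distr_l.
            replace (symbol k * (coef (U 1%nat) (U 2%nat) n k / symbol k))
              with (coef (U 1%nat) (U 2%nat) n k) by (field; lra).
            assert (V : quad N U k - symbol k * U k <= res k) by apply Rle_abs. lra.
          - rewrite Rmult_0_r. lra. }
        unfold omega. rewrite (Rmult_comm (symbol k)), Rmult_assoc.
        apply Rle_trans with (psi k *
          (res k + / 2 * bilin (e n) U K k + / 4 * bilin (e n) (e n) K k)).
        -- now apply Rmult_le_compat_l.
        -- right. ring.
    + rewrite !rsum_plus, !rsum_scal.
      assert (A1 := U_residual M).
      assert (A2 := linear_part (e n) U M K (conj He He2) U_le_P).
      assert (A3 := quadratic_part (e n) M K r (conj He He2) IH).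
      assert (A4 : theta * wnorm K (e n) <= theta * r)
        by (apply Rmult_le_compat_l; [lra|apply IH]).
      lra.
Qed.

Lemma upper_approx (n k : nat) :
  (3 <= k)%nat -> approx (U 1%nat) (U 2%nat) n k <= U k + r / omega k.
Proof.
  intros Hk. eapply Rle_trans; [apply (excess_bound _ U)|].
  apply Rplus_le_compat_l. apply wnorm_term; auto.
  - apply excess_nonneg.
  - intros M. apply upper_error.
Qed.

(** For k = 1, 2 a single coefficient is wanted, not a norm, so the row [kernel P k] is measured in
    the norm dual to the weighted l^1 norm. *)
Lemma row_bound (d : nat -> R) (K k : nat) :
  (forall m, (3 <= m)%nat -> kernel P k m <= 2 * gam * omega m) -> error_like d ->
  bilin d U K k <= 2 * gam * wnorm K d.
Proof.
  intros Hg [Hd Hd2]. unfold bilin, wnorm. rewrite <- rsum_scal. apply rsum_le; intros m _.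
  destruct (le_lt_dec m 2); [rewrite Hd2 by auto; lra|].
  replace (2 * gam * (omega m * d m)) with (d m * (2 * gam * omega m)) by ring.
  apply Rmult_le_compat_l; auto.
  eapply Rle_trans; [apply kernel_le, U_le_P|]. auto.
Qed.

(** The term [/ 2 * (r * r)] is a crude bound of the quadratic part: as [omega m >= 1] for [m >= 3],
    every entry of the error is at most [r]. *)
Lemma upper_coef (n k : nat) :
  (forall m, (3 <= m)%nat -> kernel P k m <= 2 * gam * omega m) -> 0 <= gam ->
  coef (U 1%nat) (U 2%nat) n k <= quad N U k + gam * r + / 2 * (r * r).
Proof.
  intros Hg Hg0. set (K := (S k + n)%nat).
  eapply Rle_trans; [apply (upper_coef_aux n k K); auto|].
  destruct (upper_error_like n) as [He He2].
  assert (W := upper_error n K).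
  assert (A := row_bound (e n) K k Hg (conj He He2)).
  assert (E : forall m, e n m <= r).
  { intros m. destruct (le_lt_dec m 2); [rewrite He2 by auto; lra|].
    eapply Rle_trans; [apply wnorm_term; auto; apply (upper_error n)|].
    assert (1 <= omega m) by auto.
    apply Rmult_le_reg_r with (omega m); [lra|].
    unfold Rdiv. rewrite Rmult_assoc, Rinv_l by lra. nra. }
  assert (A' : bilin (e n) (e n) K k <= 2 * r * wnorm K (e n)).
  { unfold bilin, wnorm. rewrite <- rsum_scal. apply rsum_le; intros m _.
    destruct (le_lt_dec m 2); [rewrite He2 by auto; lra|].
    assert (kernel (e n) k m <= 2 * r).
    { unfold kernel. assert (A1 := E (k - m + (m - k))%nat).
      assert (A2 := E (k + m)%nat). lra. }
    assert (1 <= omega m) by auto. assert (0 <= e n m) by auto.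
    apply Rle_trans with (e n m * (2 * r)).
    - now apply Rmult_le_compat_l.
    - replace (2 * r * (omega m * e n m)) with (e n m * (2 * r) * omega m) by ring.
      assert (0 <= e n m * (2 * r)) by (apply Rmult_le_pos; lra). nra. }
  assert (2 * gam * wnorm K (e n) <= 2 * gam * r) by (apply Rmult_le_compat_l; lra).
  assert (2 * r * wnorm K (e n) <= 2 * r * r) by (apply Rmult_le_compat_l; lra).
  lra.
Qed.

(** * Lower bounds from supersolutions *)

Section Lower.
Variable p : nat -> R.
Hypothesis p_nonneg : nonneg p.
Hypothesis p_low : forall k, (k <= 2)%nat -> p k = U k.
Hypothesis p_super : forall k, (3 <= k)%nat -> quad N p k <= symbol k * p k.
Let d : nat -> R := excess U p.

Lemma lower_error_like : error_like d.
Proof.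
  split; [apply excess_nonneg|]. intros k Hk. apply Rmax_left.
  rewrite p_low by auto. lra.
Qed.

(** Let [U = q + d], with [q] the minimum of [U] and [p]. Replacing [q] by [U] in the linear term of
    the expansion costs [/ 2 * bilin d d K k], more than the quadratic term [/ 4 * bilin d d K k],
    so no quadratic error remains. *)
Lemma lower_quad (k K : nat) : (S k + N <= K)%nat ->
  quad N U k <= quad N p k + / 2 * bilin d U K k.
Proof.
  intros HK. destruct lower_error_like as [Hd Hd2]. set (q := fun i => U i - d i).
  assert (Hq : nonneg q).
  { intros i. unfold q, d, excess. assert (A := U_nonneg i). assert (B := p_nonneg i).
    unfold Rmax. destruct (Rle_dec _ _); lra. }
  assert (Hqp : forall i, q i <= p i).
  { intros i. unfold q. assert (H := excess_bound U p i). fold d in H. lra. }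
  assert (EU : U = fun i => q i + d i)
    by (apply functional_extensionality; intros; unfold q; ring).
  assert (A := quad_plus_le q d N K k Hq Hd
    ltac:(unfold q; rewrite U_0, Hd2 by lia; ring) ltac:(apply Hd2; lia) HK).
  rewrite <- EU in A.
  assert (B : quad N q k <= quad N p k) by (apply quad_le; auto).
  assert (C : bilin d U K k = bilin d q K k + bilin d d K k)
    by (rewrite EU at 1; apply bilin_plus_r).
  assert (0 <= bilin d d K k) by now apply bilin_nonneg. lra.
Qed.

(** One inequality replaces the induction: [d] vanishes where [U] does, so its norm is a finite
    number z with z <= [eta] + [theta] z, and [r_closed] with [theta < 1] gives z <= [r]. *)
Lemma lower_error (M : nat) : wnorm M d <= r.
Proof.
  destruct lower_error_like as [Hd Hd2].
  assert (HdN : forall k, (N <= k)%nat -> d k = 0).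
  { intros k Hk. apply Rmax_left. rewrite U_high by auto. specialize (p_nonneg k). lra. }
  assert (HM : wnorm M d <= wnorm N d).
  { apply rsum_support_le.
    - intros; apply Rmult_le_pos; auto. apply omega_nonneg.
    - intros i Hi. rewrite HdN by auto. ring. }
  set (K := (S N + N)%nat).
  assert (Hstep : forall k, (k < N)%nat ->
     omega k * d k <= psi k * res k + / 2 * (psi k * bilin d U K k)).
  { intros k Hk. assert (Hps := psi_pos k).
    assert (Hres : 0 <= res k) by apply Rabs_pos.
    assert (B : 0 <= bilin d U K k) by now apply bilin_nonneg.
    destruct (le_lt_dec k 2) as [Hk2|Hk2]; [rewrite Hd2, psi_low by auto; lra|].
    assert (Sk := symbol_pos k ltac:(lia)).
    assert (D : symbol k * d k <= res k + / 2 * bilin d U K k).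
    { unfold d at 1, excess. unfold Rmax. destruct (Rle_dec _ _) as [Hle|]; [|lra].
      assert (A1 : symbol k * U k - quad N U k <= res k).
      { unfold res. rewrite Rabs_minus_sym. apply Rle_abs. }
      assert (A2 := p_super k ltac:(lia)).
      assert (A3 := lower_quad k K ltac:(unfold K; lia)).
      rewrite Rmult_minus_distr_l. lra. }
    unfold omega. rewrite (Rmult_comm (symbol k)), Rmult_assoc.
    apply (Rmult_le_compat_l (psi k)) in D; lra. }
  assert (W0 : wnorm N d <= eta + theta * wnorm N d).
  { eapply Rle_trans; [apply rsum_le, Hstep|].
    rewrite rsum_plus, rsum_scal.
    assert (A := linear_part d U N K (conj Hd Hd2) U_le_P).
    assert (E : wnorm K d = wnorm N d).
    { apply rsum_support; [|unfold K; lia]. intros i Hi. rewrite HdN by auto. ring. }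
    rewrite E in A. assert (A1 := U_residual N). lra. }
  assert (0 <= / 4 * kappa * r * r) by (repeat apply Rmult_le_pos; lra).
  nra.
Qed.

Lemma lower_coef (k : nat) :
  (forall m, (3 <= m)%nat -> kernel P k m <= 2 * gam * omega m) -> 0 <= gam ->
  quad N U k - gam * r <= quad N p k.
Proof.
  intros Hg Hg0. set (K := (S k + N)%nat).
  assert (A := lower_quad k K (le_n _)).
  assert (B := row_bound d K k Hg lower_error_like).
  assert (C := lower_error K).
  assert (2 * gam * wnorm K d <= 2 * gam * r) by (apply Rmult_le_compat_l; lra). lra.
Qed.
End Lower.
End Estimates.
End Certificate.

(** * Numerical certificate *)

(* The first three lists are approximate solutions p, in units of 10^(-10), of the
   equations with k >= 3 for the values of (p_1, p_2) at three corners of the parameter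
   box: both maximal, p_1 minimal, p_2 minimal. The fourth list gives, in units of
   10^(-3), the weights of the norm up to index 507; they form an approximate positive
   supersolution of the linearised equations and are continued geometrically. *)
Definition corner_data : list Z :=
  [ 0; 5477750409; 1751575807; 876095432; 530050701; 356669506; 256892672; 193982841;
    151658671; 121767994; 99847553; 83280682; 70447888; 60301728; 52139559; 45475304;
    39963742; 35354050; 31460333; 28142386; 25292805; 22828164; 20682848; 18804662;
    17151660; 15689818; 14391293; 13233129; 12196254; 11264718; 10425100; 9666040;
    8977870; 8352320; 7782284; 7261627; 6785031; 6347867; 5946092; 5576162; 5234960;
    4919736; 4628055; 4357757; 4106919; 3873828; 3656948; 3454904; 3266461; 3090506;
    2926036; 2772142; 2628004; 2492873; 2366074; 2246988; 2135052; 2029753; 1930619;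
    1837220; 1749161; 1666079; 1587639; 1513534; 1443481; 1377218; 1314504; 1255114;
    1198842; 1145495; 1094895; 1046878; 1001288; 957984; 916831; 877705; 840491; 805081;
    771372; 739272; 708690; 679545; 651759; 625260; 599977; 575849; 552814; 530817;
    509802; 489722; 470528; 452176; 434624; 417832; 401764; 386384; 371658; 357556;
    344048; 331105; 318701; 306811; 295410; 284477; 273990; 263929; 254273; 245006;
    236109; 227567; 219363; 211482; 203911; 196636; 189644; 182923; 176462; 170249;
    164273; 158526; 152996; 147676; 142556; 137628; 132885; 128318; 123921; 119686;
    115607; 111678; 107893; 104246; 100731; 97343; 94078; 90930; 87896; 84969; 82147;
    79425; 76800; 74267; 71823; 69465; 67190; 64994; 62874; 60828; 58853; 56946; 55104;
    53326; 51608; 49949; 48347; 46799; 45303; 43858; 42461; 41112; 39808; 38547; 37328;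
    36150; 35011; 33910; 32845; 31815; 30819; 29856; 28924; 28022; 27150; 26307; 25490;
    24700; 23936; 23196; 22480; 21787; 21116; 20466; 19837; 19229; 18639; 18068; 17515;
    16980; 16461; 15958; 15472; 15000; 14543; 14100; 13671; 13255; 12852; 12462; 12083;
    11716; 11360; 11015; 10680; 10356; 10041; 9735; 9439; 9152; 8873; 8602; 8339; 8084;
    7837; 7596; 7363; 7136; 6916; 6702; 6494; 6292; 6096; 5905; 5719; 5538; 5362; 5191;
    5025; 4862; 4704; 4550; 4400; 4254; 4111; 3972; 3835; 3702; 3572; 3445; 3320; 3198;
    3078; 2960; 2844; 2730; 2618; 2507; 2397; 2288; 2180; 2072; 1964; 1855; 1746; 1635;
    1521; 1403; 1280; 1148; 1003; 833; 609 ]%Z.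

Definition left_data : list Z :=
  [ 0; 5476983577; 1751575807; 875379457; 529233327; 355833615; 256066683; 193178407;
    150880718; 121018372; 99126593; 82587943; 69782529; 59662716; 51525777; 44885616;
    39397028; 34809224; 30936358; 27638272; 24807616; 22361014; 20232901; 18371131;
    16733803; 15286933; 14002720; 12858244; 11834466; 10915472; 10087869; 9340325;
    8663198; 8048244; 7488379; 6977489; 6510276; 6082131; 5689028; 5327439; 4994264;
    4686765; 4402523; 4139391; 3895457; 3669020; 3458555; 3262699; 3080224; 2910027;
    2751114; 2602586; 2463627; 2333500; 2211533; 2097117; 1989694; 1888756; 1793840;
    1704519; 1620403; 1541135; 1466386; 1395852; 1329255; 1266338; 1206861; 1150607;
    1097370; 1046964; 999212; 953954; 911037; 870322; 831679; 794986; 760130; 727005;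
    695513; 665561; 637063; 609939; 584112; 559513; 536075; 513736; 492437; 472123;
    452744; 434249; 416595; 399737; 383636; 368252; 353551; 339499; 326062; 313212;
    300919; 289156; 277899; 267122; 256804; 246922; 237456; 228386; 219694; 211363;
    203377; 195718; 188374; 181328; 174569; 168083; 161858; 155883; 150146; 144637;
    139347; 134265; 129383; 124692; 120185; 115852; 111687; 107684; 103834; 100131;
    96571; 93145; 89850; 86679; 83628; 80692; 77865; 75145; 72525; 70003; 67574; 65234;
    62981; 60811; 58719; 56704; 54763; 52892; 51088; 49350; 47674; 46058; 44501; 42998;
    41550; 40152; 38805; 37505; 36250; 35040; 33873; 32746; 31658; 30609; 29596; 28618;
    27674; 26763; 25883; 25033; 24212; 23420; 22654; 21915; 21201; 20511; 19844; 19200;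
    18577; 17976; 17395; 16833; 16290; 15765; 15258; 14767; 14293; 13834; 13391; 12962;
    12547; 12146; 11758; 11383; 11020; 10669; 10329; 10000; 9682; 9374; 9076; 8787; 8508;
    8237; 7975; 7722; 7476; 7239; 7008; 6785; 6569; 6360; 6157; 5961; 5770; 5585; 5406;
    5233; 5064; 4901; 4743; 4589; 4440; 4295; 4154; 4018; 3885; 3757; 3631; 3510; 3391;
    3276; 3164; 3055; 2949; 2846; 2745; 2647; 2551; 2457; 2365; 2276; 2188; 2102; 2018;
    1935; 1853; 1773; 1693; 1615; 1537; 1460; 1382; 1305; 1227; 1148; 1067; 984; 896;
    803; 701; 582; 425 ]%Z.

Definition right_data : list Z :=
  [ 0; 5477750409; 1751232532; 875514908; 529430668; 356048445; 256284705; 193393735;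
    151090684; 121221749; 99322870; 82776978; 69964386; 59837565; 51693847; 45047167;
    39552329; 34958547; 31079969; 27776429; 24940566; 22488994; 20356136; 18489833;
    16848175; 15397166; 14108996; 12960734; 11933333; 11010869; 10179941; 9429211;
    8749030; 8131145; 7568467; 7054876; 6585069; 6154431; 5758933; 5395040; 5059648;
    4750017; 4463722; 4198613; 3952777; 3724505; 3512273; 3314712; 3130594; 2958814;
    2798372; 2648368; 2507986; 2376485; 2253191; 2137493; 2028833; 1926699; 1830627;
    1740189; 1654994; 1574682; 1498923; 1427413; 1359872; 1296041; 1235681; 1178571;
    1124506; 1073298; 1024771; 978761; 935117; 893698; 854373; 817019; 781522; 747777;
    715683; 685148; 656086; 628414; 602057; 576944; 553007; 530185; 508417; 487648;
    467828; 448905; 430836; 413575; 397083; 381321; 366252; 351843; 338060; 324873;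
    312254; 300175; 288610; 277535; 266927; 256764; 247024; 237689; 228740; 220159;
    211930; 204035; 196462; 189194; 182218; 175522; 169093; 162919; 156990; 151294;
    145822; 140564; 135510; 130652; 125983; 121493; 117175; 113022; 109027; 105185;
    101487; 97929; 94504; 91208; 88035; 84980; 82038; 79205; 76476; 73848; 71315; 68876;
    66525; 64259; 62076; 59971; 57942; 55986; 54100; 52281; 50527; 48836; 47204; 45630;
    44111; 42646; 41232; 39867; 38550; 37279; 36052; 34868; 33724; 32620; 31554; 30524;
    29529; 28569; 27641; 26745; 25879; 25042; 24234; 23453; 22698; 21969; 21264; 20582;
    19923; 19286; 18670; 18075; 17499; 16942; 16404; 15883; 15379; 14892; 14421; 13965;
    13524; 13097; 12684; 12284; 11897; 11522; 11160; 10809; 10469; 10140; 9822; 9513;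
    9214; 8925; 8645; 8373; 8110; 7856; 7609; 7369; 7138; 6913; 6695; 6484; 6279; 6080;
    5887; 5701; 5519; 5343; 5172; 5007; 4846; 4689; 4538; 4390; 4247; 4108; 3972; 3840;
    3712; 3588; 3466; 3348; 3233; 3120; 3011; 2904; 2799; 2697; 2598; 2500; 2404; 2310;
    2218; 2128; 2039; 1951; 1864; 1778; 1693; 1608; 1523; 1438; 1352; 1266; 1177; 1085;
    989; 887; 774; 643; 469 ]%Z.

Definition weight_data : list Z :=
  [ 0; 0; 0; 17694; 21665; 23264; 23844; 23911; 23698; 23324; 22856; 22334; 21782; 21217;
    20649; 20085; 19528; 18983; 18451; 17932; 17429; 16941; 16469; 16011; 15570; 15144;
    14733; 14335; 13951; 13580; 13222; 12875; 12539; 12215; 11901; 11597; 11304; 11019;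
    10744; 10477; 10219; 9969; 9727; 9492; 9264; 9043; 8829; 8622; 8420; 8225; 8036;
    7852; 7673; 7500; 7332; 7168; 7010; 6855; 6706; 6560; 6419; 6282; 6148; 6018; 5892;
    5769; 5650; 5534; 5421; 5311; 5205; 5101; 5000; 4901; 4806; 4713; 4622; 4534; 4448;
    4364; 4283; 4204; 4127; 4051; 3978; 3907; 3838; 3770; 3704; 3640; 3577; 3517; 3457;
    3399; 3343; 3288; 3235; 3183; 3132; 3082; 3034; 2987; 2941; 2897; 2853; 2811; 2769;
    2729; 2690; 2651; 2614; 2577; 2542; 2507; 2473; 2440; 2408; 2377; 2346; 2316; 2287;
    2259; 2231; 2204; 2178; 2152; 2127; 2103; 2079; 2056; 2033; 2011; 1989; 1968; 1948;
    1928; 1908; 1889; 1870; 1852; 1834; 1817; 1800; 1784; 1768; 1752; 1737; 1722; 1707;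
    1693; 1679; 1665; 1652; 1639; 1627; 1614; 1602; 1591; 1579; 1568; 1557; 1547; 1536;
    1526; 1516; 1507; 1497; 1488; 1479; 1470; 1462; 1453; 1445; 1437; 1430; 1422; 1415;
    1407; 1400; 1394; 1387; 1380; 1374; 1368; 1362; 1356; 1350; 1344; 1339; 1333; 1328;
    1323; 1318; 1313; 1308; 1303; 1299; 1294; 1290; 1286; 1281; 1277; 1273; 1270; 1266;
    1262; 1259; 1255; 1252; 1248; 1245; 1242; 1239; 1236; 1233; 1230; 1227; 1224; 1221;
    1219; 1216; 1214; 1211; 1209; 1206; 1204; 1202; 1199; 1197; 1195; 1193; 1191; 1189;
    1187; 1185; 1183; 1182; 1180; 1178; 1176; 1175; 1173; 1171; 1170; 1168; 1167; 1165;
    1164; 1163; 1161; 1160; 1159; 1157; 1156; 1155; 1154; 1152; 1151; 1150; 1149; 1148;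
    1147; 1146; 1145; 1144; 1143; 1142; 1141; 1140; 1140; 1139; 1138; 1137; 1136; 1135;
    1135; 1134; 1133; 1133; 1132; 1131; 1131; 1130; 1129; 1129; 1128; 1128; 1127; 1126;
    1126; 1125; 1125; 1125; 1124; 1124; 1123; 1123; 1122; 1122; 1122; 1121; 1121; 1121;
    1120; 1120; 1120; 1119; 1119; 1119; 1118; 1118; 1118; 1118; 1117; 1117; 1117; 1117;
    1117; 1116; 1116; 1116; 1116; 1115; 1115; 1115; 1115; 1115; 1114; 1114; 1114; 1114;
    1113; 1113; 1113; 1113; 1112; 1112; 1111; 1110; 1107; 1107; 1108; 1108; 1108; 1109;
    1109; 1109; 1110; 1110; 1110; 1111; 1111; 1111; 1112; 1112; 1112; 1113; 1113; 1113;
    1114; 1114; 1114; 1115; 1115; 1115; 1116; 1116; 1116; 1117; 1117; 1117; 1118; 1118;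
    1118; 1119; 1119; 1119; 1120; 1120; 1120; 1121; 1121; 1121; 1122; 1122; 1122; 1123;
    1123; 1123; 1124; 1124; 1124; 1125; 1125; 1125; 1126; 1126; 1126; 1127; 1127; 1127;
    1128; 1128; 1128; 1129; 1129; 1130; 1130; 1130; 1131; 1131; 1131; 1132; 1132; 1132;
    1133; 1133; 1133; 1134; 1134; 1134; 1135; 1135; 1135; 1136; 1136; 1136; 1137; 1137;
    1137; 1138; 1138; 1138; 1139; 1139; 1139; 1140; 1140; 1140; 1141; 1141; 1141; 1142;
    1142; 1142; 1143; 1143; 1143; 1144; 1144; 1145; 1145; 1145; 1146; 1146; 1146; 1147;
    1147; 1147; 1148; 1148; 1148; 1149; 1149; 1149; 1150; 1150; 1150; 1151; 1151; 1151;
    1152; 1152; 1152; 1153; 1153; 1153; 1154; 1154; 1155; 1155; 1155; 1156; 1156; 1156;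
    1157; 1157; 1157; 1158; 1158; 1158; 1159; 1159; 1159; 1160; 1160; 1160; 1161; 1161;
    1161; 1162; 1162; 1163; 1163; 1163; 1164; 1164; 1164 ]%Z.

Definition entry (l : list Z) (k : nat) : Z := nth k l 0%Z.

Fixpoint dot (a b : list Z) : Z :=
  match a, b with x :: a', y :: b' => (x * y + dot a' b')%Z | _, _ => 0%Z end.

Fixpoint padd (a b : list Z) : list Z :=
  match a, b with
  | x :: a', y :: b' => (x + y)%Z :: padd a' b'
  | [], _ => b
  | _, [] => a
  end.

(** The reversed prefix followed by the tail reads l_k, ..., l_0, l_1, ..., the entries at index |k
    - m|. A whole row of [kernel] is produced in one pass and the convolution becomes a dot product
    of integer lists. *)
Definition zkernel (l : list Z) (k : nat) : list Z :=
  padd (rev (firstn (S k) l) ++ tl l) (skipn k l).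

Definition zbilin (a b : list Z) (k : nat) : Z := dot a (zkernel b k).

Fixpoint zsum (n : nat) (f : nat -> Z) : Z :=
  match n with O => 0%Z | S m => (zsum m f + f m)%Z end.

(** On a reversed list these are the sums of the last m entries; for a list of length 261,
    [dot l (partial_sums 0 (rev l))] thus adds l_m l_j over all m + j >= 261 without a double
    loop. *)
Fixpoint partial_sums (acc : Z) (l : list Z) : list Z :=
  match l with [] => [] | x :: l' => acc :: partial_sums (acc + x) l' end.

(* [acc * (6001 / 6000) ^ j], rounded up. *)
Fixpoint grow (n : nat) (acc : Z) : list Z :=
  match n with
  | O => []
  | S m => let acc' := (acc + acc / 6000 + 1)%Z in acc' :: grow m acc'
  end.

Definition band : nat := 261.
Definition last_weight : nat := 507.
Definition ext_weight : list Z :=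
  weight_data ++ grow band (entry weight_data last_weight).

(* Rounding up from units of 10^(-10) to units of 10^(-6); 0 is kept. *)
Definition coarse (z : Z) : Z := if (z =? 0)%Z then 0%Z else (z / 10 ^ 4 + 1)%Z.
Definition majorant_data : list Z := map coarse corner_data.

Definition symbol_num (k : nat) : Z :=
  (1109643839000099 * Z.of_nat k - 10 ^ 15)%Z.

Definition residual_num (l : list Z) (k : nat) : Z :=
  (10 ^ 15 * Z.of_nat k * zbilin l l k - 4 * 10 ^ 10 * symbol_num k * entry l k)%Z.

Definition residual_term (l : list Z) (k : nat) : Z :=
  if (k <=? 2)%nat then 0%Z
  else (entry weight_data k * Z.abs (residual_num l k) / Z.of_nat k + 1)%Z.

(* An upper bound, in units of 1 / (4 * 10^38), for the weighted norm of the residual;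
   the second summand accounts for the indices k >= 261, where the residual is the
   tail of a convolution and the weights that matter are at most 1200 / 1000. *)
Definition residual_total (l : list Z) : Z :=
  (zsum band (residual_term l)
   + 1200000000000000000 * dot l (partial_sums 0 (rev l)))%Z.

(** This is [58 / 10 ^ 8] in units of 1 / (4 * 10^38). *)
Definition residual_max : Z := 232000000000000000000000000000000%Z.

Definition in_range (lo hi z : Z) : bool := ((lo <=? z) && (z <=? hi))%Z.

Definition range_check (l : list Z) : bool :=
  ((length l =? band)%nat && (entry l 0 =? 0)%Z &&
   forallb (fun k => in_range 0 (10 ^ 4 * entry majorant_data k) (entry l k))
     (seq 0 band))%bool.

Definition omega_check (k : nat) : bool :=
  (10 ^ 18 * Z.of_nat k <=? symbol_num k * entry weight_data k)%Z.

(** The column condition for [theta = 991 / 1000], cleared of denominators. The majorant dominates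
    all three candidates, so one check of the linearisation serves them all. *)
Definition column_check (m : nat) : bool :=
  (10 ^ 15 * Z.of_nat m * zbilin majorant_data ext_weight m
   <=? 2 * 991 * symbol_num m * entry weight_data m * 10 ^ 3)%Z.

(** A strengthened column at index 507, in which all weights to the left are replaced by the last
    one; in this form it passes to every later column after multiplication by a power of [ratio]. *)
Definition last_column_check : bool :=
  (10 ^ 15 * Z.of_nat last_weight
   * dot majorant_data (padd (repeat (entry weight_data last_weight) band)
                            (skipn last_weight ext_weight))
   <=? 2 * 991 * symbol_num last_weight * entry weight_data last_weight * 10 ^ 3)%Z.

Definition row_check (k m : nat) : bool :=
  (10 ^ 15 * Z.of_nat m * (entry majorant_data (m - k) + entry majorant_data (k + m))
   <=? 44 * symbol_num m * entry weight_data m)%Z.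

Definition scaled (d : R) (l : list Z) (k : nat) : R := IZR (entry l k) / d.

Lemma entry_high (l : list Z) (k : nat) : (length l <= k)%nat -> entry l k = 0%Z.
Proof. apply nth_overflow. Qed.

Lemma entry_app_l (a b : list Z) (k : nat) :
  (k < length a)%nat -> entry (a ++ b) k = entry a k.
Proof. apply app_nth1. Qed.

Lemma entry_app_r (a b : list Z) (k : nat) :
  (length a <= k)%nat -> entry (a ++ b) k = entry b (k - length a).
Proof. apply app_nth2. Qed.

Lemma entry_repeat (z : Z) (n k : nat) : (k < n)%nat -> entry (repeat z n) k = z.
Proof. apply nth_repeat_lt. Qed.

Lemma dot_spec (a b : list Z) (n : nat) : (length a <= n)%nat ->
  rsum n (fun i => IZR (entry a i) * IZR (entry b i)) = IZR (dot a b).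
Proof.
  revert b n. induction a as [|x a IH]; intros b n Hn.
  - simpl. apply rsum_zero. intros i _. rewrite entry_high by (simpl; lia). lra.
  - destruct n as [|n]; simpl in Hn; [lia|]. destruct b as [|y b].
    + simpl dot. apply rsum_zero. intros i _. rewrite (entry_high []) by (simpl; lia). lra.
    + rewrite rsum_first. simpl dot. rewrite plus_IZR, mult_IZR. f_equal.
      apply (IH b). lia.
Qed.

Lemma padd_spec (a b : list Z) (i : nat) :
  entry (padd a b) i = (entry a i + entry b i)%Z.
Proof.
  revert b i. induction a as [|x a IH]; intros b i.
  - simpl. rewrite (entry_high []) by (simpl; lia). reflexivity.
  - destruct b as [|y b].
    + simpl padd. rewrite (entry_high []) by (simpl; lia). ring.
    + destruct i as [|i]; [reflexivity|]. apply (IH b i).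
Qed.

Lemma entry_skipn (l : list Z) (k m : nat) : entry (skipn k l) m = entry l (k + m).
Proof.
  revert l. induction k as [|k IH]; intros l; [reflexivity|].
  destruct l as [|x l]; [|apply (IH l)].
  rewrite !entry_high; auto; simpl; lia.
Qed.

Lemma zkernel_spec (l : list Z) (k m : nat) : (k < length l)%nat ->
  entry (zkernel l k) m = (entry l (k - m + (m - k)) + entry l (k + m))%Z.
Proof.
  intros Hk. unfold zkernel. rewrite padd_spec, entry_skipn. f_equal.
  assert (Hlen : length (rev (firstn (S k) l)) = S k)
    by (rewrite length_rev, length_firstn; lia).
  unfold entry. destruct (le_lt_dec m k).
  - rewrite app_nth1, rev_nth; rewrite ?length_rev in *; try lia.
    rewrite Hlen, nth_firstn. replace (S k - S m <? S k)%nat with true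
      by (symmetry; apply Nat.ltb_lt; lia).
    f_equal. lia.
  - rewrite app_nth2, Hlen by lia. destruct l as [|x l]; [simpl in Hk; lia|].
    replace (k - m + (m - k))%nat with (S (m - S k)) by lia. reflexivity.
Qed.

Lemma zbilin_spec (a b : list Z) (d d' : R) (n k : nat) :
  d <> 0 -> d' <> 0 -> (k < length b)%nat -> (length a <= n)%nat ->
  bilin (scaled d a) (scaled d' b) n k = IZR (zbilin a b k) / (d * d').
Proof.
  intros Hd Hd' Hk Hn. unfold zbilin. rewrite <- (dot_spec a _ n Hn). unfold bilin.
  unfold Rdiv. rewrite Rmult_comm, <- rsum_scal. apply rsum_ext. intros m _.
  rewrite zkernel_spec by auto. unfold kernel, scaled. rewrite plus_IZR. field. auto.
Qed.

Lemma zsum_spec (n : nat) (f : nat -> Z) : IZR (zsum n f) = rsum n (fun i => IZR (f i)).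
Proof. induction n as [|n IH]; simpl; [reflexivity|]. now rewrite plus_IZR, IH. Qed.

Lemma partial_sums_spec (l : list Z) (acc : Z) (m : nat) : (m < length l)%nat ->
  IZR (entry (partial_sums acc l) m) = IZR acc + rsum m (fun j => IZR (entry l j)).
Proof.
  revert acc m. induction l as [|x l IH]; intros acc m Hm; simpl in Hm; [lia|].
  destruct m as [|m]; [simpl; unfold entry; simpl; ring|].
  change (entry (partial_sums acc (x :: l)) (S m))
    with (entry (partial_sums (acc + x) l) m).
  rewrite IH, rsum_first, plus_IZR by lia. apply Rplus_assoc.
Qed.

Lemma forallb_seq (f : nat -> bool) (a n : nat) :
  forallb f (seq a n) = true -> forall k, (a <= k < a + n)%nat -> f k = true.
Proof.
  intros H k Hk. rewrite forallb_forall in H. apply H. apply in_seq. lia.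
Qed.

(** * The weights and the majorant satisfy the hypotheses on the norm *)

Definition ratio : R := 6001 / 6000.

Lemma grow_spec (n j : nat) (acc : Z) : (j < n)%nat ->
  IZR acc * ratio ^ S j <= IZR (entry (grow n acc) j).
Proof.
  revert acc j. induction n as [|n IH]; intros acc j Hj; [lia|].
  assert (H : IZR acc * ratio <= IZR (acc + acc / 6000 + 1)).
  { assert (D := Z_div_mod_eq_full acc 6000).
    assert (M := Z.mod_pos_bound acc 6000 ltac:(lia)).
    assert (E : IZR acc <= 6000 * IZR (acc / 6000) + 6000).
    { rewrite <- mult_IZR, <- plus_IZR. apply IZR_le. lia. }
    rewrite !plus_IZR. unfold ratio. lra. }
  destruct j as [|j].
  - simpl grow. unfold entry. simpl. lra.
  - change (entry (grow (S n) acc) (S j))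
      with (entry (grow n (acc + acc / 6000 + 1)) j).
    eapply Rle_trans; [|apply IH; lia].
    replace (IZR acc * ratio ^ S (S j)) with (IZR acc * ratio * ratio ^ S j)
      by (simpl; ring).
    apply Rmult_le_compat_r; auto. apply pow_le. unfold ratio; lra.
Qed.

Lemma ratio_pow_ge1 (n : nat) : 1 <= ratio ^ n.
Proof. apply pow_R1_Rle. unfold ratio; lra. Qed.

Lemma symbol_num_spec (k : nat) : (1 <= k)%nat ->
  symbol k = IZR (symbol_num k) / (10 ^ 15 * INR k).
Proof.
  intros Hk. unfold symbol, symbol_num.
  replace speed with (1109643839000099 / 10 ^ 15) by (unfold speed; lra).
  change (10 ^ 15)%Z with 1000000000000000%Z.
  rewrite minus_IZR, mult_IZR, <- INR_IZR_INZ.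
  assert (0 < INR k) by (apply lt_0_INR; lia). field. lra.
Qed.

Lemma symbol_incr (i j : nat) : (1 <= i <= j)%nat -> symbol i <= symbol j.
Proof.
  intros Hij. unfold symbol.
  assert (/ INR j <= / INR i); [|lra].
  apply Rinv_le_contravar; [apply lt_0_INR; lia | apply le_INR; lia].
Qed.

Definition weight (k : nat) : R :=
  if (k <=? last_weight)%nat then scaled 1000 weight_data k
  else scaled 1000 weight_data last_weight * ratio ^ (k - last_weight).

Definition majorant : nat -> R := scaled (10 ^ 6) majorant_data.

Definition candidate (l : list Z) : nat -> R := scaled (10 ^ 10) l.

Lemma in_range_spec (lo hi z : Z) : in_range lo hi z = true -> (lo <= z <= hi)%Z.
Proof.
  intros H. apply andb_prop in H. destruct H as [A B].
  apply Z.leb_le in A. apply Z.leb_le in B. auto.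
Qed.

Lemma majorant_length : length majorant_data = band.
Proof. vm_compute. reflexivity. Qed.

Lemma majorant_range_ok :
  forallb (fun k => in_range 0 (10 ^ 6) (entry majorant_data k)) (seq 0 band) = true.
Proof. vm_compute. reflexivity. Qed.

Lemma weight_length : length weight_data = S last_weight.
Proof. vm_compute. reflexivity. Qed.

Lemma weight_range_ok :
  forallb (fun k => in_range 1100 24000 (entry weight_data k)) (seq 3 505) = true.
Proof. vm_compute. reflexivity. Qed.

Lemma omega_check_ok : forallb omega_check (seq 3 505) = true.
Proof. vm_compute. reflexivity. Qed.

Lemma weight_max_ok :
  forallb (fun k => in_range 0 (entry weight_data last_weight) (entry weight_data k))
    (seq 248 260) = true.
Proof. vm_compute. reflexivity. Qed.

Lemma ext_weight_ok :
  forallb (fun k => in_range 0 1200 (entry ext_weight k)) (seq band band) = true.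
Proof. vm_compute. reflexivity. Qed.

Lemma column_check_ok : forallb column_check (seq 3 505) = true.
Proof. vm_compute. reflexivity. Qed.

Lemma last_column_check_ok : last_column_check = true.
Proof. vm_compute. reflexivity. Qed.

Lemma row_check_ok (k : nat) : (1 <= k <= 2)%nat -> forallb (row_check k) (seq 3 260) = true.
Proof.
  intros Hk. assert (k = 1 \/ k = 2)%nat as [-> | ->] by lia; vm_compute; reflexivity.
Qed.

Lemma majorant_range (k : nat) : (0 <= entry majorant_data k <= 10 ^ 6)%Z.
Proof.
  destruct (le_lt_dec band k).
  - rewrite entry_high by (rewrite majorant_length; auto). lia.
  - apply in_range_spec, (forallb_seq _ _ _ majorant_range_ok k). lia.
Qed.

Lemma weight_range (k : nat) : (3 <= k <= last_weight)%nat ->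
  (1100 <= entry weight_data k <= 24000)%Z.
Proof.
  intros Hk. apply in_range_spec, (forallb_seq _ _ _ weight_range_ok k).
  unfold last_weight in *; lia.
Qed.

Lemma scaled_nonneg (d : R) (l : list Z) (k : nat) :
  0 < d -> (0 <= entry l k)%Z -> 0 <= scaled d l k.
Proof.
  intros Hd H. apply IZR_le in H. apply Rmult_le_pos; auto.
  now apply Rlt_le, Rinv_0_lt_compat.
Qed.

Lemma scaled_le (d : R) (l l' : list Z) (k k' : nat) :
  0 < d -> (entry l k <= entry l' k')%Z -> scaled d l k <= scaled d l' k'.
Proof.
  intros Hd H. apply IZR_le in H. apply Rmult_le_compat_r; auto.
  now apply Rlt_le, Rinv_0_lt_compat.
Qed.

Lemma weight_eq (k : nat) : (k <= last_weight)%nat -> weight k = scaled 1000 weight_data k.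
Proof. intros Hk. unfold weight. apply Nat.leb_le in Hk. now rewrite Hk. Qed.

Lemma weight_high (k : nat) : (last_weight <= k)%nat ->
  weight k = weight last_weight * ratio ^ (k - last_weight).
Proof.
  intros Hk. rewrite (weight_eq last_weight) by auto. unfold weight.
  destruct (Nat.leb_spec k last_weight); auto.
  replace k with last_weight by lia. rewrite Nat.sub_diag. simpl. ring.
Qed.

Lemma weight_low (k : nat) : (k <= 2)%nat -> weight k = 0.
Proof.
  intros Hk. rewrite weight_eq by (unfold last_weight; lia).
  unfold scaled. replace (entry weight_data k) with 0%Z; [unfold Rdiv; ring|].
  destruct k as [|[|[|k]]]; [reflexivity..|lia].
Qed.

Lemma weight_bounds_low (k : nat) : (3 <= k <= last_weight)%nat ->
  11 / 10 <= weight k <= 24.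
Proof.
  intros Hk. destruct (weight_range k Hk) as [A B]. apply IZR_le in A. apply IZR_le in B.
  rewrite weight_eq by lia. unfold scaled. lra.
Qed.

Lemma weight_upper (k : nat) : weight k <= 24 * ratio ^ (k - last_weight).
Proof.
  destruct (le_lt_dec k last_weight).
  - replace (k - last_weight)%nat with 0%nat by lia.
    destruct (le_lt_dec k 2); [rewrite weight_low by auto; simpl; lra|].
    assert (H := weight_bounds_low k ltac:(lia)). simpl. lra.
  - rewrite weight_high by lia. apply Rmult_le_compat_r.
    + assert (H := ratio_pow_ge1 (k - last_weight)). lra.
    + apply weight_bounds_low. unfold last_weight; lia.
Qed.

Lemma weight_lower (k : nat) : (3 <= k)%nat ->
  11 / 10 * ratio ^ (k - last_weight) <= weight k.
Proof.
  intros Hk. destruct (le_lt_dec k last_weight).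
  - replace (k - last_weight)%nat with 0%nat by lia.
    assert (H := weight_bounds_low k ltac:(lia)). simpl. lra.
  - rewrite weight_high by lia. apply Rmult_le_compat_r.
    + assert (H := ratio_pow_ge1 (k - last_weight)). lra.
    + apply weight_bounds_low. unfold last_weight; lia.
Qed.

Lemma weight_nonneg : nonneg weight.
Proof.
  intros k. destruct (le_lt_dec k 2); [rewrite weight_low by auto; lra|].
  eapply Rle_trans; [|apply weight_lower; lia].
  assert (H := ratio_pow_ge1 (k - last_weight)). lra.
Qed.

Lemma weight_le_ext (k : nat) : (k <= last_weight + band)%nat ->
  weight k <= scaled 1000 ext_weight k.
Proof.
  intros Hk. assert (Hlen := weight_length).
  unfold ext_weight, scaled. destruct (le_lt_dec k last_weight).
  - rewrite weight_eq, entry_app_l by (rewrite ?Hlen; lia). apply Rle_refl.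
  - rewrite weight_high, weight_eq, entry_app_r by (rewrite ?Hlen; lia). rewrite Hlen.
    assert (G := grow_spec band (k - S last_weight) (entry weight_data last_weight) ltac:(lia)).
    replace (S (k - S last_weight)) with (k - last_weight)%nat in G by lia.
    unfold scaled. lra.
Qed.

Lemma omega_weight_ge1 (k : nat) : (3 <= k)%nat -> 1 <= omega weight k.
Proof.
  intros Hk.
  assert (L : forall j, (3 <= j <= last_weight)%nat -> 1 <= omega weight j).
  { intros j Hj.
    assert (A := forallb_seq _ _ _ omega_check_ok j ltac:(unfold last_weight in *; lia)).
    unfold omega_check in A. apply Z.leb_le in A.
    change (10 ^ 18)%Z with 1000000000000000000%Z in A.
    apply IZR_le in A. rewrite !mult_IZR, <- INR_IZR_INZ in A.
    unfold omega. rewrite symbol_num_spec, weight_eq by lia. unfold scaled.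
    assert (0 < INR j) by (apply lt_0_INR; lia).
    apply Rmult_le_reg_r with (10 ^ 18 * INR j); [lra|].
    replace (IZR (symbol_num j) / (10 ^ 15 * INR j) * (IZR (entry weight_data j) / 1000)
             * (10 ^ 18 * INR j))
      with (IZR (symbol_num j) * IZR (entry weight_data j)) by (field; lra). lra. }
  destruct (le_lt_dec k last_weight); [apply L; lia|].
  eapply Rle_trans; [apply (L last_weight); unfold last_weight; lia|].
  unfold omega. apply Rmult_le_compat.
  - apply Rlt_le, symbol_pos. unfold last_weight; lia.
  - apply weight_nonneg.
  - apply symbol_incr. unfold last_weight in *; lia.
  - rewrite (weight_high k) by lia.
    assert (H := ratio_pow_ge1 (k - last_weight)). assert (W := weight_nonneg last_weight). nra.
Qed.

Lemma majorant_nonneg : nonneg majorant.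
Proof. intros k. apply scaled_nonneg; [lra|apply majorant_range]. Qed.

Lemma majorant_0 : majorant 0%nat = 0.
Proof.
  unfold majorant, scaled. change (entry majorant_data 0) with 0%Z. unfold Rdiv; ring.
Qed.

Lemma majorant_high (k : nat) : (band <= k)%nat -> majorant k = 0.
Proof.
  intros Hk. unfold majorant, scaled.
  rewrite entry_high by (rewrite majorant_length; auto). unfold Rdiv; ring.
Qed.

Lemma majorant_le1 (k : nat) : majorant k <= 1.
Proof.
  destruct (majorant_range k) as [_ A].
  change (10 ^ 6)%Z with 1000000%Z in A. apply IZR_le in A.
  unfold majorant, scaled. lra.
Qed.

Lemma column_from_check (m : nat) (z : Z) : (1 <= m <= last_weight)%nat ->
  (10 ^ 15 * Z.of_nat m * z <= 2 * 991 * symbol_num m * entry weight_data m * 10 ^ 3)%Z ->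
  IZR z / (10 ^ 6 * 1000) <= 2 * (991 / 1000) * omega weight m.
Proof.
  intros Hm A. change (10 ^ 15)%Z with 1000000000000000%Z in A.
  change (10 ^ 3)%Z with 1000%Z in A.
  apply IZR_le in A. rewrite !mult_IZR, <- INR_IZR_INZ in A.
  unfold omega. rewrite symbol_num_spec, weight_eq by lia. unfold scaled.
  assert (0 < INR m) by (apply lt_0_INR; lia).
  apply Rmult_le_reg_r with (10 ^ 24 * INR m); [lra|].
  replace (IZR z / (10 ^ 6 * 1000) * (10 ^ 24 * INR m)) with (10 ^ 15 * INR m * IZR z)
    by (field; lra).
  replace (2 * (991 / 1000) * (IZR (symbol_num m) / (10 ^ 15 * INR m) *
             (IZR (entry weight_data m) / 1000)) * (10 ^ 24 * INR m))
    with (2 * 991 * IZR (symbol_num m) * IZR (entry weight_data m) * 1000) by (field; lra).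
  lra.
Qed.

Lemma last_column_bound :
  rsum band (fun i => majorant i * (weight last_weight + weight (last_weight + i)))
  <= 2 * (991 / 1000) * omega weight last_weight.
Proof.
  assert (C := last_column_check_ok). unfold last_column_check in C. apply Z.leb_le in C.
  apply column_from_check in C; [|unfold last_weight; lia].
  eapply Rle_trans; [|exact C]. assert (Hlen := majorant_length).
  rewrite <- (dot_spec majorant_data _ band) by (rewrite Hlen; auto).
  unfold Rdiv. rewrite (Rmult_comm (rsum _ _)), <- rsum_scal. apply rsum_le. intros i Hi.
  rewrite padd_spec, entry_skipn, plus_IZR.
  assert (A : weight (last_weight + i) <= scaled 1000 ext_weight (last_weight + i))
    by (apply weight_le_ext; lia).
  assert (B : weight last_weight = IZR (entry (repeat (entry weight_data last_weight) band) i)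
              / 1000).
  { rewrite weight_eq, entry_repeat by auto. reflexivity. }
  assert (P := majorant_nonneg i). unfold majorant in P |- *. unfold scaled in A, P |- *.
  rewrite B.
  apply Rle_trans with (IZR (entry majorant_data i) / 10 ^ 6 *
    (IZR (entry (repeat (entry weight_data last_weight) band) i) / 1000 +
     IZR (entry ext_weight (last_weight + i)) / 1000)).
  - apply Rmult_le_compat_l; auto. lra.
  - right. field.
Qed.

(** Beyond index 507 put [t = ratio ^ (m - last_weight)]. Weights to the right are [t] times those
    seen from 507, weights to the left are at most [t * weight last_weight], and [omega] grows at
    least by the factor [t] because [symbol] increases. *)
Lemma weight_column (m : nat) : (3 <= m)%nat ->
  bilin majorant weight band m <= 2 * (991 / 1000) * omega weight m.
Proof.
  intros Hm. destruct (le_lt_dec m last_weight) as [Hl|Hl].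
  - assert (C := forallb_seq _ _ _ column_check_ok m ltac:(unfold last_weight in *; lia)).
    unfold column_check in C. apply Z.leb_le in C.
    apply column_from_check in C; [|lia].
    assert (Hlen := majorant_length). assert (Hlen' := weight_length).
    eapply Rle_trans; [|exact C].
    rewrite <- (zbilin_spec majorant_data ext_weight (10 ^ 6) 1000 band m); try lra.
    + apply rsum_le. intros i Hi. apply Rmult_le_compat_l; [apply majorant_nonneg|].
      apply Rplus_le_compat; apply weight_le_ext; lia.
    + unfold ext_weight. rewrite length_app, Hlen'. lia.
    + rewrite Hlen. auto.
  - set (t := ratio ^ (m - last_weight)).
    assert (Ht : 1 <= t) by apply ratio_pow_ge1.
    assert (W := weight_nonneg last_weight).
    apply Rle_trans with (t * (2 * (991 / 1000) * omega weight last_weight)).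
    + eapply Rle_trans; [|apply Rmult_le_compat_l; [lra|apply last_column_bound]].
      rewrite <- rsum_scal. apply rsum_le. intros i Hi.
      rewrite <- Rmult_assoc, (Rmult_comm t), Rmult_assoc.
      apply Rmult_le_compat_l; [apply majorant_nonneg|].
      unfold kernel. rewrite Rmult_plus_distr_l. apply Rplus_le_compat.
      * replace (m - i + (i - m))%nat with (m - i)%nat by (unfold band, last_weight in *; lia).
        (* Here [m - i >= 508 - 260 = 248], and from index 248 on no table entry exceeds the last
           one; past the table the geometric growth decides. *)
        destruct (le_lt_dec (m - i) last_weight).
        -- apply Rle_trans with (weight last_weight); [|nra].
           rewrite !weight_eq by auto. apply scaled_le; [lra|].
           apply (in_range_spec 0), (forallb_seq _ _ _ weight_max_ok (m - i)).
           unfold band, last_weight in *; lia.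
        -- rewrite (weight_high (m - i)) by lia. rewrite Rmult_comm.
           apply Rmult_le_compat_r; auto. apply Rle_pow; [unfold ratio; lra|lia].
      * rewrite (weight_high (m + i)), (weight_high (last_weight + i)) by lia.
        right. unfold t. replace (m + i - last_weight)%nat with (m - last_weight + i)%nat by lia.
        replace (last_weight + i - last_weight)%nat with i by lia. rewrite pow_add. ring.
    + unfold omega. rewrite (weight_high m) by lia. fold t.
      assert (S1 := symbol_incr last_weight m ltac:(unfold last_weight in *; lia)).
      assert (0 <= t * weight last_weight) by nra. nra.
Qed.

(** As 507 = 13 * 13 * 3, the power is taken in stages, and rounding after the first keeps the
    rationals small. *)
Lemma ratio_pow_last : ratio ^ last_weight <= 109 / 100.
Proof.
  replace last_weight with (13 * (13 * 3))%nat by reflexivity.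
  rewrite !pow_mult.
  assert (A : 1 <= ratio ^ 13 <= 100217 / 100000) by (unfold ratio; simpl; lra).
  assert (B : 1 <= (ratio ^ 13) ^ 13 <= (100217 / 100000) ^ 13).
  { split; [apply pow_R1_Rle; lra | apply pow_incr; lra]. }
  apply Rle_trans with (((100217 / 100000) ^ 13) ^ 3).
  - apply pow_incr; lra.
  - simpl. lra.
Qed.

(** Up to geometric factors the weights are at most 24 and at least 11/10, and [symbol] is at least
    776/1000 from index 3 on. The constant is 2 * 24 * 1.09 / 0.853^2, about 71.9; the factor 1.09
    is needed because [i + j] may exceed 507 while [i] and [j] do not. *)
Lemma weight_submult (i j : nat) : (3 <= i)%nat -> (3 <= j)%nat ->
  kernel weight i j <= 72 * omega weight i * omega weight j.
Proof.
  intros Hi Hj.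
  set (ti := ratio ^ (i - last_weight)). set (tj := ratio ^ (j - last_weight)).
  assert (Hti : 1 <= ti) by apply ratio_pow_ge1.
  assert (Htj : 1 <= tj) by apply ratio_pow_ge1.
  assert (H1t : 1 <= ti * tj) by nra.
  assert (A : forall k, (k <= i + j)%nat -> weight k <= 24 * (109 / 100) * (ti * tj)).
  { intros k Hk. eapply Rle_trans; [apply weight_upper|].
    rewrite Rmult_assoc. apply Rmult_le_compat_l; [lra|].
    apply Rle_trans with (ratio ^ (last_weight + ((i - last_weight) + (j - last_weight)))).
    - apply Rle_pow; [unfold ratio; lra|lia].
    - rewrite !pow_add. fold ti tj. apply Rmult_le_compat_r; [lra|]. apply ratio_pow_last. }
  assert (B : forall k, (3 <= k)%nat ->
     853 / 1000 * ratio ^ (k - last_weight) <= omega weight k).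
  { intros k Hk. unfold omega.
    assert (S3 : 776 / 1000 <= symbol 3) by (unfold symbol, speed; simpl; lra).
    assert (S4 := symbol_incr 3 k ltac:(lia)). assert (W := weight_lower k Hk).
    assert (T := ratio_pow_ge1 (k - last_weight)).
    apply Rle_trans with (776 / 1000 * (11 / 10 * ratio ^ (k - last_weight))); [lra|].
    apply Rmult_le_compat; lra. }
  assert (Bi := B i Hi). assert (Bj := B j Hj). fold ti in Bi. fold tj in Bj.
  assert (D : 853 / 1000 * ti * (853 / 1000 * tj) <= omega weight i * omega weight j)
    by (apply Rmult_le_compat; lra).
  unfold kernel. assert (A1 := A (i - j + (j - i))%nat ltac:(lia)).
  assert (A2 := A (i + j)%nat ltac:(lia)). lra.
Qed.

Lemma majorant_row (k m : nat) : (1 <= k <= 2)%nat -> (3 <= m)%nat ->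
  kernel majorant k m <= 2 * (22 / 1000) * omega weight m.
Proof.
  intros Hk Hm. assert (W := omega_weight_ge1 m Hm). unfold kernel.
  replace (k - m + (m - k))%nat with (m - k)%nat by lia.
  destruct (le_lt_dec (band + 2) m).
  - rewrite !majorant_high by lia. lra.
  - assert (A := forallb_seq _ _ _ (row_check_ok k Hk) m ltac:(unfold band in *; lia)).
    unfold row_check in A. apply Z.leb_le in A.
    change (10 ^ 15)%Z with 1000000000000000%Z in A.
    apply IZR_le in A. rewrite !mult_IZR, plus_IZR, <- INR_IZR_INZ in A.
    unfold omega, majorant. rewrite symbol_num_spec, weight_eq
      by (unfold last_weight, band in *; lia). unfold scaled.
    assert (0 < INR m) by (apply lt_0_INR; lia).
    apply Rmult_le_reg_r with (10 ^ 21 * INR m); [lra|].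
    replace ((IZR (entry majorant_data (m - k)) / 10 ^ 6
       + IZR (entry majorant_data (k + m)) / 10 ^ 6) * (10 ^ 21 * INR m))
      with (10 ^ 15 * INR m * (IZR (entry majorant_data (m - k))
            + IZR (entry majorant_data (k + m)))) by (field; lra).
    replace (2 * (22 / 1000) * (IZR (symbol_num m) / (10 ^ 15 * INR m) *
             (IZR (entry weight_data m) / 1000)) * (10 ^ 21 * INR m))
      with (44 * IZR (symbol_num m) * IZR (entry weight_data m)) by (field; lra).
    lra.
Qed.

(** * Residual and error bounds for an approximate solution *)

Section Candidate.
Variable l : list Z.
Hypothesis l_range : range_check l = true.

Lemma candidate_length : length l = band.
Proof.
  assert (H := l_range). apply andb_prop in H. destruct H as [H _].
  apply andb_prop in H. destruct H as [H _]. now apply Nat.eqb_eq.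
Qed.

Lemma candidate_0 : candidate l 0%nat = 0.
Proof.
  assert (H := l_range). apply andb_prop in H. destruct H as [H _].
  apply andb_prop in H. destruct H as [_ H]. apply Z.eqb_eq in H.
  unfold candidate, scaled. rewrite H. unfold Rdiv; ring.
Qed.

Lemma candidate_range (k : nat) :
  (0 <= entry l k <= 10 ^ 4 * entry majorant_data k)%Z.
Proof.
  destruct (le_lt_dec band k).
  - rewrite !entry_high by (rewrite ?majorant_length, ?candidate_length; auto). lia.
  - assert (H := l_range). apply andb_prop in H. destruct H as [_ H].
    apply in_range_spec, (forallb_seq _ _ _ H k). lia.
Qed.

Lemma candidate_nonneg : nonneg (candidate l).
Proof. intros k. apply scaled_nonneg; [lra|apply candidate_range]. Qed.

Lemma candidate_high (k : nat) : (band <= k)%nat -> candidate l k = 0.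
Proof.
  intros Hk. unfold candidate, scaled.
  rewrite entry_high by (rewrite candidate_length; auto). unfold Rdiv; ring.
Qed.

Lemma candidate_le_majorant (k : nat) : candidate l k <= majorant k.
Proof.
  destruct (candidate_range k) as [_ A]. change (10 ^ 4)%Z with 10000%Z in A.
  apply IZR_le in A. rewrite mult_IZR in A. unfold candidate, majorant, scaled. lra.
Qed.

Lemma candidate_quad (k : nat) : (k < band)%nat ->
  quad band (candidate l) k = IZR (zbilin l l k) / (4 * 10 ^ 20).
Proof.
  intros Hk. unfold quad, candidate.
  rewrite zbilin_spec by (rewrite ?candidate_length; auto; lra). field.
Qed.

Lemma residual_inner (k : nat) : (k < band)%nat ->
  weight k * Rabs (quad band (candidate l) k - symbol k * candidate l k)
  <= / (4 * 10 ^ 38) * IZR (residual_term l k).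
Proof.
  intros Hk. unfold residual_term. destruct (Nat.leb_spec k 2).
  { rewrite weight_low by auto. lra. }
  rewrite candidate_quad, symbol_num_spec, weight_eq
    by (unfold band, last_weight in *; lia).
  unfold candidate, scaled. set (w := entry weight_data k). set (z := residual_num l k).
  assert (Hp : 0 < INR k) by (apply lt_0_INR; lia).
  replace (IZR (zbilin l l k) / (4 * 10 ^ 20) -
     IZR (symbol_num k) / (10 ^ 15 * INR k) * (IZR (entry l k) / 10 ^ 10))
    with (IZR z / (4 * 10 ^ 35 * INR k)).
  2:{ unfold z, residual_num. change (10 ^ 15)%Z with 1000000000000000%Z.
      change (10 ^ 10)%Z with 10000000000%Z.
      rewrite minus_IZR, !mult_IZR, <- INR_IZR_INZ. field. lra. }
  unfold Rdiv at 2. rewrite Rabs_mult, <- abs_IZR.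
  rewrite (Rabs_pos_eq (/ _)) by (apply Rlt_le, Rinv_0_lt_compat; lra).
  assert (D : IZR (w * Z.abs z) <= INR k * IZR (w * Z.abs z / Z.of_nat k + 1)).
  { rewrite INR_IZR_INZ, <- mult_IZR. apply IZR_le.
    assert (E := Z_div_mod_eq_full (w * Z.abs z) (Z.of_nat k)).
    assert (F := Z.mod_pos_bound (w * Z.abs z) (Z.of_nat k) ltac:(lia)). lia. }
  rewrite mult_IZR in D.
  apply Rmult_le_reg_r with (4 * 10 ^ 38 * INR k); [lra|].
  replace (IZR w / 1000 * (IZR (Z.abs z) * / (4 * 10 ^ 35 * INR k)) * (4 * 10 ^ 38 * INR k))
    with (IZR w * IZR (Z.abs z)) by (field; lra).
  replace (/ (4 * 10 ^ 38) * IZR (w * Z.abs z / Z.of_nat k + 1) * (4 * 10 ^ 38 * INR k))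
    with (INR k * IZR (w * Z.abs z / Z.of_nat k + 1)) by (field; lra).
  exact D.
Qed.

(** From index 261 on the candidate vanishes and the residual is the convolution alone, which ends
    before index 522. There the weights are at most 12/10, and 12/10 times [/ 4] is the factor
    3/10. *)
Lemma residual_outer (M : nat) :
  rsum M (fun t => weight (band + t) *
     Rabs (quad band (candidate l) (band + t) - symbol (band + t) * candidate l (band + t)))
  <= 3 / 10 ^ 21 * IZR (dot l (partial_sums 0 (rev l))).
Proof.
  set (U := candidate l). assert (HU : nonneg U) by apply candidate_nonneg.
  assert (HUh : forall k, (band <= k)%nat -> U k = 0) by apply candidate_high.
  assert (Q : forall t, quad band U (band + t)
                = / 4 * rsum band (fun m => U m * U (band + t - m)%nat)).
  { intros t. unfold quad, bilin. f_equal. apply rsum_ext. intros m Hm. unfold kernel.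
    rewrite (HUh (band + t + m)%nat) by lia.
    replace (band + t - m + (m - (band + t)))%nat with (band + t - m)%nat by lia.
    ring. }
  apply Rle_trans with
    (rsum M (fun t => 3 / 10 * rsum band (fun m => U m * U (band + t - m)%nat))).
  - apply rsum_le. intros t _.
    rewrite (HUh (band + t)%nat), Rmult_0_r, Rminus_0_r by lia.
    rewrite Rabs_pos_eq by (apply quad_nonneg; auto). rewrite Q.
    set (s := rsum band _).
    assert (Hs : 0 <= s) by (apply rsum_nonneg; intros; apply Rmult_le_pos; auto).
    destruct (le_lt_dec band t).
    + replace s with 0; [lra|]. symmetry. apply rsum_zero. intros m Hm.
      rewrite (HUh (band + t - m)%nat) by lia. ring.
    + assert (W : weight (band + t) <= 12 / 10).
      { eapply Rle_trans; [apply weight_le_ext; unfold last_weight, band in *; lia|].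
        assert (A := in_range_spec _ _ _
          (forallb_seq _ _ _ ext_weight_ok (band + t) ltac:(lia))).
        destruct A as [_ A]. apply IZR_le in A. unfold scaled. lra. }
      nra.
  - rewrite rsum_scal, rsum_switch.
    replace (3 / 10 ^ 21 * IZR (dot l (partial_sums 0 (rev l))))
      with (3 / 10 * (/ 10 ^ 20 * IZR (dot l (partial_sums 0 (rev l))))) by field.
    apply Rmult_le_compat_l; [lra|].
    rewrite <- (dot_spec l _ band) by (rewrite candidate_length; auto).
    rewrite <- rsum_scal. apply rsum_le. intros m Hm. rewrite rsum_scal.
    rewrite partial_sums_spec by (rewrite length_rev, candidate_length; auto).
    replace (/ 10 ^ 20 * (IZR (entry l m) * (IZR 0 + rsum m (fun j => IZR (entry (rev l) j)))))
      with (U m * (/ 10 ^ 10 * rsum m (fun j => IZR (entry (rev l) j))))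
      by (unfold U, candidate, scaled; field).
    apply Rmult_le_compat_l; auto.
    (* For fixed [m] only the last [m] entries of the candidate occur, because
       [band + t - m >= band - m]. *)
    eapply Rle_trans; [apply (rsum_support_le m)|].
    + intros; apply HU.
    + intros i Hi. apply HUh. lia.
    + rewrite <- rsum_scal. right. destruct m as [|m]; [reflexivity|].
      rewrite <- (rsum_rev m). apply rsum_ext. intros j Hj.
      unfold U, candidate, scaled, entry.
      rewrite rev_nth by (rewrite candidate_length; lia). rewrite candidate_length.
      unfold Rdiv. rewrite Rmult_comm. do 3 f_equal. lia.
Qed.

Lemma residual_total_IZR : IZR (residual_total l) =
  IZR (zsum band (residual_term l)) + 12 * 10 ^ 17 * IZR (dot l (partial_sums 0 (rev l))).
Proof.
  unfold residual_total. rewrite plus_IZR, mult_IZR. f_equal. f_equal. lra.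
Qed.

Hypothesis l_residual : (residual_total l <= residual_max)%Z.

Lemma candidate_residual (M : nat) :
  rsum M (fun k => weight k * Rabs (quad band (candidate l) k - symbol k * candidate l k))
  <= 58 / 10 ^ 8.
Proof.
  eapply Rle_trans; [apply (rsum_mono M (band + M))|].
  - intros i. apply Rmult_le_pos; [apply weight_nonneg|apply Rabs_pos].
  - lia.
  - rewrite rsum_split. assert (A := residual_outer M).
    assert (B := rsum_le band _ _ residual_inner).
    rewrite rsum_scal, <- zsum_spec in B.
    assert (C := IZR_le _ _ l_residual).
    rewrite residual_total_IZR in C. unfold residual_max in C. lra.
Qed.

(** The admissible radii satisfy 58/10^8 + 18 r^2 <= 9/1000 r; the smaller root is about
    7.6/10^5. *)
Definition radius : R := 8 / 10 ^ 5.

Lemma radius_closed :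
  58 / 10 ^ 8 + 991 / 1000 * radius + / 4 * 72 * radius * radius <= radius.
Proof. unfold radius. lra. Qed.

Let a := candidate l 1.
Let b := candidate l 2.

Lemma candidate_approx (n k : nat) : (3 <= k)%nat ->
  approx a b n k <= candidate l k + radius / omega weight k.
Proof.
  apply (upper_approx band weight majorant (991 / 1000) 72) with (eta := 58 / 10 ^ 8);
    auto using weight_low, weight_nonneg, omega_weight_ge1, majorant_nonneg, majorant_0,
      majorant_high, weight_column, weight_submult, candidate_nonneg, candidate_0,
      candidate_high, candidate_le_majorant, candidate_residual, radius_closed;
    unfold radius; lra.
Qed.

(** The error is [22 / 1000 * radius + / 2 * (radius * radius)], that is 17632/10^10, rounded up. *)
Lemma candidate_coef_upper (n k : nat) : (1 <= k <= 2)%nat ->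
  coef a b n k <= quad band (candidate l) k + 1764 / 10 ^ 9.
Proof.
  intros Hk. eapply Rle_trans.
  - apply (upper_coef band weight majorant (991 / 1000) 72) with
      (eta := 58 / 10 ^ 8) (r := radius) (gam := 22 / 1000);
    auto using weight_low, weight_nonneg, omega_weight_ge1, majorant_nonneg, majorant_0,
      majorant_high, weight_column, weight_submult, candidate_nonneg, candidate_0,
      candidate_high, candidate_le_majorant, candidate_residual, radius_closed, majorant_row;
    unfold radius; lra.
  - unfold radius. lra.
Qed.

Lemma candidate_coef_lower (p : nat -> R) (k : nat) : (1 <= k <= 2)%nat ->
  nonneg p -> (forall j, (j <= 2)%nat -> p j = candidate l j) ->
  (forall j, (3 <= j)%nat -> quad band p j <= symbol j * p j) ->
  quad band (candidate l) k - 1764 / 10 ^ 9 <= quad band p k.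
Proof.
  intros Hk Hp Hp2 Hp3.
  assert (H := lower_coef band weight majorant (991 / 1000) 72).
  eapply Rle_trans; [|apply (H weight_low weight_nonneg omega_weight_ge1 majorant_nonneg
    majorant_0 majorant_high weight_column ltac:(lra) ltac:(lra) (candidate l)
    (58 / 10 ^ 8) radius (22 / 1000))];
    auto using candidate_nonneg, candidate_0, candidate_high, candidate_le_majorant,
      candidate_residual, radius_closed, majorant_row; unfold radius; lra.
Qed.
End Candidate.

(** * Sign conditions at the corners and existence of the amplitudes *)

Lemma corner_range : range_check corner_data = true.
Proof. vm_compute. reflexivity. Qed.

Lemma left_range : range_check left_data = true.
Proof. vm_compute. reflexivity. Qed.

Lemma right_range : range_check right_data = true.
Proof. vm_compute. reflexivity. Qed.

Lemma corner_residual : (residual_total corner_data <= residual_max)%Z.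
Proof. apply Z.leb_le. vm_compute. reflexivity. Qed.

Lemma left_residual : (residual_total left_data <= residual_max)%Z.
Proof. apply Z.leb_le. vm_compute. reflexivity. Qed.

Lemma right_residual : (residual_total right_data <= residual_max)%Z.
Proof. apply Z.leb_le. vm_compute. reflexivity. Qed.

Lemma candidate_le1 (l : list Z) (k : nat) : range_check l = true -> candidate l k <= 1.
Proof.
  intros H. eapply Rle_trans; [now apply candidate_le_majorant|apply majorant_le1].
Qed.

(** The weights eventually grow like [ratio ^ k], so an error bounded in norm decays like
    [/ ratio ^ k]: this is the source of the exponential decay of the amplitudes. The factor
    [ratio ^ last_weight] absorbs the indices before the geometric growth sets in. *)
Lemma radius_omega (k : nat) : (3 <= k)%nat ->
  radius / omega weight k <= radius * ratio ^ last_weight * / ratio ^ k.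
Proof.
  intros Hk. assert (W := weight_lower k Hk).
  assert (S3 : 776 / 1000 <= symbol 3) by (unfold symbol, speed; simpl; lra).
  assert (S4 := symbol_incr 3 k ltac:(lia)).
  assert (P1 := ratio_pow_ge1 k). assert (P2 := ratio_pow_ge1 last_weight).
  assert (P3 := ratio_pow_ge1 (k - last_weight)).
  assert (O : 853 / 1000 * ratio ^ (k - last_weight) <= omega weight k).
  { unfold omega.
    apply Rle_trans with (776 / 1000 * (11 / 10 * ratio ^ (k - last_weight))); [lra|].
    apply Rmult_le_compat; lra. }
  assert (Q : ratio ^ k <= ratio ^ last_weight * ratio ^ (k - last_weight)).
  { rewrite <- pow_add. apply Rle_pow; [unfold ratio; lra|lia]. }
  assert (O1 := omega_weight_ge1 k Hk).
  assert (E : ratio ^ k <= ratio ^ last_weight * omega weight k).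
  { destruct (le_lt_dec k last_weight).
    - apply Rle_trans with (ratio ^ last_weight * 1).
      + rewrite Rmult_1_r. apply Rle_pow; [unfold ratio; lra|lia].
      + apply Rmult_le_compat_l; lra.
    - assert (A : ratio ^ (k - last_weight) <= omega weight k).
      { unfold omega. rewrite weight_high by lia.
        assert (L := omega_weight_ge1 last_weight ltac:(unfold last_weight; lia)).
        unfold omega in L.
        assert (S5 := symbol_incr last_weight k ltac:(unfold last_weight in *; lia)).
        assert (W5 := weight_nonneg last_weight).
        assert (1 <= symbol k * weight last_weight) by nra.
        rewrite <- Rmult_assoc. nra. }
      eapply Rle_trans; [exact Q|]. apply Rmult_le_compat_l; lra. }
  apply Rmult_le_reg_r with (omega weight k * ratio ^ k); [nra|].
  replace (radius / omega weight k * (omega weight k * ratio ^ k))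
    with (radius * ratio ^ k) by (field; lra).
  replace (radius * ratio ^ last_weight * / ratio ^ k * (omega weight k * ratio ^ k))
    with (radius * (ratio ^ last_weight * omega weight k)) by (field; lra).
  apply Rmult_le_compat_l; [unfold radius|]; lra.
Qed.

Theorem amplitudes_exist : exists p : nat -> R,
  nonneg p /\ p 0%nat = 0 /\ 0 < p 1%nat /\
  (exists C rho, 0 < rho < 1 /\ forall k, p k <= C * rho ^ k) /\
  forall k, (1 <= k)%nat -> is_lim_seq (fun K => quad K p k) (symbol k * p k).
Proof.
  set (aM := candidate corner_data 1). set (bM := candidate corner_data 2).
  set (a1 := candidate left_data 1). set (b1 := candidate right_data 2).
  assert (EaM : aM = 5477750409 / 10 ^ 10) by reflexivity.
  assert (EbM : bM = 1751575807 / 10 ^ 10) by reflexivity.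
  assert (Ea1 : a1 = 5476983577 / 10 ^ 10) by reflexivity.
  assert (Eb1 : b1 = 1751232532 / 10 ^ 10) by reflexivity.
  assert (El : candidate left_data 2 = bM) by reflexivity.
  assert (Er : candidate right_data 1 = aM) by reflexivity.
  assert (HaM : 0 < aM) by lra. assert (HbM : 0 < bM) by lra.
  set (q1 := quad band (candidate corner_data) 1).
  set (q2 := quad band (candidate corner_data) 2).
  assert (Hq1 : 0 <= q1) by apply quad_nonneg, candidate_nonneg, corner_range.
  assert (Hq2 : 0 <= q2) by apply quad_nonneg, candidate_nonneg, corner_range.
  (* One constant for three bounds: 2 for the iterates, [q1] or [q2] plus a small error for the
     coefficients k = 1, 2, and at most 12/10 * 2 for k >= 3, read off from the next iterate. *)
  set (B := 3 + q1 + q2).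
  assert (Bapprox : forall n k, (3 <= k)%nat -> approx aM bM n k
                      <= candidate corner_data k + radius / omega weight k)
    by (intros; now apply candidate_approx; [apply corner_range|apply corner_residual|]).
  assert (Bapprox2 : forall n k, approx aM bM n k <= 2).
  { intros n k. destruct (le_lt_dec k 2).
    - rewrite approx_low by auto. destruct k as [|[|[|k]]]; simpl; lra.
    - eapply Rle_trans; [apply Bapprox; lia|].
      assert (A := candidate_le1 corner_data k corner_range).
      assert (O := omega_weight_ge1 k ltac:(lia)).
      assert (radius / omega weight k <= 1); [|lra].
      apply Rmult_le_reg_r with (omega weight k); [lra|].
      unfold Rdiv. rewrite Rmult_assoc, Rinv_l by lra. unfold radius; lra. }
  assert (BA : forall n k, approx aM bM n k <= B).
  { intros n k. eapply Rle_trans; [apply Bapprox2|]. unfold B; lra. }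
  assert (BC : forall n k, (1 <= k)%nat -> coef aM bM n k <= B).
  { intros n k Hk. destruct (le_lt_dec k 2).
    - eapply Rle_trans; [apply (candidate_coef_upper corner_data corner_range corner_residual);
        auto|].
      assert (k = 1 \/ k = 2)%nat as [-> | ->] by lia; fold q1 q2; unfold B; lra.
    - assert (Sk := symbol_pos k Hk).
      assert (A := Bapprox2 (S n) k). rewrite approx_S in A by lia.
      assert (Hs : symbol k <= 12 / 10).
      { unfold symbol, speed. assert (0 < / INR k); [|lra].
        apply Rinv_0_lt_compat, lt_0_INR; lia. }
      apply Rle_trans with (symbol k * 2); [|unfold B; lra].
      replace (coef aM bM n k) with (symbol k * (coef aM bM n k / symbol k)) by (field; lra).
      apply Rmult_le_compat_l; lra. }
  (* Truncating the convolution at [band] turns the exact equations for k >= 3 into the inequalities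
     of a supersolution, to which the lower bounds apply. *)
  assert (Super : forall a b, 0 <= a <= aM /\ 0 <= b <= bM ->
    forall j, (3 <= j)%nat -> quad band (amp a b) j <= symbol j * amp a b j).
  { intros a b Hab j Hj. rewrite (amp_coef aM bM B BA BC) by auto.
    apply (quad_amp_le aM bM B BA BC); auto; lia. }
  assert (Hi : forall a b, a1 <= a <= aM -> b1 <= b <= bM ->
    0 <= a <= aM /\ 0 <= b <= bM) by (intros; lra).
  assert (Lower : forall l, range_check l = true -> (residual_total l <= residual_max)%Z ->
    a1 <= candidate l 1 <= aM -> b1 <= candidate l 2 <= bM -> forall k, (1 <= k <= 2)%nat ->
    quad band (candidate l) k - 1764 / 10 ^ 9
    <= coef_lim (candidate l 1) (candidate l 2) k).
  { intros l Hl Hr H1 H2 k Hk.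
    assert (Box := Hi _ _ H1 H2).
    eapply Rle_trans; [|apply (quad_amp_le aM bM B BA BC _ _ band); [lia|exact Box]].
    apply candidate_coef_lower; auto.
    - intros j. now apply (amp_nonneg aM bM B BA).
    - intros j Hj. rewrite amp_low by auto.
      destruct j as [|[|[|j]]]; simpl; try lia; auto. symmetry; now apply candidate_0. }
  assert (Upper : forall l, range_check l = true -> (residual_total l <= residual_max)%Z ->
    a1 <= candidate l 1 <= aM -> b1 <= candidate l 2 <= bM -> forall k, (1 <= k <= 2)%nat ->
    coef_lim (candidate l 1) (candidate l 2) k <= quad band (candidate l) k + 1764 / 10 ^ 9).
  { intros l Hl Hr H1 H2 k Hk. assert (Box := Hi _ _ H1 H2).
    apply (is_lim_seq_le (fun n => coef (candidate l 1) (candidate l 2) n k)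
      (fun _ => quad band (candidate l) k + 1764 / 10 ^ 9)
      (coef_lim (candidate l 1) (candidate l 2) k)
      (quad band (candidate l) k + 1764 / 10 ^ 9)).
    - intros n. now apply candidate_coef_upper.
    - apply (coef_lim_lim aM bM B BC); auto; lia.
    - apply is_lim_seq_const. }
  assert (S1 : symbol 1 = speed - 1) by (unfold symbol; simpl; lra).
  assert (S2 : symbol 2 = speed - / 2) by (unfold symbol; simpl; lra).
  assert (L1 := Lower left_data left_range left_residual ltac:(fold a1; lra)
                  ltac:(rewrite El; lra) 1%nat ltac:(lia)).
  assert (L2 := Upper left_data left_range left_residual ltac:(fold a1; lra)
                  ltac:(rewrite El; lra) 2%nat ltac:(lia)).
  assert (R1 := Upper right_data right_range right_residual ltac:(rewrite Er; lra)
                  ltac:(fold b1; lra) 1%nat ltac:(lia)).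
  assert (R2 := Lower right_data right_range right_residual ltac:(rewrite Er; lra)
                  ltac:(fold b1; lra) 2%nat ltac:(lia)).
  rewrite candidate_quad in L1, L2, R1, R2
    by (try apply left_range; try apply right_range; unfold band; lia).
  fold a1 in L1, L2. fold b1 in R1, R2. rewrite El in L1, L2. rewrite Er in R1, R2.
  (* With the four values explicit, each corner inequality holds by linear arithmetic: its margin
     covers the error [1764 / 10 ^ 9]. *)
  assert (Z1 : zbilin left_data left_data 1 = 24021935288225961718%Z)
    by (vm_compute; reflexivity).
  assert (Z2 : zbilin left_data left_data 2 = 42702578905390041237%Z)
    by (vm_compute; reflexivity).
  assert (Z3 : zbilin right_data right_data 1 = 24022850432397472622%Z)
    by (vm_compute; reflexivity).
  assert (Z4 : zbilin right_data right_data 2 = 42716077824999043875%Z)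
    by (vm_compute; reflexivity).
  rewrite Z1 in L1. rewrite Z2 in L2. rewrite Z3 in R1. rewrite Z4 in R2.
  assert (HA1 : symbol 1 * a1 <= coef_lim a1 bM 1)
    by (eapply Rle_trans; [|exact L1]; rewrite S1, Ea1; unfold speed; lra).
  assert (HA2 : coef_lim a1 bM 2 <= symbol 2 * b1)
    by (eapply Rle_trans; [exact L2|]; rewrite S2, Eb1; unfold speed; lra).
  assert (HB1 : coef_lim aM b1 1 <= symbol 1 * aM)
    by (eapply Rle_trans; [exact R1|]; rewrite S1, EaM; unfold speed; lra).
  assert (HB2 : symbol 2 * bM <= coef_lim aM b1 2)
    by (eapply Rle_trans; [|exact R2]; rewrite S2, EbM; unfold speed; lra).
  destruct (solve_two_equations aM bM B HaM HbM BA BC a1 b1 ltac:(lra) ltac:(lra)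
              HA1 HA2 HB1 HB2) as (a & b & Ha & Hb & E1 & E2).
  assert (Box := Hi a b Ha Hb).
  exists (amp a b). split; [|split; [|split; [|split]]].
  - intros k. now apply (amp_nonneg aM bM B BA).
  - now rewrite amp_low by lia.
  - rewrite amp_low by lia. simpl. lra.
  (* The first term covers the candidate, which is at most 1 and vanishes from [band] on, the second
     the error [radius / omega weight k]. *)
  - set (C := ratio ^ band + ratio ^ last_weight).
    assert (P1 := ratio_pow_ge1 band). assert (P2 := ratio_pow_ge1 last_weight).
    exists C, (/ ratio). split.
    { split; [|rewrite <- Rinv_1]; [apply Rinv_0_lt_compat|apply Rinv_1_lt_contravar];
        unfold ratio; lra. }
    intros k. assert (P3 := ratio_pow_ge1 k).
    rewrite pow_inv.
    assert (T : forall x, x <= 1 -> ((band <= k)%nat -> x <= 0) ->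
      x <= ratio ^ band * / ratio ^ k).
    { intros x Hx Hx0. destruct (le_lt_dec band k).
      - apply Rle_trans with 0; auto. apply Rmult_le_pos; [lra|].
        apply Rlt_le, Rinv_0_lt_compat; lra.
      - eapply Rle_trans; [exact Hx|]. apply Rmult_le_reg_r with (ratio ^ k); [lra|].
        rewrite Rmult_assoc, Rinv_l, Rmult_1_r, Rmult_1_l by lra.
        apply Rle_pow; [unfold ratio; lra|lia]. }
    assert (Hinv : 0 < / ratio ^ k) by (apply Rinv_0_lt_compat; lra).
    unfold C. rewrite Rmult_plus_distr_r. destruct (le_lt_dec k 2).
    + assert (amp a b k <= ratio ^ band * / ratio ^ k).
      { rewrite amp_low by auto. apply T.
        - destruct k as [|[|[|k]]]; simpl; lra.
        - unfold band; lia. }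
      assert (0 <= ratio ^ last_weight * / ratio ^ k) by (apply Rmult_le_pos; lra). lra.
    + apply (is_lim_seq_le (fun n => approx a b n k)
        (fun _ => ratio ^ band * / ratio ^ k + ratio ^ last_weight * / ratio ^ k)
        (amp a b k) (ratio ^ band * / ratio ^ k + ratio ^ last_weight * / ratio ^ k)).
      * intros n. apply Rle_trans with (approx aM bM n k); [apply approx_le; lra|].
        eapply Rle_trans; [apply Bapprox; lia|]. apply Rplus_le_compat.
        -- apply T; [apply candidate_le1, corner_range|].
           intros; rewrite candidate_high by (auto using corner_range); lra.
        -- eapply Rle_trans; [apply radius_omega; lia|].
           apply Rmult_le_compat_r; [lra|]. unfold radius; lra.
      * now apply (amp_lim aM bM B BA).
      * apply is_lim_seq_const.
  - intros k Hk. replace (symbol k * amp a b k) with (coef_lim a b k).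
    + now apply (quad_amp_full aM bM B BA BC).
    + destruct (le_lt_dec k 2).
      * rewrite amp_low by auto.
        assert (k = 1 \/ k = 2)%nat as [-> | ->] by lia; simpl; auto.
      * symmetry. apply (amp_coef aM bM B BA BC); auto.
Qed.

(** * Trigonometric series *)

Definition fast (a : nat -> R) : Prop :=
  exists C rho, 0 < rho < 1 /\ forall k, Rabs (a k) <= C * rho ^ k.

Lemma fast_summable (a : nat -> R) : fast a -> ex_series (fun k => Rabs (a k)).
Proof.
  intros (C & rho & Hrho & H).
  apply (ex_series_le (fun k => Rabs (a k)) (fun k => C * rho ^ k)).
  - intros n. change (Rabs (Rabs (a n)) <= C * rho ^ n). now rewrite Rabs_Rabsolu.
  - apply (ex_series_scal_l C (fun k => rho ^ k)). apply ex_series_geom.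
    rewrite Rabs_pos_eq; lra.
Qed.

Lemma fast_le (a b : nat -> R) :
  (forall k, Rabs (b k) <= Rabs (a k)) -> fast a -> fast b.
Proof.
  intros Hab (C & rho & Hrho & H). exists C, rho. split; auto.
  intros k. eapply Rle_trans; [apply Hab|apply H].
Qed.

(** A rate [sigma] strictly between [rho] and 1 absorbs the linear factor: with
    [sigma / rho = 1 + h], Bernoulli's inequality [poly] bounds [1 + INR k * h] by [(1 + h) ^ k]. *)
Lemma fast_mult_linear (a b : nat -> R) (A : R) :
  (forall k, Rabs (b k) <= A * (1 + INR k)) -> fast a -> fast (fun k => a k * b k).
Proof.
  intros Hb (C & rho & Hrho & H).
  set (sigma := (1 + rho) / 2). set (h := sigma / rho - 1).
  assert (Hs : rho < sigma < 1) by (unfold sigma; lra).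
  assert (Hh : 0 < h).
  { unfold h. apply Rlt_0_minus. apply Rmult_lt_reg_r with rho; [lra|].
    unfold Rdiv. rewrite Rmult_assoc, Rinv_l; lra. }
  assert (HA : 0 <= A).
  { assert (T := Hb 0%nat). assert (T' := Rabs_pos (b 0%nat)). simpl in T. lra. }
  assert (HC : 0 <= C).
  { assert (T := H 0%nat). assert (T' := Rabs_pos (a 0%nat)). simpl in T. lra. }
  exists (C * A * (1 + / h)), sigma. split; [lra|]. intros k. rewrite Rabs_mult.
  assert (P : 1 + INR k * h <= (1 + h) ^ k) by now apply poly.
  assert (Q : (1 + INR k) * rho ^ k <= (1 + / h) * sigma ^ k).
  { replace sigma with ((1 + h) * rho) by (unfold h; field; lra).
    rewrite Rpow_mult_distr, <- Rmult_assoc.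
    apply Rmult_le_compat_r; [apply pow_le; lra|].
    assert (0 <= INR k) by apply pos_INR.
    assert (/ h * (1 + INR k * h) <= / h * (1 + h) ^ k).
    { apply Rmult_le_compat_l; auto. apply Rlt_le, Rinv_0_lt_compat; auto. }
    replace (/ h * (1 + INR k * h)) with (/ h + INR k) in H1 by (field; lra).
    assert (0 < / h) by now apply Rinv_0_lt_compat. nra. }
  assert (0 <= rho ^ k) by (apply pow_le; lra).
  apply Rle_trans with (C * rho ^ k * (A * (1 + INR k))).
  - apply Rmult_le_compat; auto using Rabs_pos.
  - replace (C * rho ^ k * (A * (1 + INR k))) with (C * A * ((1 + INR k) * rho ^ k)) by ring.
    rewrite (Rmult_assoc (C * A)). apply Rmult_le_compat_l; auto. now apply Rmult_le_pos.
Qed.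

(** The free phase keeps one family closed under all operations: differentiation adds [PI / 2] to
    it, the Hilbert transform subtracts [PI / 2], and translations shift it. *)
Definition trig (a K phi : nat -> R) (x : R) : R :=
  Series (fun j => a j * cos (K j * x + phi j)).

Lemma cos_bound (t : R) : Rabs (cos t) <= 1.
Proof. apply Rabs_le, COS_bound. Qed.

Lemma summable_mult (a b : nat -> R) :
  ex_series (fun j => Rabs (a j)) -> (forall j, Rabs (b j) <= 1) ->
  ex_series (fun j => a j * b j).
Proof.
  intros Ha Hb. apply ex_series_Rabs.
  apply (ex_series_le (fun j => Rabs (a j * b j)) (fun j => Rabs (a j))); auto.
  intros j. change (Rabs (Rabs (a j * b j)) <= Rabs (a j)).
  rewrite Rabs_Rabsolu, Rabs_mult. assert (A := Rabs_pos (a j)). specialize (Hb j). nra.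
Qed.

Lemma trig_summable (a K phi : nat -> R) (x : R) :
  ex_series (fun j => Rabs (a j)) -> ex_series (fun j => a j * cos (K j * x + phi j)).
Proof. intros Ha. apply summable_mult; auto. intros; apply cos_bound. Qed.

Lemma trig_ext (a a' K K' phi phi' : nat -> R) (x x' : R) :
  (forall j, a j * cos (K j * x + phi j) = a' j * cos (K' j * x' + phi' j)) ->
  trig a K phi x = trig a' K' phi' x'.
Proof. intros H. apply Series_ext. exact H. Qed.

Lemma cos_shift (t : R) : cos (t + PI / 2) = - sin t.
Proof. rewrite cos_plus, cos_PI2, sin_PI2. ring. Qed.

Lemma sin_lipschitz (t d : R) : Rabs (sin (t + d) - sin t) <= Rabs d.
Proof.
  destruct (MVT_gen sin t (t + d) cos) as (c & _ & E).
  - intros x _. apply is_derive_sin.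
  - intros x _. apply continuity_sin.
  - rewrite E. replace (t + d - t) with d by ring. rewrite Rabs_mult.
    assert (A := Rabs_pos d). assert (B := cos_bound c). nra.
Qed.

Lemma is_derive_continuity_pt (f : R -> R) (x l : R) :
  is_derive f x l -> continuity_pt f x.
Proof.
  intros H. apply continuity_pt_filterlim. apply (ex_derive_continuous f). now exists l.
Qed.

Lemma cos_taylor (t d : R) :
  Rabs (cos (t + d) - cos t - d * cos (t + PI / 2)) <= d * d.
Proof.
  rewrite cos_shift.
  set (F := fun s => cos (t + s) + s * sin t).
  assert (HF : forall s, is_derive F s (- (sin (t + s) - sin t))).
  { intros s. unfold F. auto_derive; auto. ring. }
  destruct (MVT_gen F 0 d (fun s => - (sin (t + s) - sin t))) as (c & Hc & E).
  - intros x _. apply HF.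
  - intros x _. apply (is_derive_continuity_pt _ _ _ (HF x)).
  - replace (cos (t + d) - cos t - d * - sin t) with (F d - F 0)
      by (unfold F; rewrite Rplus_0_r; ring).
    rewrite E, Rminus_0_r, Rabs_mult, Rabs_Ropp.
    assert (A := sin_lipschitz t c).
    assert (B : Rabs c <= Rabs d).
    { unfold Rmin, Rmax in Hc. destruct (Rle_dec 0 d).
      - rewrite !Rabs_pos_eq; lra.
      - rewrite !Rabs_left1; lra. }
    assert (D := Rabs_pos d). assert (G := Rabs_pos (sin (t + c) - sin t)).
    replace (d * d) with (Rabs d * Rabs d)
      by (rewrite <- Rabs_mult; apply Rabs_pos_eq; nra).
    nra.
Qed.

(** The termwise second-order remainders sum to at most [h * h * S2], so the difference quotient is
    within [Rabs h * S2] of the differentiated series. *)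
Lemma trig_derive (a K phi : nat -> R) (x : R) :
  ex_series (fun j => Rabs (a j)) -> ex_series (fun j => Rabs (a j * K j)) ->
  ex_series (fun j => Rabs (a j * K j * K j)) ->
  is_derive (trig a K phi) x
    (trig (fun j => a j * K j) K (fun j => phi j + PI / 2) x).
Proof.
  intros H0 H1 H2. apply is_derive_Reals. intros eps Heps.
  set (S2 := Series (fun j => Rabs (a j * K j * K j))).
  assert (HS : 0 <= S2).
  { unfold S2. rewrite <- (Rmult_0_l (Series (fun j => Rabs (a j * K j * K j)))).
    rewrite <- Series_scal_l. apply Series_le; auto.
    intros n. rewrite Rmult_0_l. split; [lra|apply Rabs_pos]. }
  assert (Hd : 0 < eps / (S2 + 1)) by (apply Rdiv_lt_0_compat; lra).
  exists (mkposreal _ Hd). intros h Hh0 Hh. simpl in Hh.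
  set (D := trig (fun j => a j * K j) K (fun j => phi j + PI / 2) x).
  assert (Main : Rabs (trig a K phi (x + h) - trig a K phi x - h * D) <= h * h * S2).
  { unfold D, trig. rewrite <- Series_scal_l.
    assert (E0 := fun y => trig_summable a K phi y H0).
    assert (E1 : ex_series (fun j => h * (a j * K j * cos (K j * x + (phi j + PI / 2))))).
    { apply (ex_series_scal_l h
        (fun j => a j * K j * cos (K j * x + (phi j + PI / 2)))).
      apply (trig_summable (fun j => a j * K j) K (fun j => phi j + PI / 2) x H1). }
    rewrite <- Series_minus, <- Series_minus; auto.
    2: apply (ex_series_minus (fun j => a j * cos (K j * (x + h) + phi j))
                              (fun j => a j * cos (K j * x + phi j))); auto.
    set (t := fun j => _ - _ - _).
    assert (Ht : forall j, 0 <= Rabs (t j) <= h * h * Rabs (a j * K j * K j)).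
    { intros j. split; [apply Rabs_pos|]. unfold t.
      replace (a j * cos (K j * (x + h) + phi j) - a j * cos (K j * x + phi j) -
        h * (a j * K j * cos (K j * x + (phi j + PI / 2))))
        with (a j * (cos (K j * x + phi j + K j * h) - cos (K j * x + phi j)
                     - K j * h * cos (K j * x + phi j + PI / 2))).
      2:{ rewrite Rmult_plus_distr_l, <- Rplus_assoc.
          replace (K j * x + K j * h + phi j) with (K j * x + phi j + K j * h) by ring.
          ring. }
      rewrite Rabs_mult. assert (T := cos_taylor (K j * x + phi j) (K j * h)).
      replace (h * h * Rabs (a j * K j * K j)) with (Rabs (a j) * (K j * h * (K j * h))).
      - apply Rmult_le_compat_l; auto using Rabs_pos.
      - replace (a j * K j * K j) with (a j * (K j * K j)) by ring.
        rewrite Rabs_mult, (Rabs_pos_eq (K j * K j)) by nra. ring. }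
    assert (Hex : ex_series (fun j => h * h * Rabs (a j * K j * K j)))
      by apply (ex_series_scal_l (h * h) _ H2).
    assert (Hex2 : ex_series (fun j => Rabs (t j))).
    { apply (ex_series_le (fun j => Rabs (t j)) (fun j => h * h * Rabs (a j * K j * K j)));
        auto. intros j. change (Rabs (Rabs (t j)) <= h * h * Rabs (a j * K j * K j)).
      rewrite Rabs_Rabsolu. apply Ht. }
    eapply Rle_trans; [now apply Series_Rabs|].
    unfold S2. rewrite <- Series_scal_l. now apply Series_le. }
  replace ((trig a K phi (x + h) - trig a K phi x) / h - D)
    with ((trig a K phi (x + h) - trig a K phi x - h * D) / h) by (field; auto).
  assert (Hp : 0 < Rabs h) by now apply Rabs_pos_lt.
  unfold Rdiv. rewrite Rabs_mult, Rabs_inv.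
  apply Rle_lt_trans with (Rabs h * S2).
  - apply Rmult_le_reg_r with (Rabs h); auto.
    rewrite Rmult_assoc, Rinv_l, Rmult_1_r by lra. eapply Rle_trans; [exact Main|].
    replace (h * h) with (Rabs h * Rabs h)
      by (rewrite <- Rabs_mult; apply Rabs_pos_eq; nra). right; ring.
  - apply Rle_lt_trans with (Rabs h * (S2 + 1)); [nra|].
    replace eps with (eps / (S2 + 1) * (S2 + 1)) by (field; lra).
    apply Rmult_lt_compat_r; lra.
Qed.

Definition grows_linearly (K : nat -> R) : Prop :=
  exists A, forall j, Rabs (K j) <= A * (1 + INR j).

Lemma fast_mult (a K : nat -> R) :
  fast a -> grows_linearly K -> fast (fun j => a j * K j).
Proof. intros Ha [A HA]. now apply fast_mult_linear with A. Qed.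

Lemma trig_derive_fast (a K phi : nat -> R) (x : R) :
  fast a -> grows_linearly K ->
  is_derive (trig a K phi) x
    (trig (fun j => a j * K j) K (fun j => phi j + PI / 2) x).
Proof.
  intros Ha HK. apply trig_derive; apply fast_summable; auto.
  - now apply fast_mult.
  - apply (fast_mult (fun j => a j * K j)); auto. now apply fast_mult.
Qed.

Lemma trig_derive_n (a K phi : nat -> R) (n : nat) :
  fast a -> grows_linearly K -> exists b psi, fast b /\
    (forall x, Derive_n (trig a K phi) n x = trig b K psi x) /\
    forall x, ex_derive_n (trig a K phi) n x.
Proof.
  intros Ha HK. induction n as [|n (b & psi & Hb & E & _)].
  - exists a, phi. split; [auto|]. split; intros; simpl; auto.
  - exists (fun j => b j * K j), (fun j => psi j + PI / 2).
    split; [now apply fast_mult|].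
    assert (D : forall x, is_derive (Derive_n (trig a K phi) n) x
                  (trig (fun j => b j * K j) K (fun j => psi j + PI / 2) x)).
    { intros x. apply is_derive_ext with (trig b K psi); [intros; now rewrite E|].
      now apply trig_derive_fast. }
    split; intros x; simpl.
    + now apply is_derive_unique.
    + eexists; apply D.
Qed.

Lemma cos_multiple (m : nat) (x phi : R) :
  cos (INR m * (x + 2 * PI) + phi) = cos (INR m * x + phi).
Proof.
  replace (INR m * (x + 2 * PI) + phi) with (INR m * x + phi + 2 * INR m * PI) by ring.
  apply cos_period.
Qed.

Lemma trig_on_torus (a : nat -> R) (m : nat -> nat) (phi : nat -> R) :
  on_torus (trig a (fun j => INR (m j)) phi).
Proof. intros x. apply trig_ext. intros j. now rewrite cos_multiple. Qed.

Lemma trig_continuous (a K phi : nat -> R) (x : R) :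
  fast a -> grows_linearly K -> continuous (trig a K phi) x.
Proof.
  intros Ha HK. apply (ex_derive_continuous (trig a K phi)).
  eexists. now apply trig_derive_fast.
Qed.

(** Frequencies of at least 1 can be divided out, which gives a primitive of the same form; as they
    are integers, the primitive takes equal values at [- PI] and [PI]. *)
Lemma trig_RInt (a : nat -> R) (m : nat -> nat) (phi : nat -> R) :
  fast a -> grows_linearly (fun j => INR (m j)) -> (forall j, (1 <= m j)%nat) ->
  is_RInt (trig a (fun j => INR (m j)) phi) (- PI) PI 0.
Proof.
  intros Ha HK Hm. set (K := fun j => INR (m j)).
  assert (HK1 : forall j, 1 <= K j) by (intros j; apply (le_INR 1), Hm).
  set (F := trig (fun j => a j / K j) K (fun j => phi j - PI / 2)).
  assert (Hfast : fast (fun j => a j / K j)).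
  { apply (fast_le a); auto. intros j. unfold Rdiv. rewrite Rabs_mult.
    assert (A := Rabs_pos (a j)). specialize (HK1 j).
    assert (Rabs (/ K j) <= 1).
    { rewrite Rabs_pos_eq by (apply Rlt_le, Rinv_0_lt_compat; lra).
      rewrite <- Rinv_1. apply Rinv_le_contravar; lra. }
    nra. }
  assert (E : F PI = F (- PI)).
  { replace PI with (- PI + 2 * PI) at 1 by ring. apply trig_on_torus. }
  replace 0 with (minus (F PI) (F (- PI))) by (rewrite E; now apply Rminus_diag_eq).
  apply (is_RInt_derive F).
  - intros x _.
    replace (trig a K phi x) with (trig (fun j => a j / K j * K j) K
      (fun j => phi j - PI / 2 + PI / 2) x).
    + now apply trig_derive_fast.
    + apply trig_ext. intros j. specialize (HK1 j). f_equal; [field; lra|]. f_equal; ring.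
  - intros x _. now apply trig_continuous.
Qed.

Lemma continuous_cos_mult (c x : R) : continuous (fun y => cos (c * y)) x.
Proof.
  apply (ex_derive_continuous (fun y => cos (c * y))). auto_derive. auto.
Qed.

Lemma continuous_sin_mult (c x : R) : continuous (fun y => sin (c * y)) x.
Proof.
  apply (ex_derive_continuous (fun y => sin (c * y))). auto_derive. auto.
Qed.

Lemma ex_RInt_cos (f : R -> R) (c : R) : (forall x, continuous f x) ->
  ex_RInt (fun x => f x * cos (c * x)) (- PI) PI.
Proof.
  intros Hf. apply (ex_RInt_continuous (fun x => f x * cos (c * x))). intros x _.
  apply (continuous_mult f (fun y => cos (c * y))); auto using continuous_cos_mult.
Qed.

Lemma ex_RInt_sin (f : R -> R) (c : R) : (forall x, continuous f x) ->
  ex_RInt (fun x => f x * sin (c * x)) (- PI) PI.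
Proof.
  intros Hf. apply (ex_RInt_continuous (fun x => f x * sin (c * x))). intros x _.
  apply (continuous_mult f (fun y => sin (c * y))); auto using continuous_sin_mult.
Qed.

Definition cos_int (f : R -> R) (c : R) : R := RInt (fun x => f x * cos (c * x)) (- PI) PI.
Definition sin_int (f : R -> R) (c : R) : R := RInt (fun x => f x * sin (c * x)) (- PI) PI.

Lemma fourier_coeff_parts (f : R -> R) (k : Z) : (forall x, continuous f x) ->
  fourier_coeff f k
  = (/ (2 * PI) * cos_int f (IZR k), - (/ (2 * PI) * sin_int f (IZR k))).
Proof.
  intros Hf. unfold fourier_coeff.
  assert (H : is_RInt (V := C_R_NormedModule)
    (fun x => RtoC (f x) * cexp_i (- (IZR k * x)))%C (- PI) PI
    (cos_int f (IZR k), - sin_int f (IZR k))).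
  { apply (is_RInt_fct_extend_pair (U := R_NormedModule) (V := R_NormedModule)); simpl.
    - apply is_RInt_ext with (fun x => f x * cos (IZR k * x)).
      + intros x _.
        change (f x * cos (IZR k * x)
                = f x * cos (- (IZR k * x)) - 0 * sin (- (IZR k * x))).
        rewrite cos_neg. ring.
      + now apply (RInt_correct (fun x => f x * cos (IZR k * x))), ex_RInt_cos.
    - apply is_RInt_ext with (fun x => opp (f x * sin (IZR k * x))).
      + intros x _.
        change (- (f x * sin (IZR k * x))
                = f x * sin (- (IZR k * x)) + 0 * cos (- (IZR k * x))).
        rewrite sin_neg. ring.
      + apply (is_RInt_opp (fun x => f x * sin (IZR k * x))).
        now apply (RInt_correct (fun x => f x * sin (IZR k * x))), ex_RInt_sin. }
  apply (is_RInt_unique (V := C_R_CompleteNormedModule)) in H. rewrite H.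
  apply injective_projections; simpl; ring.
Qed.

Lemma sin_as_cos (t : R) : sin t = cos (t - PI / 2).
Proof. rewrite cos_minus, cos_PI2, sin_PI2. ring. Qed.

(** * Hilbert transform of a trigonometric series *)

Section Hilbert.
Variables (a : nat -> R) (m : nat -> nat) (phi : nat -> R).
Hypothesis a_fast : fast a.
Hypothesis m_linear : grows_linearly (fun j => INR (m j)).
Hypothesis m_pos : forall j, (1 <= m j)%nat.
Let f := trig a (fun j => INR (m j)) phi.
Let g := trig a (fun j => INR (m j)) (fun j => phi j - PI / 2).

Lemma shifted_frequency (N : nat) (psi : nat -> R) :
  is_RInt (trig a (fun j => INR (m j + N)) psi) (- PI) PI 0.
Proof.
  apply trig_RInt; auto.
  - destruct m_linear as [A HA]. exists (A + INR N). intros j.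
    rewrite plus_INR. eapply Rle_trans; [apply Rabs_triang|].
    rewrite (Rabs_pos_eq (INR N)) by apply pos_INR.
    assert (P := pos_INR N). assert (Q := pos_INR j). specialize (HA j). nra.
  - intros j. specialize (m_pos j). lia.
Qed.

Lemma trig_term_summable (psi : nat -> R) (x : R) :
  ex_series (fun j => a j * cos (INR (m j) * x + psi j)).
Proof. apply (trig_summable a (fun j => INR (m j))). now apply fast_summable. Qed.

Lemma combine_terms (psi psi' psi'' : nat -> R) (N : nat) (s s' x : R) :
  (forall j, cos (INR (m j) * x + psi j) * s + cos (INR (m j) * x + psi' j) * s'
             = cos (INR (m j + N) * x + psi'' j)) ->
  trig a (fun j => INR (m j)) psi x * s + trig a (fun j => INR (m j)) psi' x * s'
  = trig a (fun j => INR (m j + N)) psi'' x.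
Proof.
  intros H. unfold trig. rewrite !(Rmult_comm (Series _)), <- !Series_scal_l, <- Series_plus.
  - apply Series_ext. intros j. rewrite <- H. ring.
  - apply (ex_series_scal_l s (fun j => a j * cos (INR (m j) * x + psi j))).
    apply trig_term_summable.
  - apply (ex_series_scal_l s' (fun j => a j * cos (INR (m j) * x + psi' j))).
    apply trig_term_summable.
Qed.

Lemma hilbert_cont_f (x : R) : continuous f x.
Proof. now apply trig_continuous. Qed.

Lemma hilbert_cont_g (x : R) : continuous g x.
Proof. now apply trig_continuous. Qed.

(** The function f + i g is the sum of a_j e^{i (m_j x + phi_j)}, with positive frequencies only, so
    its product with e^{i N x} has mean zero. This is the imaginary part; [hilbert_sin_relation] is
    the real part with the sign reversed. No single Fourier coefficient has to be computed. *)
Lemma hilbert_cos_relation (N : nat) : cos_int g (INR N) + sin_int f (INR N) = 0.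
Proof.
  unfold cos_int, sin_int.
  rewrite <- (RInt_plus (V := R_CompleteNormedModule) (fun x => g x * cos (INR N * x))
    (fun x => f x * sin (INR N * x))).
  - apply is_RInt_unique.
    apply is_RInt_ext with (trig a (fun j => INR (m j + N)) (fun j => phi j - PI / 2)).
    + intros x _. symmetry. apply combine_terms. intros j.
      replace (INR (m j) * x + (phi j - PI / 2)) with (INR (m j) * x + phi j - PI / 2) by ring.
      replace (INR (m j + N) * x + (phi j - PI / 2))
        with (INR (m j) * x + phi j + INR N * x - PI / 2) by (rewrite plus_INR; ring).
      rewrite <- !sin_as_cos, (sin_plus (_ + _)). ring.
    + apply shifted_frequency.
  - apply ex_RInt_cos, hilbert_cont_g.
  - apply ex_RInt_sin, hilbert_cont_f.
Qed.

Lemma hilbert_sin_relation (N : nat) : sin_int g (INR N) - cos_int f (INR N) = 0.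
Proof.
  unfold cos_int, sin_int.
  rewrite <- (RInt_minus (V := R_CompleteNormedModule) (fun x => g x * sin (INR N * x))
    (fun x => f x * cos (INR N * x))).
  - apply is_RInt_unique.
    apply is_RInt_ext with (trig a (fun j => INR (m j + N)) (fun j => phi j + PI)).
    + intros x _. unfold minus, plus, opp; simpl. symmetry.
      replace (- (f x * cos (INR N * x))) with (f x * - cos (INR N * x)) by ring.
      apply combine_terms. intros j.
      replace (INR (m j) * x + (phi j - PI / 2)) with (INR (m j) * x + phi j - PI / 2) by ring.
      replace (INR (m j + N) * x + (phi j + PI))
        with (INR (m j) * x + phi j + INR N * x + PI) by (rewrite plus_INR; ring).
      rewrite <- sin_as_cos, neg_cos, (cos_plus (_ + _)). ring.
    + apply shifted_frequency.
  - apply ex_RInt_sin, hilbert_cont_g.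
  - apply ex_RInt_cos, hilbert_cont_f.
Qed.

Lemma trig_hilbert : is_hilbert f g.
Proof.
  split; [|split].
  - apply trig_on_torus.
  - apply hilbert_cont_g.
  - intros k. rewrite !fourier_coeff_parts by (apply hilbert_cont_f || apply hilbert_cont_g).
    assert (C0 : forall h c, cos_int h (- c) = cos_int h c).
    { intros h c. apply RInt_ext. intros x _.
      replace (- c * x) with (- (c * x)) by ring. now rewrite cos_neg. }
    assert (S0 : forall h c, (forall x, continuous h x) -> sin_int h (- c) = - sin_int h c).
    { intros h c Hh. unfold sin_int.
      rewrite <- (RInt_opp (V := R_CompleteNormedModule)) by now apply ex_RInt_sin.
      apply RInt_ext. intros x _. unfold opp; simpl.
      replace (- c * x) with (- (c * x)) by ring. rewrite sin_neg. ring. }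
    (* For [k > 0] the two relations are the real and imaginary parts of the claim; parity of cosine
       and sine covers [k < 0], and for [k = 0] the first relation says that [g] has mean zero. *)
    assert (R1 := hilbert_cos_relation (Z.abs_nat k)).
    assert (R2 := hilbert_sin_relation (Z.abs_nat k)).
    destruct (Z.lt_trichotomy k 0) as [Hk | [Hk | Hk]].
    + assert (E : IZR k = - INR (Z.abs_nat k)).
      { rewrite INR_IZR_INZ, <- opp_IZR. f_equal. lia. }
      rewrite E, !C0, !S0 by (apply hilbert_cont_f || apply hilbert_cont_g).
      rewrite Z.sgn_neg by auto.
      apply injective_projections; simpl; rewrite ?Rmult_0_l.
      * replace (cos_int g (INR (Z.abs_nat k))) with (- sin_int f (INR (Z.abs_nat k))) by lra.
        ring.
      * replace (sin_int g (INR (Z.abs_nat k))) with (cos_int f (INR (Z.abs_nat k))) by lra.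
        ring.
    + subst k. simpl in R1, R2 |- *.
      assert (Z1 : sin_int f 0 = 0).
      { unfold sin_int. rewrite (RInt_ext _ (fun _ => 0)).
        - rewrite RInt_const. apply Rmult_0_r.
        - intros x _. rewrite Rmult_0_l, sin_0. apply Rmult_0_r. }
      assert (Z2 : sin_int g 0 = 0).
      { unfold sin_int. rewrite (RInt_ext _ (fun _ => 0)).
        - rewrite RInt_const. apply Rmult_0_r.
        - intros x _. rewrite Rmult_0_l, sin_0. apply Rmult_0_r. }
      apply injective_projections; simpl.
      * replace (cos_int g 0) with 0 by lra. ring.
      * rewrite Z2. ring.
    + assert (E : IZR k = INR (Z.abs_nat k)) by (rewrite INR_IZR_INZ; f_equal; lia).
      rewrite E, Z.sgn_pos by auto.
      apply injective_projections; simpl.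
      * replace (cos_int g (INR (Z.abs_nat k))) with (- sin_int f (INR (Z.abs_nat k))) by lra.
        ring.
      * replace (sin_int g (INR (Z.abs_nat k))) with (cos_int f (INR (Z.abs_nat k))) by lra.
        ring.
Qed.
End Hilbert.

(** Finitely many rows can be summed in either order, and the rows left out contribute at most a
    tail of [A] times the sum of [B]. *)
Lemma fubini_series (t : nat -> nat -> R) (A B : nat -> R) :
  nonneg A -> nonneg B -> ex_series A -> ex_series B ->
  (forall k m, Rabs (t k m) <= A k * B m) ->
  is_series (fun k => Series (t k)) (Series (fun m => Series (fun k => t k m))).
Proof.
  intros HA HB HAs HBs Ht.
  assert (Hrow : forall k, ex_series (t k)).
  { intros k. apply (ex_series_le (t k) (fun m => A k * B m)); [intros m; apply Ht|].
    apply (ex_series_scal_l (A k) B HBs). }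
  assert (Hcol : forall m, ex_series (fun k => t k m)).
  { intros m. apply (ex_series_le (fun k => t k m) (fun k => A k * B m));
      [intros k; apply Ht|].
    apply (ex_series_scal_r (B m) A HAs). }
  assert (Hpart : forall N, ex_series (fun m => rsum N (fun k => t k m)) /\
     Series (fun m => rsum N (fun k => t k m)) = rsum N (fun k => Series (t k))).
  { induction N as [|N [IH1 IH2]]; simpl.
    - split.
      + apply (ex_series_le (fun _ => 0) (fun m => A 0%nat * B m)).
        * intros m. change (Rabs 0 <= A 0%nat * B m). rewrite Rabs_R0. now apply Rmult_le_pos.
        * apply (ex_series_scal_l (A 0%nat) B HBs).
      + rewrite (Series_ext _ (fun m => 0 * B m)) by (intros; ring).
        rewrite Series_scal_l. ring.
    - split.
      + apply (ex_series_plus (fun m => rsum N (fun k => t k m)) (t N)); auto.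
      + rewrite Series_plus; auto. now rewrite IH2. }
  assert (HL : ex_series (fun m => Series (fun k => t k m))).
  { apply (ex_series_le (fun m => Series (fun k => t k m)) (fun m => Series A * B m)).
    - intros m. change (Rabs (Series (fun k => t k m)) <= Series A * B m).
      assert (Habs : ex_series (fun k => A k * B m)) by apply (ex_series_scal_r (B m) A HAs).
      eapply Rle_trans; [apply Series_Rabs|].
      + apply (ex_series_le (fun k => Rabs (t k m)) (fun k => A k * B m)); auto.
        intros k. change (Rabs (Rabs (t k m)) <= A k * B m). now rewrite Rabs_Rabsolu.
      + rewrite <- Series_scal_r. apply Series_le; auto.
        intros k. split; auto using Rabs_pos.
    - apply (ex_series_scal_l (Series A) B HBs). }
  set (L := Series (fun m => Series (fun k => t k m))).
  assert (Herr : forall N, Rabs (rsum (S N) (fun k => Series (t k)) - L)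
     <= Series (fun k => A (S N + k)%nat) * Series B).
  { intros N. destruct (Hpart (S N)) as [P1 P2]. rewrite <- P2. unfold L.
    rewrite <- Series_minus by auto.
    assert (HAN : ex_series (fun k => A (S N + k)%nat)) by now apply (ex_series_incr_n A).
    assert (Hterm : forall m, Rabs (rsum (S N) (fun k => t k m) - Series (fun k => t k m))
              <= Series (fun k => A (S N + k)%nat) * B m).
    { intros m. rewrite (Series_incr_n (fun k => t k m) (S N)) by (auto; lia).
      replace (rsum (S N) (fun k => t k m)) with (sum_f_R0 (fun k => t k m) (pred (S N))).
      2:{ simpl pred. clear. induction N as [|N IH]; simpl; [ring|]. rewrite IH.
          reflexivity. }
      replace (_ - _) with (- Series (fun k => t (S N + k)%nat m)) by ring.
      rewrite Rabs_Ropp.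
      assert (Hs : ex_series (fun k => A (S N + k)%nat * B m))
        by apply (ex_series_scal_r (B m) _ HAN).
      eapply Rle_trans; [apply Series_Rabs|].
      - apply (ex_series_le (fun k => Rabs (t (S N + k)%nat m))
          (fun k => A (S N + k)%nat * B m)); auto.
        intros k. change (Rabs (Rabs (t (S N + k)%nat m)) <= A (S N + k)%nat * B m).
        now rewrite Rabs_Rabsolu.
      - rewrite <- Series_scal_r. apply Series_le; auto.
        intros k. split; auto using Rabs_pos. }
    assert (Hs : ex_series (fun m => Series (fun k => A (S N + k)%nat) * B m))
      by apply (ex_series_scal_l _ B HBs).
    eapply Rle_trans; [apply Series_Rabs|].
    - apply (ex_series_le (fun m => Rabs (rsum (S N) (fun k => t k m) - Series (fun k => t k m)))
        (fun m => Series (fun k => A (S N + k)%nat) * B m)); auto.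
      intros m. change (Rabs (Rabs (rsum (S N) (fun k => t k m) - Series (fun k => t k m)))
        <= Series (fun k => A (S N + k)%nat) * B m). now rewrite Rabs_Rabsolu.
    - rewrite <- Series_scal_l. apply Series_le; auto.
      intros m. split; auto using Rabs_pos. }
  assert (Htail : is_lim_seq (fun N => Series (fun k => A (S N + k)%nat) * Series B) 0).
  { assert (G : is_lim_seq (sum_n A) (Series A)) by apply (Series_correct A HAs).
    apply is_lim_seq_ext with (fun N => (Series A - sum_n A N) * Series B).
    - intros N. rewrite (Series_incr_n A (S N)) by (auto; lia).
      rewrite sum_n_Reals. simpl pred. ring.
    - replace (Finite 0) with (Finite ((Series A - Series A) * Series B)) by (f_equal; ring).
      apply is_lim_seq_mult'; [|apply is_lim_seq_const].
      apply is_lim_seq_minus'; [apply is_lim_seq_const|exact G]. }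
  assert (Hlim : is_lim_seq (sum_n (fun k => Series (t k))) L).
  { apply is_lim_seq_ext with (fun N => L + (rsum (S N) (fun k => Series (t k)) - L)).
    - intros N. rewrite sum_n_Reals. ring_simplify.
      induction N as [|N IH]; simpl in *; [ring|]. now rewrite <- IH.
    - replace (Finite L) with (Finite (L + 0)) by (f_equal; ring).
      apply is_lim_seq_plus'; [apply is_lim_seq_const|].
      apply is_lim_seq_abs_0.
      apply is_lim_seq_le_le with (fun _ => 0)
        (fun N => Series (fun k => A (S N + k)%nat) * Series B); auto.
      + intros N. split; [apply Rabs_pos|apply Herr].
      + apply is_lim_seq_const. }
  exact Hlim.
Qed.

(** * The wave *)

Lemma sum_n_rsum (f : nat -> R) (N : nat) : sum_n f N = rsum (S N) f.
Proof.
  rewrite sum_n_Reals. induction N as [|N IH]; simpl in *; [ring|]. now rewrite IH.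
Qed.

Lemma Series_split (f : nat -> R) (n : nat) :
  ex_series f -> Series f = rsum n f + Series (fun k => f (n + k)%nat).
Proof.
  intros Hf. destruct n as [|n].
  - simpl. rewrite Rplus_0_l. reflexivity.
  - rewrite (Series_incr_n f (S n)) by (auto; lia).
    rewrite <- sum_n_rsum, sum_n_Reals. reflexivity.
Qed.

Lemma Series_nonneg_term (f : nat -> R) (k : nat) :
  nonneg f -> ex_series f -> f k <= Series f.
Proof.
  intros Hf Hs. rewrite (Series_split f (S k) Hs).
  assert (A := rsum_term (S k) k f Hf ltac:(lia)).
  assert (B : 0 <= Series (fun i => f (S k + i)%nat)).
  { rewrite <- (Rmult_0_l (Series (fun i => f (S k + i)%nat))), <- Series_scal_l.
    apply Series_le; [|now apply (ex_series_incr_n f)].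
    intros n. rewrite Rmult_0_l. split; [lra|apply Hf]. }
  lra.
Qed.

Lemma pow_antitone (s : R) (i j : nat) : 0 <= s <= 1 -> (i <= j)%nat -> s ^ j <= s ^ i.
Proof.
  intros Hs Hij. replace j with (i + (j - i))%nat by lia. rewrite pow_add.
  assert (A : s ^ (j - i) <= 1 ^ (j - i)) by (apply pow_incr; lra).
  rewrite pow1 in A. assert (0 <= s ^ i) by (apply pow_le; lra). nra.
Qed.

Section Wave.
Variable p : nat -> R.
Hypothesis p_nonneg : nonneg p.
Hypothesis p_0 : p 0%nat = 0.
Hypothesis p_1 : 0 < p 1%nat.
Variables C rho : R.
Hypothesis rho_bounds : 0 < rho < 1.
Hypothesis p_decay : forall k, p k <= C * rho ^ k.
Hypothesis p_eq : forall k, (1 <= k)%nat ->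
  is_lim_seq (fun K => quad K p k) (symbol k * p k).

Lemma p_fast : fast p.
Proof.
  exists C, rho. split; auto. intros k. rewrite Rabs_pos_eq; auto.
Qed.

Lemma p_summable : ex_series (fun k => Rabs (p k)).
Proof. apply fast_summable, p_fast. Qed.

Lemma p_ex_series : ex_series p.
Proof. apply ex_series_Rabs, p_summable. Qed.

Definition profile (y : R) : R := Series (fun k => p k * cos (INR k * y)).

Lemma cos_terms_summable (b : nat -> R) :
  ex_series (fun k => p k * cos (b k)).
Proof. apply summable_mult; [apply p_summable|]. intros; apply cos_bound. Qed.

Lemma shifted_p_summable (m : nat) (b : nat -> R) :
  ex_series (fun k => p (m + k)%nat * cos (b k)).
Proof.
  apply summable_mult; [|intros; apply cos_bound].
  apply (ex_series_incr_n (fun k => Rabs (p k))), p_summable.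
Qed.

(** This is 2 cos(m y) cos(j y) = cos((j + m) y) + cos((j - m) y), summed over j. The extra [p m]
    arises at k = 0, where [kernel] counts [p m] twice and the product only once. *)
Lemma row_series (m : nat) (y : R) :
  Series (fun k => kernel p k m * cos (INR k * y))
  = 2 * cos (INR m * y) * profile y + p m.
Proof.
  set (al := fun k => p (k - m + (m - k))%nat * cos (INR k * y)).
  set (be := fun k => p (k + m)%nat * cos (INR k * y)).
  assert (Hbe : ex_series be).
  { apply (ex_series_ext (fun k => p (m + k)%nat * cos (INR k * y))).
    - intros k. unfold be. now rewrite Nat.add_comm.
    - apply (shifted_p_summable m (fun k => INR k * y)). }
  assert (Hal_shift : forall k, al (m + k)%nat = p k * cos (INR (m + k) * y)).
  { intros k. unfold al. do 2 f_equal. lia. }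
  assert (Hal : ex_series al).
  { apply (ex_series_incr_n al m).
    apply (ex_series_ext (fun k => p k * cos (INR (m + k) * y))).
    - intros k. now rewrite Hal_shift.
    - apply cos_terms_summable. }
  rewrite (Series_ext _ (fun k => al k + be k))
    by (intros k; unfold al, be, kernel; ring).
  rewrite Series_plus by auto. rewrite (Series_split al m Hal).
  rewrite (Series_ext (fun k => al (m + k)%nat) (fun k => p k * cos (INR (m + k) * y)))
    by auto.
  set (de := fun j => p j * cos ((INR j - INR m) * y)).
  assert (Hde : ex_series de) by apply cos_terms_summable.
  assert (E1 : 2 * cos (INR m * y) * profile y
     = Series (fun k => p k * cos (INR (m + k) * y)) + Series de).
  { unfold profile. rewrite <- Series_scal_l, <- Series_plus; auto using cos_terms_summable.
    apply Series_ext. intros k. unfold de. rewrite plus_INR.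
    replace ((INR m + INR k) * y) with (INR k * y + INR m * y) by ring.
    replace ((INR k - INR m) * y) with (INR k * y - INR m * y) by ring.
    rewrite cos_plus, cos_minus. ring. }
  rewrite E1, (Series_split de m Hde).
  assert (E2 : Series (fun k => de (m + k)%nat) = Series be).
  { apply Series_ext. intros k. unfold de, be. rewrite plus_INR, (Nat.add_comm m).
    do 3 f_equal. ring. }
  assert (E3 : rsum m al = rsum m de + p m).
  { destruct m as [|m']; [simpl; now rewrite p_0, Rplus_0_r|].
    rewrite <- (rsum_rev m' al).
    assert (E4 : rsum (S m') (fun i => al (m' - i)%nat)
                 = rsum (S m') (fun i => de (S i))).
    { apply rsum_ext. intros i Hi. unfold al, de.
      replace (m' - i - S m' + (S m' - (m' - i)))%nat with (S i) by lia.
      f_equal. rewrite minus_INR by lia. rewrite <- cos_neg. f_equal.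
      rewrite !S_INR. ring. }
    rewrite E4. assert (E5 := rsum_first (S m') de).
    assert (E6 : de 0%nat = 0) by (unfold de; rewrite p_0; ring).
    assert (E7 : de (S m') = p (S m')).
    { unfold de. replace ((INR (S m') - INR (S m')) * y) with 0 by ring.
      rewrite cos_0. ring. }
    change (rsum (S (S m')) de) with (rsum (S m') de + de (S m')) in E5. lra. }
  rewrite E2, E3. ring.
Qed.

Lemma column_series (k : nat) : (1 <= k)%nat ->
  is_series (fun m => p m * kernel p k m) (4 * (symbol k * p k)).
Proof.
  intros Hk. assert (H := is_lim_seq_scal_l _ 4 _ (p_eq k Hk)).
  apply is_lim_seq_incr_1 in H.
  refine (is_lim_seq_ext _ (sum_n (fun m => p m * kernel p k m))
            (Finite (4 * (symbol k * p k))) _ H).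
  intros n. rewrite sum_n_rsum. unfold quad, bilin. field.
Qed.

(** For j = |k - m| or j = k + m one has 2 (m + j) >= k + m. Half of the decay of p_m p_j thus
    factors into a power in [k] and one in [m], which is the domination that [fubini_series] asks
    for. *)
Lemma kernel_decay (k m : nat) :
  Rabs (p m * kernel p k m) <= 2 * (C * C) * sqrt rho ^ k * sqrt rho ^ m.
Proof.
  set (s := sqrt rho).
  assert (Hs0 : 0 < s) by (apply sqrt_lt_R0; lra).
  assert (Hss : s * s = rho) by (apply sqrt_sqrt; lra).
  assert (Hs1 : s < 1) by nra.
  assert (HC : 0 <= C).
  { assert (A := p_decay 0). rewrite p_0 in A. simpl in A. lra. }
  rewrite Rabs_pos_eq by (apply Rmult_le_pos; auto; now apply kernel_nonneg).
  assert (P : forall j, (k + m <= 2 * m + 2 * j)%nat -> p m * p j <= C * C * (s ^ k * s ^ m)).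
  { intros j Hj.
    apply Rle_trans with (C * rho ^ m * (C * rho ^ j)).
    - apply Rmult_le_compat; auto.
    - replace (C * rho ^ m * (C * rho ^ j)) with (C * C * (rho ^ m * rho ^ j)) by ring.
      apply Rmult_le_compat_l; [nra|].
      rewrite <- !pow_add, <- Hss. replace (s * s) with (s ^ 2) by ring.
      rewrite <- pow_mult.
      apply pow_antitone; [lra|lia]. }
  unfold kernel. rewrite Rmult_plus_distr_l.
  assert (A := P (k - m + (m - k))%nat ltac:(lia)). assert (B := P (k + m)%nat ltac:(lia)).
  lra.
Qed.

(** The numbering starts at k = 1, so all frequencies are at least 1 and may be divided out. The
    derivative of [prim] below is minus the Hilbert transform of [profile]. *)
Let amps (j : nat) : R := p (S j).
Let freq (j : nat) : R := INR (S j).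
Let prim (y : R) : R := trig (fun j => amps j / freq j) freq (fun _ => 0) y.

Lemma amps_fast : fast amps.
Proof.
  exists (C * rho), rho. split; auto. intros k. unfold amps.
  rewrite Rabs_pos_eq by auto. eapply Rle_trans; [apply p_decay|]. simpl. lra.
Qed.

Lemma freq_linear : grows_linearly freq.
Proof.
  exists 1. intros j. unfold freq. rewrite Rabs_pos_eq by apply pos_INR.
  rewrite S_INR. lra.
Qed.

Lemma freq_pos (j : nat) : 1 <= freq j.
Proof. apply (le_INR 1). lia. Qed.

Lemma amps_div_fast : fast (fun j => amps j / freq j).
Proof.
  apply (fast_le amps); [|apply amps_fast]. intros j. unfold Rdiv. rewrite Rabs_mult.
  assert (A := Rabs_pos (amps j)). assert (B := freq_pos j).
  assert (Rabs (/ freq j) <= 1).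
  { rewrite Rabs_pos_eq by (apply Rlt_le, Rinv_0_lt_compat; lra).
    rewrite <- Rinv_1. apply Rinv_le_contravar; lra. }
  nra.
Qed.

Lemma profile_trig (y : R) : profile y = trig amps freq (fun _ => 0) y.
Proof.
  unfold profile. rewrite Series_incr_1 by apply cos_terms_summable.
  rewrite p_0, Rmult_0_l, Rplus_0_l. apply Series_ext. intros k.
  unfold amps, freq. now rewrite Rplus_0_r.
Qed.

(* The k-th cosine coefficient of this identity is the amplitude equation. *)
Lemma integrated_equation (y : R) :
  speed * profile y - prim y - / 2 * (profile y * profile y)
  = - / 4 * Series (fun m => p m * p m).
Proof.
  (* The double series is summed in two ways: over [k] first, where [row_series] produces the square
     of [profile], and over [m] first, where the amplitude equations produce the linear terms. *)
  set (t := fun k m => p m * kernel p k m * cos (INR k * y)).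
  set (s := sqrt rho).
  assert (Hs0 : 0 < s) by (apply sqrt_lt_R0; lra).
  assert (Hs1 : s < 1) by (rewrite <- sqrt_1; apply sqrt_lt_1; lra).
  assert (Hgeo : ex_series (fun k => s ^ k)).
  { apply ex_series_geom. rewrite Rabs_pos_eq; lra. }
  assert (HC : 0 <= C * C) by apply Rle_0_sqr.
  assert (Sq : ex_series (fun m => p m * p m)).
  { apply (ex_series_le (fun m => p m * p m) (fun m => C * Rabs (p m))).
    - intros m. change (Rabs (p m * p m) <= C * Rabs (p m)). rewrite Rabs_mult.
      apply Rmult_le_compat_r; [apply Rabs_pos|]. rewrite Rabs_pos_eq by auto.
      eapply Rle_trans; [apply p_decay|].
      assert (C0 : 0 <= C) by (assert (A := p_decay 0); rewrite p_0 in A; simpl in A; lra).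
      assert (rho ^ m <= 1) by (rewrite <- (pow1 m); apply pow_incr; lra). nra.
    - apply (ex_series_scal_l C (fun m => Rabs (p m))), p_summable. }
  assert (Fub : is_series (fun k => Series (t k))
                  (Series (fun m => Series (fun k => t k m)))).
  { apply fubini_series with (A := fun k => 2 * (C * C) * s ^ k) (B := fun m => s ^ m).
    - intros k. apply Rmult_le_pos; [lra|]. apply pow_le; lra.
    - intros k. apply pow_le; lra.
    - apply (ex_series_scal_l (2 * (C * C)) _ Hgeo).
    - exact Hgeo.
    - intros k m. unfold t. rewrite Rabs_mult. assert (K := kernel_decay k m). fold s in K.
      assert (B := cos_bound (INR k * y)).
      assert (P := Rabs_pos (p m * kernel p k m)). nra. }
  assert (R1 : Series (fun m => Series (fun k => t k m))
    = 2 * (profile y * profile y) + Series (fun m => p m * p m)).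
  { rewrite (Series_ext _ (fun m => 2 * profile y * (p m * cos (INR m * y)) + p m * p m)).
    - rewrite Series_plus; auto.
      + rewrite Series_scal_l. fold (profile y). ring.
      + apply (ex_series_scal_l (2 * profile y) (fun m => p m * cos (INR m * y))).
        apply cos_terms_summable.
    - intros m. unfold t.
      rewrite (Series_ext _ (fun k => p m * (kernel p k m * cos (INR k * y))))
        by (intros; ring).
      rewrite Series_scal_l, row_series. ring. }
  assert (R2 : Series (fun k => Series (t k))
    = 2 * Series (fun m => p m * p m) + 4 * (speed * profile y - prim y)).
  { rewrite Series_incr_1 by (eexists; exact Fub). f_equal.
    - unfold t. rewrite (Series_ext _ (fun m => 2 * (p m * p m))).
      + apply Series_scal_l.
      + intros m. unfold kernel. simpl INR. rewrite Rmult_0_l, cos_0.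
        replace (0 - m + (m - 0))%nat with m by lia. simpl Nat.add. ring.
    - rewrite profile_trig. unfold prim, trig.
      assert (E1 := trig_summable amps freq (fun _ => 0) y (fast_summable _ amps_fast)).
      assert (E2 := trig_summable _ freq (fun _ => 0) y (fast_summable _ amps_div_fast)).
      rewrite <- Series_scal_l, <- Series_minus; auto.
      + rewrite <- Series_scal_l. apply Series_ext. intros k. unfold t.
        rewrite Series_scal_r, (is_series_unique _ _ (column_series (S k) ltac:(lia))).
        unfold symbol, amps, freq. rewrite Rplus_0_r. field.
        apply not_0_INR. lia.
      + apply (ex_series_scal_l speed (fun j => amps j * cos (freq j * y + 0))). exact E1. }
  apply is_series_unique in Fub. rewrite R1, R2 in Fub. lra.
Qed.

Let dprofile : R -> R := trig (fun j => amps j * freq j) freq (fun _ => 0 + PI / 2).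
Let dprim : R -> R := trig amps freq (fun _ => 0 + PI / 2).

Lemma profile_derive (y : R) : is_derive profile y (dprofile y).
Proof.
  apply is_derive_ext with (trig amps freq (fun _ => 0)).
  - intros x. symmetry. apply profile_trig.
  - apply trig_derive_fast; auto using amps_fast, freq_linear.
Qed.

Lemma prim_derive (y : R) : is_derive prim y (dprim y).
Proof.
  replace (dprim y) with (trig (fun j => amps j / freq j * freq j) freq
    (fun _ => 0 + PI / 2) y).
  - apply trig_derive_fast; auto using amps_div_fast, freq_linear.
  - apply trig_ext. intros j. assert (A := freq_pos j). f_equal. field. lra.
Qed.

Lemma differentiated_equation (y : R) :
  speed * dprofile y - dprim y - profile y * dprofile y = 0.
Proof.
  assert (D : is_derive
    (fun x => speed * profile x - prim x - / 2 * (profile x * profile x)) y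
    (speed * dprofile y - dprim y - profile y * dprofile y)).
  { assert (X1 : ex_derive profile y) by (eexists; apply profile_derive).
    assert (X2 : ex_derive prim y) by (eexists; apply prim_derive).
    auto_derive.
    - tauto.
    - replace (Derive (fun x => profile x) y) with (dprofile y)
        by (symmetry; apply is_derive_unique, profile_derive).
      replace (Derive (fun x => prim x) y) with (dprim y)
        by (symmetry; apply is_derive_unique, prim_derive).
      field. }
  apply (is_derive_ext _ (fun _ => - / 4 * Series (fun m => p m * p m))) in D;
    [|intros x; apply integrated_equation].
  apply is_derive_unique in D. rewrite Derive_const in D. auto.
Qed.

Definition wave : R -> R := trig (fun j => - amps j) freq (fun j => freq j * PI).

Definition wave_hilbert : R -> R :=
  trig (fun j => - amps j) freq (fun j => freq j * PI - PI / 2).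

Let dwave : R -> R := trig (fun j => - amps j * freq j) freq (fun j => freq j * PI + PI / 2).

Lemma neg_amps_fast : fast (fun j => - amps j).
Proof. apply (fast_le amps); [|apply amps_fast]. intros k. rewrite Rabs_Ropp. lra. Qed.

Lemma wave_derive (x : R) : is_derive wave x (dwave x).
Proof. apply trig_derive_fast; auto using neg_amps_fast, freq_linear. Qed.

Lemma trig_opp (b K phi : nat -> R) (x : R) : trig (fun j => - b j) K phi x = - trig b K phi x.
Proof.
  unfold trig. rewrite <- Series_opp. apply Series_ext. intros; ring.
Qed.

Lemma wave_profile (x : R) : wave x = - profile (x + PI).
Proof.
  rewrite profile_trig. unfold wave. rewrite trig_opp. f_equal.
  apply trig_ext. intros j. do 2 f_equal. ring.
Qed.

Lemma wave_equation (x : R) :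
  speed * dwave x + wave_hilbert x + wave x * dwave x = 0.
Proof.
  assert (E1 : dwave x = - dprofile (x + PI)).
  { unfold dwave, dprofile. rewrite <- trig_opp. apply trig_ext. intros j.
    replace (freq j * (x + PI) + (0 + PI / 2)) with (freq j * x + (freq j * PI + PI / 2))
      by ring. ring. }
  assert (E2 : wave_hilbert x = dprim (x + PI)).
  { unfold wave_hilbert, dprim. apply trig_ext. intros j.
    replace (freq j * (x + PI) + (0 + PI / 2))
      with (freq j * x + (freq j * PI - PI / 2) + PI) by field.
    rewrite neg_cos. ring. }
  rewrite E1, E2, wave_profile. assert (D := differentiated_equation (x + PI)). lra.
Qed.

Lemma wave_on_torus : on_torus wave.
Proof. apply (trig_on_torus (fun j => - amps j) S). Qed.

Lemma wave_smooth : smooth wave.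
Proof.
  intros n x. destruct (trig_derive_n (fun j => - amps j) freq (fun j => freq j * PI) n
    neg_amps_fast freq_linear) as (b & psi & _ & _ & H). apply H.
Qed.

Lemma wave_even : even_function wave.
Proof.
  intros x. apply trig_ext. intros j. f_equal. unfold freq.
  rewrite <- cos_neg, <- (cos_period _ (S j)). f_equal. ring.
Qed.

Lemma wave_mean : RInt wave (- PI) PI = 0.
Proof.
  apply is_RInt_unique. apply (trig_RInt (fun j => - amps j) S).
  - apply neg_amps_fast.
  - apply freq_linear.
  - intros; lia.
Qed.

Lemma profile_0 : profile 0 = Series p.
Proof.
  apply Series_ext. intros k. rewrite Rmult_0_r, cos_0. ring.
Qed.

Lemma wave_nonzero : wave PI <> 0.
Proof.
  rewrite wave_profile.
  assert (E : profile (PI + PI) = profile 0).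
  { replace (PI + PI) with (0 + 2 * PI) by ring. rewrite !profile_trig.
    apply (trig_on_torus amps S). }
  rewrite E, profile_0.
  assert (A := Series_nonneg_term p 1 p_nonneg p_ex_series). lra.
Qed.

(* At x = PI all the cosines equal 1, so the minimum of [wave] is attained there
   and, as p_1 > 0, only there modulo 2 PI. *)
Lemma wave_period (T : R) : 0 < T -> periodic T wave -> 2 * PI <= T.
Proof.
  intros HT Hper. destruct (Rle_lt_dec (2 * PI) T) as [|Hlt]; auto. exfalso.
  assert (E : profile T = profile 0).
  { assert (A := Hper (- PI)). rewrite !wave_profile in A.
    replace (- PI + T + PI) with T in A by ring.
    replace (- PI + PI) with 0 in A by ring. lra. }
  rewrite profile_0 in E.
  assert (Hd : ex_series (fun k => p k * (1 - cos (INR k * T)))).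
  { apply (ex_series_ext (fun k => p k - p k * cos (INR k * T))).
    { intros k. change (p k - p k * cos (INR k * T) = p k * (1 - cos (INR k * T))). ring. }
    apply (ex_series_minus p (fun k => p k * cos (INR k * T))).
    - apply p_ex_series.
    - apply cos_terms_summable. }
  assert (Z : Series (fun k => p k * (1 - cos (INR k * T))) = 0).
  { rewrite (Series_ext _ (fun k => p k - p k * cos (INR k * T))) by (intros; ring).
    rewrite Series_minus by (apply p_ex_series || apply cos_terms_summable).
    unfold profile in E. lra. }
  assert (A := Series_nonneg_term (fun k => p k * (1 - cos (INR k * T))) 1).
  cbv beta in A. rewrite Z, Rmult_1_l in A.
  assert (Hn : nonneg (fun k => p k * (1 - cos (INR k * T)))).
  { intros k. apply Rmult_le_pos; auto. destruct (COS_bound (INR k * T)). lra. }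
  specialize (A Hn Hd).
  assert (Hsin : 0 < sin (T / 2)) by (apply sin_gt_0; lra).
  assert (Hcos : cos T = 1 - 2 * sin (T / 2) * sin (T / 2)).
  { rewrite <- cos_2a_sin. f_equal. field. }
  rewrite Hcos in A.
  assert (0 < p 1%nat * (2 * sin (T / 2) * sin (T / 2)))
    by (repeat apply Rmult_lt_0_compat; lra).
  lra.
Qed.

(** The Hilbert transform must be identified at every time, hence for every translate [s] of the
    rescaled wave; the translation enters only through the phases. *)
Lemma wave_scaled_trig (n : nat) (s x : R) :
  / INR n * wave (INR n * (x + s))
  = trig (fun j => - amps j * / INR n) (fun j => INR (n * S j))
      (fun j => INR n * freq j * s + freq j * PI) x.
Proof.
  unfold wave, trig. rewrite <- Series_scal_l. apply Series_ext. intros j.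
  rewrite mult_INR. unfold freq.
  replace (INR (S j) * (INR n * (x + s)) + INR (S j) * PI)
    with (INR n * INR (S j) * x + (INR n * INR (S j) * s + INR (S j) * PI)) by ring.
  ring.
Qed.

Lemma wave_hilbert_scaled_trig (n : nat) (s x : R) :
  / INR n * wave_hilbert (INR n * (x + s))
  = trig (fun j => - amps j * / INR n) (fun j => INR (n * S j))
      (fun j => INR n * freq j * s + freq j * PI - PI / 2) x.
Proof.
  unfold wave_hilbert, trig. rewrite <- Series_scal_l. apply Series_ext. intros j.
  rewrite mult_INR. unfold freq.
  replace (INR (S j) * (INR n * (x + s)) + (INR (S j) * PI - PI / 2))
    with (INR n * INR (S j) * x + (INR n * INR (S j) * s + INR (S j) * PI - PI / 2)) by ring.
  ring.
Qed.

Lemma scaled_hilbert (n : nat) (s : R) : (1 <= n)%nat ->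
  is_hilbert (fun x => / INR n * wave (INR n * (x + s)))
             (fun x => / INR n * wave_hilbert (INR n * (x + s))).
Proof.
  intros Hn.
  replace (fun x => / INR n * wave (INR n * (x + s)))
    with (trig (fun j => - amps j * / INR n) (fun j => INR (n * S j))
           (fun j => INR n * freq j * s + freq j * PI))
    by (apply functional_extensionality; intros; now rewrite wave_scaled_trig).
  replace (fun x => / INR n * wave_hilbert (INR n * (x + s)))
    with (trig (fun j => - amps j * / INR n) (fun j => INR (n * S j))
           (fun j => INR n * freq j * s + freq j * PI - PI / 2))
    by (apply functional_extensionality; intros; now rewrite wave_hilbert_scaled_trig).
  assert (N1 : 1 <= INR n) by now apply (le_INR 1).
  apply (trig_hilbert _ (fun j => (n * S j)%nat)).
  - apply fast_mult_linear with 1; [|apply neg_amps_fast]. intros k.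
    rewrite Rabs_pos_eq by (apply Rlt_le, Rinv_0_lt_compat; lra).
    assert (0 <= INR k) by apply pos_INR.
    assert (/ INR n <= / 1) by (apply Rinv_le_contravar; lra). lra.
  - exists (INR n). intros j. rewrite Rabs_pos_eq by apply pos_INR.
    rewrite mult_INR, S_INR. lra.
  - intros j. nia.
Qed.

Lemma scaled_traveling (n : nat) : (1 <= n)%nat ->
  traveling_wave (speed / INR n) (fun x => / INR n * wave (INR n * x)).
Proof.
  intros Hn. assert (N1 : 1 <= INR n) by now apply (le_INR 1).
  set (c := speed / INR n).
  assert (Dx : forall x t, is_derive (fun y => / INR n * wave (INR n * (y + c * t))) x
                 (dwave (INR n * (x + c * t)))).
  { intros x t.
    assert (X : ex_derive wave (INR n * (x + c * t))) by (eexists; apply wave_derive).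
    auto_derive; [auto|].
    replace (Derive (fun x => wave x) (INR n * (x + c * t)))
        with (dwave (INR n * (x + c * t)))
        by (symmetry; apply is_derive_unique, wave_derive).
      field. lra. }
  assert (Dt : forall x t, is_derive (fun r => / INR n * wave (INR n * (x + c * r))) t
                 (c * dwave (INR n * (x + c * t)))).
  { intros x t.
    assert (X : ex_derive wave (INR n * (x + c * t))) by (eexists; apply wave_derive).
    auto_derive; [auto|].
    replace (Derive (fun x => wave x) (INR n * (x + c * t)))
        with (dwave (INR n * (x + c * t)))
        by (symmetry; apply is_derive_unique, wave_derive).
      field. lra. }
  split; [|split].
  - intros t x.
    rewrite !wave_scaled_trig.
    apply (trig_on_torus _ (fun j => (n * S j)%nat)).
  - intros x t. split; eexists; [apply Dx|apply Dt].
  - intros t. exists (fun x => / INR n * wave_hilbert (INR n * (x + c * t))). split.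
    + now apply scaled_hilbert.
    + intros x. cbv beta.
      replace (Derive (fun r => / INR n * wave (INR n * (x + c * r))) t)
        with (c * dwave (INR n * (x + c * t)))
        by (symmetry; apply is_derive_unique, Dt).
      replace (Derive (fun y => / INR n * wave (INR n * (y + c * t))) x)
        with (dwave (INR n * (x + c * t))) by (symmetry; apply is_derive_unique, Dx).
      assert (E := wave_equation (INR n * (x + c * t))).
      set (y := INR n * (x + c * t)) in *.
      (* Since the factor [INR n] of the chain rule cancels [/ INR n] in the space derivative, each
         term of the equation at scale [n] is [/ INR n] times its counterpart at scale 1. *)
      replace (c * dwave y + / INR n * wave_hilbert y + / INR n * wave y * dwave y)
        with (/ INR n * (speed * dwave y + wave_hilbert y + wave y * dwave y))
        by (unfold c; field; lra).
      rewrite E. ring.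
Qed.

Lemma scaled_minimal_period (n : nat) : (1 <= n)%nat ->
  minimal_period (2 * PI / INR n) (fun x => / INR n * wave (INR n * x)).
Proof.
  intros Hn. assert (N1 : 1 <= INR n) by now apply (le_INR 1). assert (P := PI_RGT_0).
  split; [|split].
  - apply Rdiv_lt_0_compat; lra.
  - intros x. f_equal. replace (INR n * (x + 2 * PI / INR n)) with (INR n * x + 2 * PI)
      by (field; lra). apply wave_on_torus.
  - intros T HT Hper.
    assert (2 * PI <= INR n * T).
    { apply wave_period; [nra|]. intros x. assert (A := Hper (x / INR n)). cbv beta in A.
      replace (INR n * (x / INR n + T)) with (x + INR n * T) in A by (field; lra).
      replace (INR n * (x / INR n)) with x in A by (field; lra).
      apply Rmult_eq_reg_l in A; auto. apply Rinv_neq_0_compat. lra. }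
    apply Rmult_le_reg_l with (INR n); [lra|].
    replace (INR n * (2 * PI / INR n)) with (2 * PI) by (field; lra). auto.
Qed.

Lemma wave_hilbert_pair : is_hilbert wave wave_hilbert.
Proof.
  assert (H := scaled_hilbert 1 0 (le_n 1)).
  replace (fun x => / INR 1 * wave (INR 1 * (x + 0))) with wave in H
    by (apply functional_extensionality; intros; simpl; rewrite Rinv_1, !Rmult_1_l;
        now rewrite Rplus_0_r).
  replace (fun x => / INR 1 * wave_hilbert (INR 1 * (x + 0))) with wave_hilbert in H
    by (apply functional_extensionality; intros; simpl; rewrite Rinv_1, !Rmult_1_l;
        now rewrite Rplus_0_r).
  exact H.
Qed.

Lemma wave_traveling : traveling_wave speed wave.
Proof.
  assert (H := scaled_traveling 1 (le_n 1)).
  replace (fun x => / INR 1 * wave (INR 1 * x)) with wave in H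
    by (apply functional_extensionality; intros; simpl; now rewrite Rinv_1, !Rmult_1_l).
  replace (speed / INR 1) with speed in H by (simpl; field). exact H.
Qed.

Lemma wave_derivative_equation (x : R) :
  speed * Derive wave x + wave_hilbert x + wave x * Derive wave x = 0.
Proof.
  rewrite (is_derive_unique _ _ _ (wave_derive x)). apply wave_equation.
Qed.
End Wave.

Theorem theorem2p1 :
  let c := 1.109643839000099 in
  exists v : R -> R,
    on_torus v /\ smooth v /\ even_function v /\
    RInt v (- PI) PI = 0 /\
    (exists x, v x <> 0) /\
    traveling_wave c v /\
    (exists Hv : R -> R,
       is_hilbert v Hv /\
       forall x, c * Derive v x + Hv x + v x * Derive v x = 0) /\
    (forall n : nat, (2 <= n)%nat -> ~ periodic (2 * PI / INR n) v) /\
    (forall n : nat, (1 <= n)%nat ->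
       traveling_wave (c / INR n) (fun x => / INR n * v (INR n * x)) /\
       minimal_period (2 * PI / INR n) (fun x => / INR n * v (INR n * x))).
Proof.
  intros c. change c with speed.
  destruct amplitudes_exist as (p & Hp & Hp0 & Hp1 & (C & rho & Hrho & Hdecay) & Heq).
  exists (wave p).
  split; [apply wave_on_torus|].
  split; [now apply (wave_smooth p Hp C rho)|].
  split; [apply wave_even|].
  split; [now apply (wave_mean p Hp C rho)|].
  split; [exists PI; now apply (wave_nonzero p Hp Hp0 Hp1 C rho)|].
  split; [now apply (wave_traveling p Hp Hp0 C rho)|].
  split; [|split].
  - exists (wave_hilbert p). split; [now apply (wave_hilbert_pair p Hp C rho)|].
    now apply (wave_derivative_equation p Hp Hp0 C rho).
  - intros n Hn Hper. assert (N2 : 2 <= INR n) by now apply (le_INR 2).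
    assert (P := PI_RGT_0).
    assert (L : 2 * PI <= 2 * PI / INR n).
    { apply (wave_period p Hp Hp0 Hp1 C rho); auto. apply Rdiv_lt_0_compat; lra. }
    apply (Rmult_le_compat_r (INR n)) in L; [|lra].
    replace (2 * PI / INR n * INR n) with (2 * PI) in L by (field; lra). nra.
  - intros n Hn. split.
    + now apply (scaled_traveling p Hp Hp0 C rho).
    + now apply (scaled_minimal_period p Hp Hp0 Hp1 C rho).
Qed.
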